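(* There exist two algorithms with the following guarantees. (Identity) Given the full description of a Bayes net $Q$ over $\{0,1\}^n$ of degree at most $d$, a parameter $\epsilon\in(0,1]$, and sample access to a distribution $P$ promised to be a Bayes net (i) of degree at most $d$ and (ii) such that the structures of $P$ and $Q$ give the same ordering to nodes, the first algorithm takes $N=2^{d/2}\mathrm{poly}(n/\epsilon)$ samples from $P$, runs in time $n^d\mathrm{poly}(N)$, and distinguishes with probability at least $2/3$ between (i) $P=Q$ and (ii) $\|P-Q\|_1>\epsilon$. (Closeness) Given a parameter $\epsilon\in(0,1]$ and sample access to two distributions $P,Q$ promised to be Bayes nets (i) of degree at most $d$ and (ii) such that the structures of $P$ and $Q$ give the same ordering to nodes, the second algorithm takes $N=2^{2d/3}\mathrm{poly}(n/\epsilon)$ samples from $P$ and $Q$, runs in time $n^d\mathrm{poly}(N)$, and distinguishes with probability at least $2/3$ between (i) $P=Q$ and (ii) $\|P-Q\|_1>\epsilon$.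
   Context: A Bayes net with structure $\mathcal{S}$ (a DAG on $[n]$; degree = maximum in-degree) is a distribution on $\{0,1\}^n$ in which, under a topological order of $\mathcal{S}$, $\Pr[X_i=1\mid\text{earlier coordinates}]$ depends only on the coordinates at the parents of $i$. Two structures ''give the same ordering to nodes'' if there is a common ordering of $[n]$ that is a topological order for both DAGs. $\|P-Q\|_1=\sum_x|P(x)-Q(x)|$. *)

(* Defs.v *)
From HB Require Import structures.
From mathcomp Require Import all_boot all_order all_fingroup all_algebra.

Set Implicit Arguments.
Unset Strict Implicit.
Unset Printing Implicit Defensive.

Import Order.TTheory GRing.Theory Num.Theory.
Local Open Scope ring_scope.

(* Distributions on {0,1}^n, whose points are the elements of [n.-tuple bool]. *)

Section Distributions.
Variables (R : realFieldType) (n : nat).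
Implicit Types (P Q : {ffun n.-tuple bool -> R}) (x y : n.-tuple bool).

Definition is_dist P : Prop := (forall x, 0 <= P x) /\ \sum_x P x = 1.

Definition l1dist P Q : R := \sum_x `|P x - Q x|.

Definition prob P (A : {set n.-tuple bool}) : R := \sum_(x in A) P x.

Definition cprob P (A B : {set n.-tuple bool}) : R :=
  prob P (A :&: B) / prob P B.

Definition coord_one (i : 'I_n) : {set n.-tuple bool} := [set y | tnth y i].

Definition agree (J : {set 'I_n}) x : {set n.-tuple bool} :=
  [set y | [forall j in J, tnth y j == tnth x j]].

End Distributions.

(* Structures are directed graphs on 'I_n; [S j i] is the edge j -> i, that is,
   "j is a parent of i". *)

Section Structures.
Variable n : nat.
Implicit Types (S : rel 'I_n) (s : 'S_n) (i j : 'I_n).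

Definition is_dag S : Prop := forall j i, S j i -> ~~ connect S i j.

Definition parents S i : {set 'I_n} := [set j | S j i].

Definition degree S : nat := \max_(i < n) #|parents S i|.

(* An ordering of the nodes is given by the position [s i] of each node [i]. *)
Definition topological S s : Prop := forall j i, S j i -> (s j < s i)%N.

Definition earlier s i : {set 'I_n} := [set j | (s j < s i)%N].

Definition same_ordering S S' : Prop :=
  exists s : 'S_n, topological S s /\ topological S' s.

End Structures.

(* The conditional probability is only constrained at histories of positive
   probability, where it is defined. *)
Definition bayes_net (R : realFieldType) (n : nat) (S : rel 'I_n)
    (P : {ffun n.-tuple bool -> R}) : Prop :=
  [/\ is_dag S, is_dist P &
      exists s : 'S_n, topological S s /\
        forall (i : 'I_n) (x y : n.-tuple bool),
          0 < prob P (agree (earlier s i) x) ->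
          0 < prob P (agree (earlier s i) y) ->
          y \in agree (parents S i) x ->
          cprob P (coord_one i) (agree (earlier s i) x) =
          cprob P (coord_one i) (agree (earlier s i) y)].

(* The number in [0, 2 ^ #|parents S i|) whose binary digits, least significant
   first, are the values in x of the parents of i in increasing order. *)
Definition parent_code (n : nat) (S : rel 'I_n) (i : 'I_n)
    (x : n.-tuple bool) : nat :=
  (\sum_(j in parents S i)
     tnth x j * 2 ^ #|[set k in parents S i | (k < j)%N]|)%N.

(* (S, theta) is a full description of the Bayes net Q: theta i a is the
   probability of X_i = 1 given that the parents of i are in configuration a.
   For configurations of probability zero it is any element of [0, 1]. *)
Definition describes (R : realFieldType) (n : nat) (S : rel 'I_n)
    (theta : 'I_n -> nat -> R) (Q : {ffun n.-tuple bool -> R}) : Prop :=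
  bayes_net S Q /\
  forall (i : 'I_n) (x : n.-tuple bool),
    0 <= theta i (parent_code S i x) <= 1 /\
    (0 < prob Q (agree (parents S i) x) ->
     theta i (parent_code S i x) =
     cprob Q (coord_one i) (agree (parents S i) x)).

(* Algorithms are programs for a probabilistic real RAM. There is a memory of
   natural numbers and a memory of real numbers, both with indirect addressing.
   The unit-cost operations are (truncated) addition and subtraction of natural
   numbers, the field operations on reals, conversion from naturals to reals,
   comparisons, one fair coin toss, and one draw from a sample source. Naturals
   have no unit-cost multiplication, reals have no rounding operation, and no
   real constants other than images of naturals are available. The two sample
   sources are named by booleans. *)

Inductive nexp : Type :=
| NNum of nat
| NMem of nexp
| NAdd of nexp & nexp
| NSub of nexp & nexp
| NBit of bool & nexp. (* coordinate of the latest sample from a source *)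

Inductive rexp : Type :=
| RNat of nexp
| RMem of nexp
| RAdd of rexp & rexp
| ROpp of rexp
| RMul of rexp & rexp
| RInv of rexp. (* total, with 0^-1 = 0 *)

Inductive bexp : Type :=
| BLeN of nexp & nexp
| BLeR of rexp & rexp
| BNot of bexp
| BAnd of bexp & bexp.

Inductive cmd : Type :=
| CSkip
| CSetN of nexp & nexp (* address, value *)
| CSetR of nexp & rexp (* address, value *)
| CCoin of nexp        (* address receiving the coin *)
| CDraw of bool        (* source *)
| CSeq of cmd & cmd
| CIf of bexp & cmd & cmd
| CWhile of bexp & cmd.

Section Machine.
Variable R : realFieldType.

Record state : Type := State {
  nmem : nat -> nat;
  rmem : nat -> R;
  latest : bool -> seq bool;       (* latest sample drawn from each source *)
  coins : seq bool;                (* coin tosses to come *)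
  samples : bool -> seq (seq bool) (* samples to come from each source *)
}.

Definition upd (K : eqType) (V : Type) (f : K -> V) (k : K) (v : V) : K -> V :=
  fun k' => if k' == k then v else f k'.

Fixpoint neval (s : state) (e : nexp) : nat :=
  match e with
  | NNum k => k
  | NMem a => nmem s (neval s a)
  | NAdd e1 e2 => (neval s e1 + neval s e2)%N
  | NSub e1 e2 => (neval s e1 - neval s e2)%N
  | NBit src e1 => nth false (latest s src) (neval s e1)
  end.

Fixpoint reval (s : state) (e : rexp) : R :=
  match e with
  | RNat e1 => (neval s e1)%:R
  | RMem a => rmem s (neval s a)
  | RAdd e1 e2 => reval s e1 + reval s e2
  | ROpp e1 => - reval s e1
  | RMul e1 e2 => reval s e1 * reval s e2
  | RInv e1 => (reval s e1)^-1
  end.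

Fixpoint beval (s : state) (b : bexp) : bool :=
  match b with
  | BLeN e1 e2 => (neval s e1 <= neval s e2)%N
  | BLeR e1 e2 => reval s e1 <= reval s e2
  | BNot b1 => ~~ beval s b1
  | BAnd b1 b2 => beval s b1 && beval s b2
  end.

(* The commands still to be executed, and the current state. *)
Definition config : Type := (seq cmd * state)%type.

(* Time is the number of steps. A step evaluates at most a constant number,
   depending on the program only, of unit-cost operations. A halted
   configuration is stationary, and so is one that waits for a coin or a sample
   which is not available; the latter has not halted. *)
Definition step (c : config) : config :=
  let: (todo, s) := c in
  match todo with
  | [::] => c
  | CSkip :: k => (k, s)
  | CSetN a e :: k =>
      (k, State (upd (nmem s) (neval s a) (neval s e)) (rmem s)
                (latest s) (coins s) (samples s))
  | CSetR a e :: k =>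
      (k, State (nmem s) (upd (rmem s) (neval s a) (reval s e))
                (latest s) (coins s) (samples s))
  | CCoin a :: k =>
      if coins s is b :: bs then
        (k, State (upd (nmem s) (neval s a) (nat_of_bool b)) (rmem s)
                  (latest s) bs (samples s))
      else c
  | CDraw src :: k =>
      if samples s src is x :: xs then
        (k, State (nmem s) (rmem s) (upd (latest s) src x)
                  (coins s) (upd (samples s) src xs))
      else c
  | CSeq c1 c2 :: k => (c1 :: c2 :: k, s)
  | CIf b c1 c2 :: k => ((if beval s b then c1 else c2) :: k, s)
  | CWhile b c1 :: k => (if beval s b then c1 :: CWhile b c1 :: k else k, s)
  end.

Definition input : Type := (seq nat * seq R)%type.

Definition start (A : cmd) (inp : input) (cs : seq bool)
    (xs ys : seq (seq bool)) : config :=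
  ([:: A], State (nth 0%N inp.1) (nth 0 inp.2) (fun=> [::]) cs
                 (fun src => if src then ys else xs)).

Definition run (T : nat) (A : cmd) (inp : input) (cs : seq bool)
    (xs ys : seq (seq bool)) : config :=
  iter T step (start A inp cs xs ys).

Definition halted (c : config) : bool := nilp c.1.

(* The answer of a halted program; true means "P = Q". *)
Definition answer (c : config) : bool := nmem c.2 0 == 1%N.

Definition tape (n N : nat) (x : N.-tuple (n.-tuple bool)) : seq (seq bool) :=
  [seq tval y | y <- x].

(* Whatever the coins and the samples, A halts within T steps, after exactly N
   draws from the first source and N' draws from the second one. *)
Definition takes (A : cmd) (inp : input) (n T N N' : nat) : Prop :=
  forall (cs : T.-tuple bool) (x : N.-tuple (n.-tuple bool))
         (y : N'.-tuple (n.-tuple bool)),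
    let c := run T A inp cs (tape x) (tape y) in
    [/\ halted c, samples c.2 false = [::] & samples c.2 true = [::]].

(* The probability that A halts within T steps with answer b, for independent
   fair coins, N independent samples from P and N' independent samples from Q;
   T steps toss at most T coins. *)
Definition prob_answer (A : cmd) (inp : input) (n T N N' : nat)
    (P Q : {ffun n.-tuple bool -> R}) (b : bool) : R :=
  \sum_(cs : T.-tuple bool) \sum_(x : N.-tuple (n.-tuple bool))
    \sum_(y : N'.-tuple (n.-tuple bool) |
            let c := run T A inp cs (tape x) (tape y) in
            halted c && (answer c == b))
      2^-1 ^+ T * (\prod_(k < N) P (tnth x k)) * (\prod_(k < N') Q (tnth y k)).

Definition closeness_input (n d : nat) (eps : R) : input :=
  ([:: n; d], [:: eps]).

(* The naturals are n, d and the adjacency matrix of S, with rows indexed by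
   children; the reals are eps and, node by node, 2 ^ d entries of the
   conditional probability table, of which the first 2 ^ #|parents S i| are
   meaningful. *)
Definition identity_input (n d : nat) (eps : R) (S : rel 'I_n)
    (theta : 'I_n -> nat -> R) : input :=
  ([:: n; d] ++ [seq nat_of_bool (S j i) | i <- enum 'I_n, j <- enum 'I_n],
   eps :: [seq theta i a | i <- enum 'I_n, a <- iota 0 (2 ^ d)]).

End Machine.

(* Main.v *)
(* Order the nodes topologically for both nets. If P and Q are far apart in l1,
   their kernels differ: bounding l1dist P Q by a hybrid argument over the nodes and
   comparing the two conditional means of a node as optimal quadratic predictors
   shows that some marginal on dd + 1 coordinates, dd = min (d, n), is far as well
   (a node together with at most dd parents). So it suffices to compare, for each of
   the n ^ (dd + 1) tuples of coordinates, two distributions on 2 ^ (dd + 1) points.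

   This is done with the statistic
     Z = \sum_c (X_c - Y_c) (X'_c - Y'_c) / (1 + F_c),
   where X, X' count samples from P, and Y, Y', F count samples from Q. Its mean is a
   weighted squared l2 distance, and since F_c + 1 flattens Q, Chebyshev's inequality
   needs, up to powers of n / eps, h samples, with h = 2 ^ (dd / 2) if F may have
   h ^ 2 samples and h = 2 ^ (2 dd / 3) if F has h of them. The test is repeated on
   independent blocks, and a tuple rejects if Z is large on all of them; this makes the error under
   P = Q small enough for a union bound over the tuples.

   In the identity problem the samples from Q are simulated: each conditional
   probability is rounded to kc binary digits by comparing it with a uniform dyadic
   number made of kc coin tosses, which changes the law of all simulated samples by at
   most 1 / 16. Simulated samples are free, so only the h samples from P count. *)

Require Import Defs.
From HB Require Import structures.
From mathcomp Require Import all_boot all_order all_fingroup all_algebra.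
From mathcomp Require Import reals exp.
From mathcomp Require Import ring lra zify.

Set Implicit Arguments.
Unset Strict Implicit.
Unset Printing Implicit Defensive.

Import Order.TTheory GRing.Theory Num.Theory.
Local Open Scope ring_scope.

(** * Expectations over independent samples *)

(** The parent sets of a node in [P] and in [Q] may differ, and comparing the two conditional laws
    directly would involve up to [2 d + 1] coordinates, which spoils both the power of 2 and the
    factor [n ^ d]. A quadratic loss only sees the node and one parent set; the price is a square,
    hence the gap [1 / D] with [D = 8 n^2 E^2] and [1 / E < eps]. In [Z] the two independent pairs
    of counts estimate the square of a difference of masses without bias, for a fixed number of
    samples and with second moments only. With [K = 2 ^ (dd + 1)], the analysis asks for
    [(K + m1)^2 <= 9 h^2 m1] and [K + m1 <= 3 h^2]. Taking [m1 = h^2] allows [h] of order [K^(1/2)];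
    taking [m1 = h] requires [K^(2/3)]. There are [t = n (dd + 3)] blocks, so that
    [n ^ (dd + 1) 2 ^- t <= 1 / 4]. In the far case a single block may err with probability
    [1 / (4 t)] only, whence the factor [t] in [m = 600 D^2 h t]. Truncating [d] at [n] keeps [t]
    polynomial in [n]: the sample bound leaves no room for a further factor [d]. *)

Section IteratedExpectation.
Variables (R : realFieldType) (T : finType).
Implicit Types (P Q : T -> R) (f g : seq T -> R).

Definition is_law P : Prop := (forall x, 0 <= P x) /\ \sum_x P x = 1.

(** Drawing one sample at a time makes the independence of consecutive segments a one-line induction
    ([Ex_cat]); [Ex_tuple] links this form to the product measure on tuples. *)
Fixpoint Ex P N f : R :=
  if N is N'.+1 then \sum_x P x * Ex P N' (fun l => f (x :: l)) else f [::].

Lemma eq_Ex P N f g :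
  (forall l, size l = N -> f l = g l) -> Ex P N f = Ex P N g.
Proof.
elim: N f g => [|N IH] f g fg /=; first exact: fg.
by apply: eq_bigr => x _; congr (_ * _); apply: IH => l sl; apply: fg; rewrite /= sl.
Qed.

Lemma Ex_tuple P N f :
  Ex P N f = \sum_(x : N.-tuple T) (\prod_(k < N) P (tnth x k)) * f x.
Proof.
elim: N f => [|N IH] f /=.
  rewrite (bigD1 [tuple]) //= big_ord0 mul1r big1 ?addr0 // => x /eqP[].
  by rewrite tuple0.
transitivity (\sum_(u : T * N.-tuple T)
    (P u.1 * \prod_(k < N) P (tnth u.2 k)) * f (u.1 :: u.2)).
  rewrite -(pair_bigA _ (fun x (y : N.-tuple T) =>
     (P x * \prod_(k < N) P (tnth y k)) * f (x :: y))) /=.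
  apply: eq_bigr => x _; rewrite IH big_distrr /=.
  by apply: eq_bigr => y _; rewrite mulrA.
rewrite (reindex (fun u : T * N.-tuple T => cons_tuple u.1 u.2)) /=; last first.
  exists (fun x : N.+1.-tuple T => (thead x, behead_tuple x)) => [[x y] _|x _] /=.
    by congr (_, _); apply: val_inj.
  by rewrite [RHS]tuple_eta; apply: val_inj.
apply: eq_bigr => [[x y]] _ /=; congr (_ * _).
rewrite big_ord_recl; congr (_ * _).
by apply: eq_bigr => k _; rewrite tnthS.
Qed.

Lemma Ex_cat P a b f :
  Ex P (a + b) f = Ex P a (fun l => Ex P b (fun l' => f (l ++ l'))).
Proof.
elim: a f => [|a IH] f //=.
by apply: eq_bigr => x _; rewrite IH.
Qed.

Lemma ExD P N f g : Ex P N (fun l => f l + g l) = Ex P N f + Ex P N g.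
Proof.
elim: N f g => [|N IH] f g //=.
by rewrite -big_split /=; apply: eq_bigr => x _; rewrite IH mulrDr.
Qed.

Lemma ExZ P N c f : Ex P N (fun l => c * f l) = c * Ex P N f.
Proof.
elim: N f => [|N IH] f //=.
by rewrite big_distrr /=; apply: eq_bigr => x _; rewrite IH mulrCA.
Qed.

Lemma ExZr P N c f : Ex P N (fun l => f l * c) = Ex P N f * c.
Proof. by rewrite mulrC -ExZ; apply: eq_Ex => l _; rewrite mulrC. Qed.

Lemma ExB P N f g : Ex P N (fun l => f l - g l) = Ex P N f - Ex P N g.
Proof.
rewrite ExD -[- Ex P N g]mulN1r -ExZ; congr (_ + _).
by apply: eq_Ex => l _; rewrite mulN1r.
Qed.

Lemma Ex_sum P N (I : finType) (F : I -> seq T -> R) :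
  Ex P N (fun l => \sum_i F i l) = \sum_i Ex P N (F i).
Proof.
elim: N F => [|N IH] F //=.
by rewrite exchange_big /=; apply: eq_bigr => x _; rewrite IH big_distrr.
Qed.

Lemma le_Ex P N f g : is_law P ->
  (forall l, size l = N -> f l <= g l) -> Ex P N f <= Ex P N g.
Proof.
move=> [P0 _]; elim: N f g => [|N IH] f g fg /=; first exact: fg.
apply: ler_sum => x _; apply: ler_wpM2l => //.
by apply: IH => l sl; apply: fg; rewrite /= sl.
Qed.

Lemma Ex_const P N c : is_law P -> Ex P N (fun=> c) = c.
Proof.
move=> [_ P1]; elim: N => [|N IH] //=.
by rewrite IH -big_distrl /= P1 mul1r.
Qed.

Lemma Ex_ge0 P N f : is_law P -> (forall l, size l = N -> 0 <= f l) ->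
  0 <= Ex P N f.
Proof. by move=> lP f0; rewrite -(Ex_const N 0 lP); apply: le_Ex. Qed.

(** The law of one sample is exchanged at a time. Each exchange costs at most the l1 distance,
    because the expectation over the remaining samples stays bounded by 1. *)
Lemma Ex_dist P Q N f : is_law P -> is_law Q -> (forall l, `|f l| <= 1) ->
  `|Ex P N f - Ex Q N f| <= N%:R * \sum_x `|P x - Q x|.
Proof.
move=> lP lQ; elim: N f => [|N IH] f f1 /=; first by rewrite subrr normr0 mul0r.
have f1' x : `|Ex P N (fun l => f (x :: l))| <= 1.
  rewrite ler_norml -{1}(Ex_const N (-1) lP) -{2}(Ex_const N 1 lP).
  by apply/andP; split; apply: le_Ex => // l _; have /ler_normlP[] := f1 (x :: l);
     lra.
have -> : \sum_x P x * Ex P N (fun l => f (x :: l)) -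
          \sum_x Q x * Ex Q N (fun l => f (x :: l)) =
  \sum_x ((P x - Q x) * Ex P N (fun l => f (x :: l)) +
     Q x * (Ex P N (fun l => f (x :: l)) - Ex Q N (fun l => f (x :: l)))).
  by rewrite -sumrB; apply: eq_bigr => x _; ring.
apply: (le_trans (ler_norm_sum _ _ _)).
rewrite -natr1 mulrDl mul1r addrC.
have -> : N%:R * (\sum_x `|P x - Q x|) =
   \sum_x Q x * (N%:R * (\sum_x `|P x - Q x|)) by rewrite -big_distrl /= lQ.2 mul1r.
rewrite -big_split; apply: ler_sum => x _ /=.
apply: (le_trans (ler_normD _ _)); rewrite !normrM (ger0_norm (lQ.1 x)).
by apply: lerD; [rewrite ler_piMr|apply: ler_wpM2l; [exact: lQ.1|exact: IH]].
Qed.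

End IteratedExpectation.

Lemma Ex_exch (R : realFieldType) (T T' : finType) (P : T -> R) (Q : T' -> R)
    a b (f : seq T -> seq T' -> R) :
  Ex P a (fun l => Ex Q b (fun l' => f l l')) =
  Ex Q b (fun l' => Ex P a (fun l => f l l')).
Proof.
elim: a f => [|a IH] f //=.
by rewrite Ex_sum; apply: eq_bigr => x _; rewrite IH ExZ.
Qed.

Section SampleSums.
Variables (R : realFieldType) (T : finType) (P : T -> R).
Hypothesis lawP : is_law P.
Implicit Types a b : T -> R.

Definition mean a : R := \sum_x P x * a x.

Lemma Ex_sum1 N a : Ex P N (fun l => \sum_(x <- l) a x) = N%:R * mean a.
Proof.
elim: N => [|N IH] /=; first by rewrite big_nil mul0r.
under eq_bigr => x _ do (under eq_Ex do rewrite big_cons; rewrite ExD Ex_const // IH).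
rewrite (eq_bigr (fun x => P x * a x + P x * (N%:R * mean a))); last by move=> x _; ring.
by rewrite big_split /= -big_distrl /= lawP.2 /mean -natr1; ring.
Qed.

(** Among the [N ^ 2] pairs of positions, the [N] diagonal ones contribute the mean of the product
    and the others the product of the means. *)
Lemma Ex_sum2 N a b :
  Ex P N (fun l => (\sum_(x <- l) a x) * (\sum_(x <- l) b x)) =
  N%:R * mean (fun x => a x * b x) + (N%:R ^+ 2 - N%:R) * (mean a * mean b).
Proof.
elim: N => [|N IH] /=; first by rewrite !big_nil; ring.
transitivity (\sum_x (P x * (a x * b x) + P x * a x * (N%:R * mean b)
   + P x * b x * (N%:R * mean a) + P x * (N%:R * mean (fun x => a x * b x) +
   (N%:R ^+ 2 - N%:R) * (mean a * mean b)))).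
  apply: eq_bigr => x _; rewrite -IH -!Ex_sum1.
  transitivity (P x * Ex P N (fun l => a x * b x + a x * (\sum_(x <- l) b x)
     + b x * (\sum_(x <- l) a x) + (\sum_(x <- l) a x) * (\sum_(x <- l) b x))).
    by congr (_ * _); apply: eq_Ex => l _; rewrite !big_cons; ring.
  by rewrite !ExD Ex_const // !ExZ; ring.
rewrite !big_split /= -!big_distrl /= lawP.2 -natr1 /mean; ring.
Qed.

(** Size-bias identity of the binomial law: weighting by the count amounts to forcing one sample
    into [A] and drawing the others afresh. *)
Lemma Ex_size_bias (A : pred T) N (psi : nat -> R) :
  Ex P N.+1 (fun l => (count A l)%:R * psi (count A l)) =
  N.+1%:R * (mean (fun x => (A x)%:R) * Ex P N (fun l => psi (count A l).+1)).
Proof.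
have step M (chi : nat -> R) : Ex P M.+1 (fun l => chi (count A l)) =
  mean (fun x => (A x)%:R) * Ex P M (fun l => chi (count A l).+1) +
  (1 - mean (fun x => (A x)%:R)) * Ex P M (fun l => chi (count A l)).
  have -> : 1 - mean (fun x => (A x)%:R) = \sum_x P x * (~~ A x)%:R.
    rewrite -[X in X - _]lawP.2 -sumrB; apply: eq_bigr => x _.
    by case: (A x); rewrite /= ?mulr1 ?mulr0 ?subr0 ?subrr.
  rewrite /= /mean !big_distrl -big_split /=.
  apply: eq_bigr => x _; case: (A x) => /=; rewrite !mulr1 !mulr0 mul0r ?addr0 //.
  by rewrite add0r.
elim: N psi => [|N IH] psi.
  by rewrite (step 0%N (fun k => k%:R * psi k)) /= mulr0n mul0r mulr0 addr0 mulr1n !mul1r.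
have := step N.+1 (fun k => k%:R * psi k); cbv beta => ->; rewrite IH.
have -> : Ex P N.+1 (fun l => (count A l).+1%:R * psi (count A l).+1) =
   Ex P N.+1 (fun l => psi (count A l).+1) +
   Ex P N.+1 (fun l => (count A l)%:R * psi (count A l).+1).
  by rewrite -ExD; apply: eq_Ex => l _; rewrite -natr1; ring.
have := IH (fun k => psi k.+1); cbv beta => ->.
have := step N (fun k => psi k.+1); cbv beta => ->.
rewrite -!natr1; ring.
Qed.

(** Size bias with [psi k = 1 / k], where count times [psi] is at most 1. A bin of mass [q] thus has
    average weight at most [1 / ((N + 1) q)], which is how flattening works without splitting any
    bin. *)
Lemma Ex_inv_count (A : pred T) N :
  mean (fun x => (A x)%:R) * Ex P N (fun l => (count A l).+1%:R^-1) <= N.+1%:R^-1.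
Proof.
rewrite -[leRHS]mul1r ler_pdivlMr // mulrC.
rewrite -(Ex_size_bias A N (fun k => k%:R^-1)) -[leRHS](Ex_const N.+1 1 lawP).
apply: le_Ex => // l _; case: (count A l) => [|k]; first by rewrite mul0r.
by rewrite divff ?lexx ?pnatr_eq0.
Qed.

End SampleSums.

(** * The variance of the statistic as an inequality between finite sums *)

Section VarianceAlgebra.
Variables (R : realFieldType) (K : nat) (w p q : 'I_K -> R).
Hypotheses (w01 : forall c, 0 <= w c <= 1) (p0 : forall c, 0 <= p c)
  (q0 : forall c, 0 <= q c) (p1 : \sum_c p c <= 1) (q1 : \sum_c q c <= 1).

Let G := \sum_c w c * (p c - q c) ^+ 2.
Let B := \sum_c w c * q c ^+ 2.

(** The covariance matrices of one multinomial draw from [p] and one from [q], added up. *)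
Definition covar (c c' : 'I_K) : R :=
  (c == c')%:R * (p c + q c) - p c * p c' - q c * q c'.

Let mass_le1 (r : 'I_K -> R) c : (forall c, 0 <= r c) -> \sum_c r c <= 1 -> r c <= 1.
Proof.
move=> r0; apply: le_trans; rewrite (bigD1 c) //= lerDl.
by apply: sumr_ge0.
Qed.

Let wsq_le1 (r : 'I_K -> R) : (forall c, 0 <= r c) -> \sum_c r c <= 1 ->
  0 <= \sum_c w c * r c ^+ 2 <= 1.
Proof.
move=> r0 r1; apply/andP; split.
  by apply: sumr_ge0 => c _; apply: mulr_ge0; [case/andP: (w01 c)|apply: sqr_ge0].
apply: (le_trans _ r1); apply: ler_sum => c _.
have := mass_le1 c r0 r1; have := r0 c; have /andP[] := w01 c.
move: (w c) (r c) => a b; nra.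
Qed.

(** When the square is expanded, the term in [m ^ 4] sums to [(m ^ 2 * G) ^ 2] and cancels. A noise
    term in [covar ^ 2] and a cross term remain. The parameter [l] trades the cross term against the
    square of the mean: the null case takes [l = 1], the far case an [l] of order [1 / t]. *)
Lemma variance_bound (m l : R) : 0 <= m -> 0 < l ->
  \sum_c \sum_c' w c * w c' * (m * covar c c' + m ^+ 2 * (p c - q c) * (p c' - q c')) ^+ 2
   - (m ^+ 2 * G) ^+ 2
  <= m ^+ 2 * ((4 + 2 / l) * (3 * B + 2 * G)) + l * (m ^+ 2 * G) ^+ 2.
Proof.
move=> m0 l0.
pose a := \sum_c w c * p c ^+ 2; pose u c := p c - q c.
have a01 : 0 <= a <= 1 by apply: wsq_le1.
have b01 : 0 <= B <= 1 by apply: wsq_le1.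
have G0 : 0 <= G.
  by apply: sumr_ge0 => c _; apply: mulr_ge0; [case/andP: (w01 c)|apply: sqr_ge0].
(* [p ^ 2 + q ^ 2 <= 3 q ^ 2 + 2 (p - q) ^ 2] because [(p - 2 q) ^ 2 >= 0]: the norm of [p] is
   traded for that of the reference plus the signal. *)
have aBG : a + B <= 3 * B + 2 * G.
  rewrite /a /B /G !big_distrr -!big_split /=; apply: ler_sum => c _.
  have /andP[] := w01 c; move: (w c) (p c) (q c) => x y z.
  by have := sqr_ge0 (y - 2 * z); nra.
have first : \sum_c \sum_c' w c * w c' * covar c c' ^+ 2 <= 4 * (a + B).
  have h c c' : w c * w c' * covar c c' ^+ 2 <=
     (c == c')%:R * (w c * (2 * (p c ^+ 2 + q c ^+ 2))) +
     2 * ((w c * p c ^+ 2) * (w c' * p c' ^+ 2) + (w c * q c ^+ 2) * (w c' * q c' ^+ 2)).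
    rewrite /covar; case: eqVneq => [<-|_] /=.
      rewrite !mul1r.
      have t0 : 0 <= 2 * (w c * p c ^+ 2 * (w c * p c ^+ 2) + w c * q c ^+ 2 * (w c * q c ^+ 2)).
        by rewrite -!expr2; apply: mulr_ge0 => //; apply: addr_ge0; apply: sqr_ge0.
      apply: (le_trans (y := w c * (2 * (p c ^+ 2 + q c ^+ 2)))); last by rewrite lerDl.
      have pc1 := mass_le1 c p0 p1; have qc1 := mass_le1 c q0 q1.
      have := p0 c; have := q0 c; have /andP[] := w01 c; move: pc1 qc1.
      move: (w c) (p c) (q c) => x y z y1 z1 x0 x1 z0 y0.
      have e0 : 0 <= y + z - y * y - z * z by nra.
      have e1 : y + z - y * y - z * z <= y + z by nra.
      have e2 : (y + z - y * y - z * z) ^+ 2 <= 2 * (y ^+ 2 + z ^+ 2).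
        apply: (le_trans (y := (y + z) ^+ 2)); first by rewrite !expr2; apply: ler_pM.
        by have := sqr_ge0 (y - z); nra.
      rewrite -mulrA; apply: ler_wpM2l => //.
      by apply: le_trans e2; rewrite ler_piMl // sqr_ge0.
    rewrite !mul0r !add0r.
    have /andP[x0 _] := w01 c; have /andP[x'0 _] := w01 c'.
    have xx0 : 0 <= w c * w c' by apply: mulr_ge0.
    have -> : 2 * (w c * p c ^+ 2 * (w c' * p c' ^+ 2) + w c * q c ^+ 2 * (w c' * q c' ^+ 2))
      = (w c * w c') * (2 * ((p c * p c') ^+ 2 + (q c * q c') ^+ 2)) by ring.
    apply: ler_wpM2l => //.
    by have := sqr_ge0 (p c * p c' - q c * q c'); nra.
  apply: (le_trans (ler_sum _ (fun c _ => ler_sum _ (fun c' _ => h c c')))).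
  have -> : \sum_c \sum_c' ((c == c')%:R * (w c * (2 * (p c ^+ 2 + q c ^+ 2))) +
     2 * ((w c * p c ^+ 2) * (w c' * p c' ^+ 2) + (w c * q c ^+ 2) * (w c' * q c' ^+ 2)))
    = 2 * (a + B) + 2 * (a ^+ 2 + B ^+ 2).
    under eq_bigr => c _.
      rewrite big_split /= (bigD1 c) //= eqxx mul1r big1 ?addr0; last first.
        by move=> c' /negPf; rewrite eq_sym => ->; rewrite mul0r.
      rewrite -big_distrr big_split /= -!big_distrr /=.
    over.
    rewrite big_split /= -big_distrr /= big_split /= -!big_distrl /= -/a -/B.
    rewrite -!expr2; congr (_ + _).
    rewrite mulrDr /a /B !big_distrr -big_split /=; apply: eq_bigr => c _; ring.
  by case/andP: a01; case/andP: b01; move: (a) (B) => x y; nra.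
(* The rank-one parts of [covar] contribute squares with a minus sign and are dropped; the diagonal
   part is split by the inequality of means with weight [l]. *)
have second : \sum_c \sum_c' w c * w c' * (2 * m * covar c c' * u c * u c')
    <= 2 / l * (a + B) + l * (m ^+ 2 * G ^+ 2).
  have -> : \sum_c \sum_c' w c * w c' * (2 * m * covar c c' * u c * u c') =
     \sum_c 2 * m * ((w c * (p c + q c)) * (w c * u c ^+ 2)) -
     2 * m * ((\sum_c w c * u c * p c) ^+ 2 + (\sum_c w c * u c * q c) ^+ 2).
    under eq_bigr => c _.
      have -> : \sum_c' w c * w c' * (2 * m * covar c c' * u c * u c') =
        \sum_c' (c == c')%:R * (2 * m * ((w c * (p c + q c)) * (w c' * u c * u c'))) -
        2 * m * (w c * u c * p c) * \sum_c' w c' * u c' * p c' -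
        2 * m * (w c * u c * q c) * \sum_c' w c' * u c' * q c'.
        rewrite !big_distrr -!sumrB /=; apply: eq_bigr => c' _; rewrite /covar; ring.
      rewrite (bigD1 c) //= eqxx mul1r big1 ?addr0; last first.
        by move=> c' /negPf; rewrite eq_sym => ->; rewrite mul0r.
    over.
    rewrite !sumrB /= -!big_distrl -!big_distrr /=.
    rewrite -addrA -opprD; congr (_ - _); last by ring.
    by congr (_ * _); apply: eq_bigr => c _; rewrite expr2 -!mulrA.
  apply: (le_trans (y := \sum_c 2 * m * ((w c * (p c + q c)) * (w c * u c ^+ 2)))).
    rewrite gerDl oppr_le0; apply: mulr_ge0; first by apply: mulr_ge0.
    by apply: addr_ge0; apply: sqr_ge0.
  have h c : 2 * m * ((w c * (p c + q c)) * (w c * u c ^+ 2)) <=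
     l^-1 * (w c * (p c + q c)) ^+ 2 + l * m ^+ 2 * (w c * u c ^+ 2) ^+ 2.
    move: (w c * (p c + q c)) (w c * u c ^+ 2) => x y.
    have -> : l^-1 * x ^+ 2 + l * m ^+ 2 * y ^+ 2 =
       l^-1 * (x - l * m * y) ^+ 2 + 2 * m * (x * y).
      field; exact: lt0r_neq0.
    by rewrite lerDr; apply: mulr_ge0; [rewrite invr_ge0 ltW|apply: sqr_ge0].
  apply: (le_trans (ler_sum _ (fun c _ => h c))).
  rewrite big_split /= -!big_distrr /=; apply: lerD.
    rewrite [2 / l]mulrC -mulrA; apply: ler_wpM2l; first by rewrite invr_ge0 ltW.
    rewrite /a /B -big_split /= big_distrr /=; apply: ler_sum => c _.
    have /andP[] := w01 c; move: (w c) (p c) (q c) => x y z x0 x1.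
    have -> : (x * (y + z)) ^+ 2 = x * (x * (y + z) ^+ 2) by ring.
    have -> : 2 * (x * y ^+ 2 + x * z ^+ 2) = x * (2 * (y ^+ 2 + z ^+ 2)) by ring.
    apply: ler_wpM2l => //; apply: (le_trans (y := (y + z) ^+ 2)).
      by rewrite ler_piMl // sqr_ge0.
    by have := sqr_ge0 (y - z); nra.
  rewrite -mulrA; apply: ler_wpM2l; first exact: ltW.
  apply: ler_wpM2l; first exact: sqr_ge0.
  have g0 c : 0 <= w c * u c ^+ 2.
    by apply: mulr_ge0; [case/andP: (w01 c)|apply: sqr_ge0].
  rewrite [X in _ <= X]expr2 {1}/G big_distrl /=; apply: ler_sum => c _.
  rewrite expr2; apply: ler_wpM2l => //; rewrite /G (bigD1 c) //= lerDl.
  by apply: sumr_ge0.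
have -> : \sum_c \sum_c' w c * w c' * (m * covar c c' + m ^+ 2 * (p c - q c) * (p c' - q c')) ^+ 2
   - (m ^+ 2 * G) ^+ 2 =
   m ^+ 2 * (\sum_c \sum_c' w c * w c' * covar c c' ^+ 2) +
   m ^+ 2 * (\sum_c \sum_c' w c * w c' * (2 * m * covar c c' * u c * u c')).
  have -> : (m ^+ 2 * G) ^+ 2 = \sum_c \sum_c' m ^+ 4 * (w c * u c ^+ 2) * (w c' * u c' ^+ 2).
    have -> : (m ^+ 2 * G) ^+ 2 = m ^+ 4 * (G * G) by ring.
    rewrite {1}/G big_distrl big_distrr /=; apply: eq_bigr => c _.
    by rewrite /G !big_distrr /=; apply: eq_bigr => c' _; rewrite mulrA.
  rewrite !big_distrr -sumrB -big_split /=; apply: eq_bigr => c _.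
  rewrite !big_distrr -sumrB -big_split /=; apply: eq_bigr => c' _.
  rewrite /u; ring.
rewrite -mulrDr.
have -> : m ^+ 2 * ((4 + 2 / l) * (3 * B + 2 * G)) + l * (m ^+ 2 * G) ^+ 2 =
  m ^+ 2 * ((4 + 2 / l) * (3 * B + 2 * G) + l * (m ^+ 2 * G ^+ 2)) by ring.
apply: ler_wpM2l; first exact: sqr_ge0.
apply: (le_trans (lerD first second)).
rewrite addrA lerD2r -mulrDl; apply: ler_wpM2l => //.
by apply: addr_ge0 => //; apply: divr_ge0 => //; exact: ltW.
Qed.

End VarianceAlgebra.

(** * The statistic of a block of samples *)

Section Statistic.
Variables (R : realFieldType) (T : Type) (phi : T -> nat).

Definition cnt (c : nat) (l : seq T) : nat := count (fun x => phi x == c) l.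

Definition cdiff (c : nat) (X Y : seq T) : R := (cnt c X)%:R - (cnt c Y)%:R.

(* Dividing by 1 + F_c flattens the reference distribution: a bin receiving many
   samples in F is downweighted as if it were split into that many bins. *)
Definition stat (K : nat) (F X Y X' Y' : seq T) : R :=
  \sum_(c < K) cdiff c X Y * cdiff c X' Y' / (cnt c F).+1%:R.

End Statistic.

Section BlockExpectation.
Variables (R : realFieldType) (T : finType) (P Q : T -> R).

Definition Ex2 m (g : seq T -> seq T -> R) : R :=
  Ex P m (fun X => Ex Q m (fun Y => g X Y)).

Definition Eblock m1 m (f : seq T -> seq T -> seq T -> seq T -> seq T -> R) : R :=
  Ex Q m1 (fun F => Ex2 m (fun X Y => Ex2 m (fun X' Y' => f F X Y X' Y'))).

Hypotheses (lawP : is_law P) (lawQ : is_law Q).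

Lemma eq_Ex2 m g g' : (forall X Y, g X Y = g' X Y) -> Ex2 m g = Ex2 m g'.
Proof. by move=> e; apply: eq_Ex => X _; apply: eq_Ex => Y _. Qed.

Lemma Ex2Z m c g : Ex2 m (fun X Y => c * g X Y) = c * Ex2 m g.
Proof. by rewrite /Ex2 -ExZ; apply: eq_Ex => X _; rewrite ExZ. Qed.

Lemma Ex2D m g g' : Ex2 m (fun X Y => g X Y + g' X Y) = Ex2 m g + Ex2 m g'.
Proof. by rewrite /Ex2 -ExD; apply: eq_Ex => X _; rewrite ExD. Qed.

Lemma Ex2_const m c : Ex2 m (fun _ _ => c) = c.
Proof. by rewrite /Ex2 Ex_const // Ex_const. Qed.

Lemma Ex2_sum m (I : finType) (F : I -> seq T -> seq T -> R) :
  Ex2 m (fun X Y => \sum_i F i X Y) = \sum_i Ex2 m (F i).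
Proof. by rewrite /Ex2 -Ex_sum; apply: eq_Ex => X _; rewrite Ex_sum. Qed.

Lemma le_Ex2 m g g' : (forall X Y, g X Y <= g' X Y) -> Ex2 m g <= Ex2 m g'.
Proof. by move=> h; apply: le_Ex => // X _; apply: le_Ex => // Y _. Qed.

Lemma le_Eblock m1 m f g : (forall F X Y X' Y', size F = m1 ->
   f F X Y X' Y' <= g F X Y X' Y') -> Eblock m1 m f <= Eblock m1 m g.
Proof.
move=> h; apply: le_Ex => // F sF; apply: le_Ex2 => X Y.
by apply: le_Ex2 => X' Y'; apply: h.
Qed.

Section Moments.
Variables (phi : T -> nat) (K : nat).
Hypothesis phiK : forall x, (phi x < K)%N.

Definition mass (P' : T -> R) (c : nat) : R := mean P' (fun x => (phi x == c)%:R).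

Lemma cnt_sum c (l : seq T) : (cnt phi c l)%:R = \sum_(x <- l) (phi x == c)%:R :> R.
Proof. by rewrite /cnt -sum1_count natr_sum big_mkcond /=; apply: eq_bigr => x _; case: eqP. Qed.

Lemma mass_ge0 P' c : is_law P' -> 0 <= mass P' c.
Proof. by move=> [h _]; apply: sumr_ge0 => x _; apply: mulr_ge0. Qed.

Lemma mass_sum P' : is_law P' -> \sum_(c < K) mass P' c = 1.
Proof.
move=> [_ <-]; rewrite exchange_big /=; apply: eq_bigr => x _.
rewrite -big_distrr /= (bigD1 (Ordinal (phiK x))) //= eqxx big1 ?addr0 ?mulr1 //.
by move=> i /eqP ne; case: eqP => // e; case: ne; apply: val_inj.
Qed.

Lemma sum_cnt (l : seq T) : (\sum_(c < K) cnt phi c l)%N = size l.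
Proof.
elim: l => [|x l IH]; first by rewrite big1.
rewrite /= -IH -add1n big_split /=; congr (_ + _)%N.
rewrite (bigD1 (Ordinal (phiK x))) //= eqxx big1 ?addn0 //.
by move=> i /eqP ne; case: eqP => // e; case: ne; apply: val_inj.
Qed.

Lemma Ex2_cdiff m c :
  Ex2 m (fun X Y => cdiff R phi c X Y) = m%:R * (mass P c - mass Q c).
Proof.
rewrite /Ex2 /cdiff; under eq_Ex do rewrite ExB Ex_const // (eq_Ex Q (fun l _ => cnt_sum c l)) Ex_sum1 //.
rewrite ExB Ex_const // (eq_Ex P (fun l _ => cnt_sum c l)) Ex_sum1 // /mass; ring.
Qed.

Lemma Ex2_cdiff2 m (c c' : 'I_K) :
  Ex2 m (fun X Y => cdiff R phi c X Y * cdiff R phi c' X Y) =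
  m%:R * covar (mass P) (mass Q) c c' +
  m%:R ^+ 2 * (mass P c - mass Q c) * (mass P c' - mass Q c').
Proof.
pose a (b : 'I_K) (l : seq T) : R := \sum_(x <- l) (phi x == b)%:R.
transitivity (Ex2 m (fun X Y => (a c X * a c' X + a c Y * a c' Y) +
   (-1 * (a c X * a c' Y) + -1 * (a c' X * a c Y)))).
  by apply: eq_Ex2 => X Y; rewrite /cdiff !cnt_sum -!/(a _ _); ring.
have mm P' : mean P' (fun x => (phi x == c)%:R * (phi x == c')%:R) = (c == c')%:R * mass P' c.
  rewrite /mass /mean big_distrr /=; apply: eq_bigr => x _; case: (phi x =P c) => [->|_].
    by rewrite mul1r mulr1 mulrC -val_eqE.
  by rewrite mul0r !mulr0.
have cross b b' : Ex2 m (fun X Y => a b X * a b' Y) =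
   (m%:R * mass P b) * (m%:R * mass Q b').
  rewrite /Ex2 /mass -!Ex_sum1 // -ExZr; apply: eq_Ex => X _.
  by rewrite ExZ.
rewrite 2!Ex2D !Ex2D !Ex2Z !cross.
have -> : Ex2 m (fun X Y => a c X * a c' X) =
  m%:R * ((c == c')%:R * mass P c) + (m%:R ^+ 2 - m%:R) * (mass P c * mass P c').
  rewrite -mm -Ex_sum2 //; apply: eq_Ex => X _; exact: Ex_const.
have -> : Ex2 m (fun X Y => a c Y * a c' Y) =
  m%:R * ((c == c')%:R * mass Q c) + (m%:R ^+ 2 - m%:R) * (mass Q c * mass Q c').
  by rewrite -mm -Ex_sum2 // /Ex2 Ex_const.
rewrite /covar; ring.
Qed.

Section GivenReference.
Variables (F : seq T) (m : nat).

Let w (c : 'I_K) : R := (cnt phi c F).+1%:R^-1.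
Let p (c : 'I_K) := mass P c.
Let q (c : 'I_K) := mass Q c.
Let G := \sum_c w c * (p c - q c) ^+ 2.
Let B := \sum_c w c * q c ^+ 2.

(** The two pairs are independent, so each summand has the square of the mean [m (p_c - q_c)] as its
    expectation, with no correction term. *)
Lemma Ex_stat :
  Ex2 m (fun X Y => Ex2 m (fun X' Y' => stat R phi K F X Y X' Y')) = m%:R ^+ 2 * G.
Proof.
transitivity (\sum_c (w c * Ex2 m (cdiff R phi c) * Ex2 m (cdiff R phi c))).
  transitivity (Ex2 m (fun X Y => \sum_c (w c * Ex2 m (cdiff R phi c)) * cdiff R phi c X Y)).
    apply: eq_Ex2 => X Y; rewrite Ex2_sum; apply: eq_bigr => c _.
    rewrite mulrAC -Ex2Z.
    by apply: eq_Ex2 => X' Y'; rewrite /w; ring.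
  by rewrite Ex2_sum; apply: eq_bigr => c _; rewrite Ex2Z.
rewrite /G big_distrr; apply: eq_bigr => c _; rewrite !Ex2_cdiff /p /q /=; ring.
Qed.

(** By the same independence the joint moment of the two pairs factors into the square of a second
    moment, so no fourth moments of counts occur. *)
Lemma Ex_stat2 :
  Ex2 m (fun X Y => Ex2 m (fun X' Y' => stat R phi K F X Y X' Y' ^+ 2)) =
  \sum_c \sum_c' w c * w c' *
    (m%:R * covar p q c c' + m%:R ^+ 2 * (p c - q c) * (p c' - q c')) ^+ 2.
Proof.
pose M (c c' : 'I_K) := Ex2 m (fun X Y => cdiff R phi c X Y * cdiff R phi c' X Y).
transitivity (Ex2 m (fun X Y => \sum_c \sum_c' (w c * w c' * M c c') *
    (cdiff R phi c X Y * cdiff R phi c' X Y))).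
  apply: eq_Ex2 => X Y.
  transitivity (Ex2 m (fun X' Y' => \sum_c \sum_c'
     (w c * w c' * (cdiff R phi c X Y * cdiff R phi c' X Y)) *
     (cdiff R phi c X' Y' * cdiff R phi c' X' Y'))).
    apply: eq_Ex2 => X' Y'; rewrite expr2 /stat big_distrl /=.
    apply: eq_bigr => c _; rewrite big_distrr /=; apply: eq_bigr => c' _.
    by rewrite /w; ring.
  rewrite Ex2_sum; apply: eq_bigr => c _; rewrite Ex2_sum; apply: eq_bigr => c' _.
  by rewrite Ex2Z -/(M c c'); ring.
rewrite Ex2_sum; apply: eq_bigr => c _; rewrite Ex2_sum; apply: eq_bigr => c' _.
rewrite Ex2Z -/(M c c') /M Ex2_cdiff2 /p /q; ring.
Qed.

Let w01 c : 0 <= w c <= 1.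
Proof. by rewrite invr_ge0 ler0n /= invf_le1 ?ltr0n // ler1n. Qed.

Lemma Var_stat (l : R) : 0 < l ->
  Ex2 m (fun X Y => Ex2 m (fun X' Y' =>
     (stat R phi K F X Y X' Y' - m%:R ^+ 2 * G) ^+ 2)) <=
  m%:R ^+ 2 * ((4 + 2 / l) * (3 * B + 2 * G)) + l * (m%:R ^+ 2 * G) ^+ 2.
Proof.
move=> l0; set mu := m%:R ^+ 2 * G.
have -> : Ex2 m (fun X Y => Ex2 m (fun X' Y' => (stat R phi K F X Y X' Y' - mu) ^+ 2)) =
  Ex2 m (fun X Y => Ex2 m (fun X' Y' => stat R phi K F X Y X' Y' ^+ 2)) - mu ^+ 2.
  transitivity (Ex2 m (fun X Y => Ex2 m (fun X' Y' => stat R phi K F X Y X' Y' ^+ 2) +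
     (- (2 * mu) * Ex2 m (fun X' Y' => stat R phi K F X Y X' Y') + mu ^+ 2))).
    apply: eq_Ex2 => X Y; rewrite -(Ex2_const m (mu ^+ 2)) -Ex2Z -!Ex2D.
    by apply: eq_Ex2 => X' Y'; ring.
  by rewrite Ex2D Ex2D Ex2Z Ex2_const Ex_stat -/mu; ring.
rewrite Ex_stat2; apply: variance_bound => //.
- by move=> c; exact: mass_ge0.
- by move=> c; exact: mass_ge0.
- by rewrite /p mass_sum.
- by rewrite /q mass_sum.
Qed.

(* Cauchy-Schwarz with the weights 1 + F_c, whose sum is K + size F. *)
Lemma signal_lb (g : R) :
  (K + size F)%:R * g <= (\sum_c `|p c - q c|) ^+ 2 -> (0 < K)%N -> g <= G.
Proof.
move=> hg K0; have N0 : 0 < (K + size F)%:R :> R by rewrite ltr0n addn_gt0 K0.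
rewrite -(ler_pM2l N0); apply: le_trans hg _.
set s := \sum_c _; set n : R := (K + size F)%:R.
have eN : n = \sum_c (w c)^-1.
  rewrite /n natrD -(sum_cnt F) natr_sum.
  have -> : K%:R = \sum_(c < K) 1 :> R by rewrite sumr_const card_ord.
  by rewrite -big_split /=; apply: eq_bigr => c _; rewrite /w invrK addrC natr1.
have wpos c : 0 < w c by rewrite invr_gt0 ltr0n.
have : 0 <= \sum_c w c * (`|p c - q c| * (\sum_c (w c)^-1) - s / w c) ^+ 2.
  by apply: sumr_ge0 => c _; apply: mulr_ge0; [exact: ltW|exact: sqr_ge0].
rewrite -eN.
have -> : \sum_c w c * (`|p c - q c| * n - s / w c) ^+ 2 = n * (n * G - s ^+ 2).
  transitivity (\sum_c (n ^+ 2 * (w c * (p c - q c) ^+ 2) - 2 * s * n * `|p c - q c| + s ^+ 2 * (w c)^-1)).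
    apply: eq_bigr => c _; rewrite -(real_normK (num_real (p c - q c))).
    by field; exact: lt0r_neq0.
  by rewrite big_split sumrB /= -!big_distrr /= -/s -eN -/G; ring.
by rewrite pmulr_rge0 ?subr_ge0.
Qed.

End GivenReference.

(** [Ex_inv_count] cancels one factor [q_c], and the other factors sum to 1. Without the weights
    this would be the squared l2 norm of the masses, which can be as large as 1. *)
Lemma Ex_ref_norm m1 : \sum_(c < K) Ex Q m1 (fun F => (cnt phi c F).+1%:R^-1 * mass Q c ^+ 2)
  <= m1.+1%:R^-1.
Proof.
apply: (le_trans (y := \sum_(c < K) mass Q c * m1.+1%:R^-1)); last first.
  by rewrite -big_distrl /= mass_sum // mul1r.
apply: ler_sum => c _; rewrite ExZr expr2 mulrC -mulrA.
by apply: ler_wpM2l; [exact: mass_ge0|exact: Ex_inv_count].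
Qed.

(** Equal masses make the mean vanish for every reference sample, so Chebyshev's inequality applies
    around 0. The constant is [18 = (4 + 2 / l) * 3] at [l = 1]. *)
Lemma block_null m1 m (tau : R) : 0 < tau -> (forall c, mass P c = mass Q c) ->
  Eblock m1 m (fun F X Y X' Y' => (tau < stat R phi K F X Y X' Y')%R%:R) <=
  18 * m%:R ^+ 2 / (tau ^+ 2 * m1.+1%:R).
Proof.
move=> tau0 PQ.
have G0 F : \sum_(c < K) (cnt phi c F).+1%:R^-1 * (mass P c - mass Q c) ^+ 2 = 0.
  by rewrite big1 // => c _; rewrite PQ subrr expr0n mulr0.
apply: (le_trans (y := Eblock m1 m (fun F X Y X' Y' => tau ^- 2 * stat R phi K F X Y X' Y' ^+ 2))).
  apply: le_Eblock => F X Y X' Y' _; set S := stat _ _ _ _ _ _ _ _.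
  case: ltP => h /=; last by apply: mulr_ge0; [rewrite invr_ge0 sqr_ge0|rewrite sqr_ge0].
  rewrite mulrC ler_pdivlMr ?exprn_gt0 // mul1r; rewrite ler_pXn2r ?nnegrE //; lra.
rewrite /Eblock.
apply: (le_trans (y := Ex Q m1 (fun F => \sum_(c < K) 18 * m%:R ^+ 2 / tau ^+ 2 *
   ((cnt phi c F).+1%:R^-1 * mass Q c ^+ 2)))).
  apply: le_Ex => // F _.
  have := Var_stat F m (@ltr01 R); rewrite G0 mulr0.
  under eq_Ex2 do under eq_Ex2 do rewrite subr0.
  move=> hV; under eq_Ex2 do rewrite Ex2Z.
  rewrite Ex2Z -big_distrr /=; move: hV; set V := Ex2 _ _; set B := \sum_(c < K) _ => hV.
  have -> : 18 * m%:R ^+ 2 / tau ^+ 2 * B = tau ^- 2 * (18 * m%:R ^+ 2 * B) by ring.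
  apply: ler_wpM2l; first by rewrite invr_ge0 sqr_ge0.
  apply: (le_trans hV); rewrite le_eqVlt; apply/orP; left; apply/eqP; by field.
rewrite Ex_sum; under eq_bigr do rewrite ExZ.
rewrite -big_distrr /=.
have -> : 18 * m%:R ^+ 2 / (tau ^+ 2 * m1.+1%:R) =
  18 * m%:R ^+ 2 / tau ^+ 2 * m1.+1%:R^-1 by rewrite invfM mulrA.
apply: ler_wpM2l; last exact: Ex_ref_norm.
by apply: divr_ge0; rewrite ?sqr_ge0 // mulr_ge0 ?sqr_ge0.
Qed.

(** For every reference sample [2 * tau] is at most the mean, so [Z <= tau] is a deviation by at
    least half the mean, which gives the factor 4. The lower bound [g <= G] holds for each [F],
    whereas the noise [B F] is controlled only on average over [F]; hence [G] is replaced first. *)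
Lemma block_alt m1 m (tau g l : R) : (0 < K)%N -> (0 < m)%N -> 0 < g -> 0 < l ->
  (K + m1)%:R * g <= (\sum_(c < K) `|mass P c - mass Q c|) ^+ 2 ->
  2 * tau <= m%:R ^+ 2 * g ->
  Eblock m1 m (fun F X Y X' Y' => (stat R phi K F X Y X' Y' <= tau)%R%:R) <=
  4 * ((4 + 2 / l) * (3 / (m1.+1%:R * g ^+ 2) + 2 / g) / m%:R ^+ 2 + l).
Proof.
move=> K0 m0 g0 l0 hg htau.
have M0 : 0 < m%:R ^+ 2 :> R by rewrite exprn_gt0 // ltr0n.
have L0 : 0 < 4 + 2 / l by rewrite addr_gt0 // divr_gt0.
pose B (F : seq T) := \sum_(c < K) (cnt phi c F).+1%:R^-1 * mass Q c ^+ 2.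
pose C := 4 * (4 + 2 / l) / m%:R ^+ 2.
have C0 : 0 < C by rewrite divr_gt0 // mulr_gt0.
apply: (le_trans (y := Ex Q m1 (fun F => C * (3 / g ^+ 2) * B F + (C * (2 / g) + 4 * l)))); last first.
  rewrite ExD ExZ Ex_const // /B Ex_sum.
  have h := Ex_ref_norm m1.
  apply: (le_trans (y := C * (3 / g ^+ 2) * m1.+1%:R^-1 + (C * (2 / g) + 4 * l))).
    rewrite lerD2r; apply: ler_wpM2l => //; apply: mulr_ge0; first exact: ltW.
    by rewrite divr_ge0 ?sqr_ge0.
  rewrite le_eqVlt; apply/orP; left; apply/eqP; rewrite /C; field.
  by rewrite !lt0r_neq0 ?nat1r ?ltr0n.
apply: le_Ex => // F sF.
set G := \sum_(c < K) (cnt phi c F).+1%:R^-1 * (mass P c - mass Q c) ^+ 2.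
have gG : g <= G by apply: signal_lb => //; rewrite sF.
have G0 : 0 < G by exact: lt_le_trans gG.
have B0 : 0 <= B F by apply: sumr_ge0 => c _; rewrite mulr_ge0 ?sqr_ge0 ?invr_ge0.
have MG0 : 0 < m%:R ^+ 2 * G by apply: mulr_gt0.
have V := Var_stat F m l0; rewrite -/G -/(B F) in V.
apply: (le_trans (y := Ex2 m (fun X Y => Ex2 m (fun X' Y' =>
   (4 / (m%:R ^+ 2 * G) ^+ 2) * (stat R phi K F X Y X' Y' - m%:R ^+ 2 * G) ^+ 2)))).
  apply: le_Ex2 => X Y; apply: le_Ex2 => X' Y'; set S := stat _ _ _ _ _ _ _ _.
  have mG : m%:R ^+ 2 * g <= m%:R ^+ 2 * G by rewrite ler_pM2l.
  case: (leP S tau) => h /=; last first.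
    by apply: mulr_ge0; [rewrite divr_ge0 ?sqr_ge0|rewrite sqr_ge0].
  rewrite mulrAC ler_pdivlMr ?exprn_gt0 // mul1r.
  move: (m%:R ^+ 2 * G) (m%:R ^+ 2 * g) MG0 mG htau h => u v; nra.
under eq_Ex2 do rewrite Ex2Z.
rewrite Ex2Z; apply: (le_trans (ler_wpM2l _ V)); first by rewrite divr_ge0 ?sqr_ge0.
have -> : 4 / (m%:R ^+ 2 * G) ^+ 2 *
    (m%:R ^+ 2 * ((4 + 2 / l) * (3 * B F + 2 * G)) + l * (m%:R ^+ 2 * G) ^+ 2)
  = C * (3 / G ^+ 2) * B F + (C * (2 / G) + 4 * l).
  by rewrite /C; field; rewrite !lt0r_neq0 // ltr0n.
apply: lerD.
  apply: ler_wpM2r => //; apply: ler_wpM2l; first exact: ltW.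
  apply: ler_wpM2l => //; rewrite lef_pV2 ?posrE ?exprn_gt0 //.
  by rewrite ler_pXn2r ?nnegrE // ltW.
rewrite lerD2r; apply: ler_wpM2l; first exact: ltW.
by apply: ler_wpM2l => //; rewrite lef_pV2 ?posrE.
Qed.

End Moments.
End BlockExpectation.

(** * Consecutive blocks of samples and their joint law *)

Section Blocks.
Variables (R : realFieldType) (T : Type) (m1 m : nat).

Definition block_size : nat := (m1 + m + m + m + m)%N.

Definition block_stat (phi : T -> nat) (K : nat) (l : seq T) : R :=
  stat R phi K (take m1 l) (take m (drop m1 l)) (take m (drop (m1 + m) l))
    (take m (drop (m1 + m + m) l)) (take m (drop (m1 + m + m + m) l)).

Definition all_exceed (phi : T -> nat) (K : nat) (tau : R) (t : nat) (l : seq T) : bool :=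
  all (fun b => tau < block_stat phi K (drop (b * block_size) l)) (iota 0 t).

(* Each block discards o samples from the first source. *)
Fixpoint interleave (o t : nat) (xs ys : seq T) : seq T :=
  if t is t'.+1 then
    take m1 ys ++ take m (drop o xs) ++ take m (drop m1 ys) ++
    take m (drop (o + m) xs) ++ take m (drop (m1 + m) ys) ++
    interleave o t' (drop (o + m + m) xs) (drop (m1 + m + m) ys)
  else [::].

Lemma drop_catD (s : seq T) k : size s = k ->
  forall a l, drop (k + a) (s ++ l) = drop a l.
Proof. by move=> <- a l; rewrite addnC -drop_drop drop_size_cat. Qed.

Lemma block_stat_cat phi K F X Y X' Y' l :
  size F = m1 -> size X = m -> size Y = m -> size X' = m -> size Y' = m ->
  block_stat phi K (F ++ X ++ Y ++ X' ++ Y' ++ l) = stat R phi K F X Y X' Y'.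
Proof.
move=> sF sX sY sX' sY'; rewrite /block_stat -!addnA.
rewrite take_size_cat // drop_size_cat // !(drop_catD sF).
rewrite take_size_cat // drop_size_cat // !(drop_catD sX).
rewrite take_size_cat // drop_size_cat // !(drop_catD sY).
by rewrite take_size_cat // drop_size_cat // take_size_cat.
Qed.

Lemma all_exceed_cat phi K tau t B l : size B = block_size ->
  all_exceed phi K tau t.+1 (B ++ l) =
  (tau < block_stat phi K (B ++ l)) && all_exceed phi K tau t l.
Proof.
move=> sB; rewrite /all_exceed /= mul0n drop0; congr (_ && _).
rewrite -[1%N]addn0 iotaDl all_map; apply: eq_all => b /=.
by rewrite mulnDl mul1n addnC -drop_drop drop_size_cat.
Qed.

End Blocks.

Section BlockLaw.
Variables (R : realFieldType) (T : finType) (P Q : T -> R) (m1 m : nat).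
Hypotheses (lawP : is_law P) (lawQ : is_law Q).

Fixpoint Eblocks (t : nat) (f : seq T -> R) : R :=
  if t is t'.+1 then
    Eblock P Q m1 m (fun F X Y X' Y' =>
      Eblocks t' (fun l => f (F ++ X ++ Y ++ X' ++ Y' ++ l)))
  else f [::].

Lemma eq_Eblock f g :
  (forall F X Y X' Y', size F = m1 -> size X = m -> size Y = m ->
     size X' = m -> size Y' = m -> f F X Y X' Y' = g F X Y X' Y') ->
  Eblock P Q m1 m f = Eblock P Q m1 m g.
Proof.
move=> h; apply: eq_Ex => F sF; apply: eq_Ex => X sX; apply: eq_Ex => Y sY.
by apply: eq_Ex => X' sX'; apply: eq_Ex => Y' sY'; apply: h.
Qed.

Lemma EblockZ c f : Eblock P Q m1 m (fun F X Y X' Y' => c * f F X Y X' Y') =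
  c * Eblock P Q m1 m f.
Proof.
rewrite /Eblock -ExZ; apply: eq_Ex => F _.
by rewrite -Ex2Z; apply: eq_Ex2 => X Y; rewrite -Ex2Z.
Qed.

Lemma Eblock_sum (I : finType) (f : I -> _) :
  Eblock P Q m1 m (fun F X Y X' Y' => \sum_i f i F X Y X' Y') =
  \sum_i Eblock P Q m1 m (f i).
Proof.
rewrite /Eblock -Ex_sum; apply: eq_Ex => F _.
by rewrite -Ex2_sum; apply: eq_Ex2 => X Y; rewrite -Ex2_sum.
Qed.

Lemma EblockD f g :
  Eblock P Q m1 m (fun F X Y X' Y' => f F X Y X' Y' + g F X Y X' Y') =
  Eblock P Q m1 m f + Eblock P Q m1 m g.
Proof.
rewrite /Eblock -ExD; apply: eq_Ex => F _.
by rewrite -Ex2D; apply: eq_Ex2 => X Y; rewrite -Ex2D.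
Qed.

Lemma Eblock_const c : Eblock P Q m1 m (fun _ _ _ _ _ => c) = c.
Proof.
transitivity (Ex Q m1 (fun=> c)); last exact: Ex_const.
by apply: eq_Ex => F _; rewrite !Ex2_const.
Qed.

Lemma le_Eblocks t f g : (forall l, f l <= g l) -> Eblocks t f <= Eblocks t g.
Proof.
elim: t f g => [|t IH] f g h //=.
by apply: le_Eblock => // F X Y X' Y' _; apply: IH.
Qed.

Lemma eq_Eblocks t f g : (forall l, f l = g l) -> Eblocks t f = Eblocks t g.
Proof.
elim: t f g => [|t IH] f g h //=.
by apply: eq_Eblock => F X Y X' Y' *; apply: IH.
Qed.

Lemma Eblocks_sum t (I : finType) (f : I -> _) :
  Eblocks t (fun l => \sum_i f i l) = \sum_i Eblocks t (f i).
Proof.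
elim: t f => [|t IH] f //=; rewrite -Eblock_sum.
by apply: eq_Eblock => F X Y X' Y' *; rewrite IH.
Qed.

Lemma EblocksZ t c f : Eblocks t (fun l => c * f l) = c * Eblocks t f.
Proof.
elim: t f => [|t IH] f //=; rewrite -EblockZ.
by apply: eq_Eblock => F X Y X' Y' *; rewrite IH.
Qed.

Lemma EblocksD t f g : Eblocks t (fun l => f l + g l) = Eblocks t f + Eblocks t g.
Proof.
elim: t f g => [|t IH] f g //=; rewrite -EblockD.
by apply: eq_Eblock => F X Y X' Y' *; rewrite IH.
Qed.

Lemma Eblocks_const t c : Eblocks t (fun=> c) = c.
Proof. by elim: t => [|t IH] //=; rewrite IH Eblock_const. Qed.

Lemma Eblocks_exceed phi K tau t :
  Eblocks t (fun l => (all_exceed m1 m phi K tau t l)%:R) =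
  Eblock P Q m1 m (fun F X Y X' Y' => (tau < stat R phi K F X Y X' Y')%R%:R) ^+ t.
Proof.
elim: t => [|t IH] //=; rewrite exprS -IH mulrC -EblockZ.
apply: eq_Eblock => F X Y X' Y' sF sX sY sX' sY'.
rewrite mulrC -EblocksZ; apply: eq_Eblocks => l.
have -> : F ++ X ++ Y ++ X' ++ Y' ++ l = (F ++ X ++ Y ++ X' ++ Y') ++ l.
  by rewrite -!catA.
rewrite all_exceed_cat; last first.
  by rewrite !size_cat sF sX sY sX' sY' /block_size; lia.
by rewrite -!catA block_stat_cat //; case: (_ < _); rewrite /= ?mul1r ?mul0r.
Qed.

(** The two sides draw the same independent samples, once in the order of the tapes and once block
    by block, so exchanging sums suffices. Discarded samples integrate to 1. *)
Lemma Ex_interleave o t f :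
  Ex P (t * (o + m + m)) (fun xs => Ex Q (t * (m1 + m + m)) (fun ys =>
    f (interleave m1 m o t xs ys))) = Eblocks t f.
Proof.
elim: t f => [|t IH] f //.
rewrite !mulSn; set ta := (t * _)%N in IH *; set tb := (t * (m1 + m + m))%N in IH *.
have -> : (o + m + m + ta = o + (m + (m + ta)))%N by rewrite -!addnA.
have -> : (m1 + m + m + tb = m1 + (m + (m + tb)))%N by rewrite -!addnA.
rewrite Ex_cat.
transitivity (Ex P o (fun=> Eblocks t.+1 f)); last by rewrite Ex_const.
apply: eq_Ex => a sa; rewrite Ex_cat.
transitivity (Ex P m (fun X => Ex P m (fun X' => Ex P ta (fun xs =>
  Ex Q m1 (fun F => Ex Q m (fun Y => Ex Q m (fun Y' => Ex Q tb
   (fun ys => f (F ++ X ++ Y ++ X' ++ Y' ++ interleave m1 m o t xs ys))))))))).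
  apply: eq_Ex => X sX; rewrite Ex_cat; apply: eq_Ex => X' sX'.
  apply: eq_Ex => xs _; rewrite Ex_cat; apply: eq_Ex => F sF.
  rewrite Ex_cat; apply: eq_Ex => Y sY; rewrite Ex_cat; apply: eq_Ex => Y' sY'.
  apply: eq_Ex => ys _; congr f => /=.
  rewrite -!addnA !(drop_catD sa) !(drop_catD sF) drop_size_cat // take_size_cat //.
  rewrite drop_size_cat // take_size_cat // take_size_cat //.
  rewrite !(drop_catD sX) !(drop_catD sY) !drop_size_cat // !take_size_cat //.
rewrite /= /Eblock /Ex2.
transitivity (Ex Q m1 (fun F => Ex P m (fun X => Ex P m (fun X' => Ex P ta (fun xs =>
   Ex Q m (fun Y => Ex Q m (fun Y' => Ex Q tb
   (fun ys => f (F ++ X ++ Y ++ X' ++ Y' ++ interleave m1 m o t xs ys))))))))).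
  rewrite [RHS]Ex_exch; apply: eq_Ex => X _; rewrite [RHS]Ex_exch; apply: eq_Ex => X' _.
  by rewrite [RHS]Ex_exch.
apply: eq_Ex => F _; apply: eq_Ex => X _.
transitivity (Ex Q m (fun Y => Ex P m (fun X' => Ex P ta (fun xs =>
   Ex Q m (fun Y' => Ex Q tb
   (fun ys => f (F ++ X ++ Y ++ X' ++ Y' ++ interleave m1 m o t xs ys))))))).
  by rewrite [RHS]Ex_exch; apply: eq_Ex => X' _; rewrite [RHS]Ex_exch.
apply: eq_Ex => Y _; apply: eq_Ex => X' _; rewrite Ex_exch; apply: eq_Ex => Y' _.
exact: (IH (fun l => f (F ++ X ++ Y ++ X' ++ Y' ++ l))).
Qed.

(** The 36 is twice the 18 of [block_null]: a single block then exceeds the threshold with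
    probability at most one half. *)
Lemma blocks_null (J : finType) (phi : J -> T -> nat) (K : nat) (tau : R) t :
  (forall j x, (phi j x < K)%N) -> 0 < tau ->
  (forall j c, mass (phi j) P c = mass (phi j) Q c) ->
  36 * m%:R ^+ 2 <= tau ^+ 2 * m1.+1%:R ->
  Eblocks t (fun l => [exists j, all_exceed m1 m (phi j) K tau t l]%:R) <=
  #|J|%:R * 2^-1 ^+ t.
Proof.
move=> phiK tau0 PQ h.
apply: (le_trans (y := Eblocks t (fun l => \sum_j (all_exceed m1 m (phi j) K tau t l)%:R))).
  apply: le_Eblocks => l; case: existsP => [[j hj]|_] /=; last by apply: sumr_ge0.
  by rewrite (bigD1 j) //= hj lerDl; apply: sumr_ge0.
rewrite Eblocks_sum -sum1_card natr_sum big_distrl /=.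
apply: ler_sum => j _; rewrite mul1r Eblocks_exceed.
have b0 : 0 <= Eblock P Q m1 m (fun F X Y X' Y' => (tau < stat R (phi j) K F X Y X' Y')%R%:R).
  by rewrite -[leLHS]Eblock_const; apply: le_Eblock => // F X Y X' Y' _; case: ltP.
apply: lerXn2r; rewrite ?nnegrE ?invr_ge0 //.
apply: (le_trans (block_null lawP lawQ (phiK j) m1 m tau0 (PQ j))).
have D0 : 0 < tau ^+ 2 * m1.+1%:R by rewrite mulr_gt0 ?exprn_gt0 ?ltr0n.
by rewrite ler_pdivrMr //; lra.
Qed.

(** Bernoulli's inequality [1 - be ^ t <= t (1 - be)], in other words a union bound over the
    blocks. *)
Lemma blocks_alt (phi : T -> nat) (K : nat) (tau del : R) t :
  Eblock P Q m1 m (fun F X Y X' Y' => (stat R phi K F X Y X' Y' <= tau)%R%:R) <= del ->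
  Eblocks t (fun l => (~~ all_exceed m1 m phi K tau t l)%:R) <= t%:R * del.
Proof.
set al := Eblock _ _ _ _ _ => hal.
pose be := Eblock P Q m1 m (fun F X Y X' Y' => (tau < stat R phi K F X Y X' Y')%R%:R).
have e : al + be = 1.
  rewrite /al /be -EblockD -[RHS]Eblock_const; apply: eq_Eblock => F X Y X' Y' *.
  by rewrite ltNge; case: (_ <= _); rewrite /= ?addr0 ?add0r.
have al0 : 0 <= al.
  by rewrite -[leLHS]Eblock_const; apply: le_Eblock => // F X Y X' Y' _; case: (_ <= _).
have be0 : 0 <= be.
  by rewrite -[leLHS]Eblock_const; apply: le_Eblock => // F X Y X' Y' _; case: (_ < _).
have -> : Eblocks t (fun l => (~~ all_exceed m1 m phi K tau t l)%:R) = 1 - be ^+ t.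
  transitivity (Eblocks t (fun l => 1 + -1 * (all_exceed m1 m phi K tau t l)%:R)).
    by apply: eq_Eblocks => l; case: all_exceed => /=; lra.
  by rewrite EblocksD EblocksZ Eblocks_const Eblocks_exceed mulN1r.
apply: (le_trans (y := t%:R * al)); last by apply: ler_wpM2l.
have -> : al = 1 - be by lra.
elim: t => [|t IH]; first by rewrite expr0 subrr mul0r.
have be1 : be <= 1 by lra.
rewrite exprS -natr1; move: (be ^+ t) IH (exprn_ile1 t be0 be1) => x IH x1; nra.
Qed.

End BlockLaw.

(** * Distance of Bayes nets from low-dimensional marginals *)

Section ProductKernels.
Variables (R : realFieldType) (n : nat).
Implicit Types (x y : n.-tuple bool) (A : {set 'I_n}) (f g : 'I_n -> n.-tuple bool -> R).

Definition bern (a : R) (b : bool) : R := if b then a else 1 - a.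

Definition depends_on (V : Type) A (phi : n.-tuple bool -> V) : Prop :=
  forall x y, (forall j, j \in A -> tnth x j = tnth y j) -> phi x = phi y.

(** The chain rule: the joint law in which [f j x] is the probability of a 1 at node [j] given the
    rest of [x] on which it depends. *)
Definition bern_prod f x : R := \prod_j bern (f j x) (tnth x j).

Definition flip (i : 'I_n) x : n.-tuple bool :=
  [tuple (if j == i then ~~ tnth x j else tnth x j) | j < n].

Lemma tnth_flip i x j : tnth (flip i x) j = if j == i then ~~ tnth x j else tnth x j.
Proof. by rewrite tnth_mktuple. Qed.

Lemma flipK i : involutive (flip i).
Proof.
move=> x; apply: eq_from_tnth => j; rewrite !tnth_flip.
by case: eqP => // _; rewrite negbK.
Qed.

(** Sums always run over full points; pairing a point with its flip takes the place of summing out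
    one coordinate. *)
Lemma sum_flip i (F : n.-tuple bool -> R) :
  \sum_x F x = 2^-1 * \sum_x (F x + F (flip i x)).
Proof.
have e : \sum_x F (flip i x) = \sum_x F x by rewrite [RHS](reindex_inj (inv_inj (flipK i))).
by rewrite big_split /= e; field.
Qed.

Lemma depends_sub V (A B : {set 'I_n}) (phi : n.-tuple bool -> V) :
  A \subset B -> depends_on A phi -> depends_on B phi.
Proof. by move=> /subsetP AB dA x y h; apply: dA => j /AB /h. Qed.

Lemma depends_flip V A i (phi : n.-tuple bool -> V) x :
  depends_on A phi -> i \notin A -> phi (flip i x) = phi x.
Proof.
move=> dA iA; apply: dA => j jA; rewrite tnth_flip.
by case: eqP => // e; rewrite -e jA in iA.
Qed.

Variable s : 'S_n.

Definition before (r : nat) : {set 'I_n} := [set j | (s j < r)%N].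

Lemma node_at r : (r < n)%N -> {i : 'I_n | s i = r :> nat}.
Proof. by move=> rn; exists ((s^-1)%g (Ordinal rn)); rewrite permKV. Qed.

Lemma prod_at (F : 'I_n -> R) r i : s i = r :> nat ->
  \prod_(j | (r <= s j)%N) F j = F i * \prod_(j | (r < s j)%N) F j.
Proof.
move=> si; rewrite (bigD1 i) /= ?si //; congr (_ * _); apply: eq_bigl => j.
have -> : (j != i) = (s j != r :> nat) by rewrite -si val_eqE (inj_eq perm_inj).
by lia.
Qed.

Lemma prod_below (F : 'I_n -> R) r i : s i = r :> nat ->
  \prod_(j | (s j < r.+1)%N) F j = F i * \prod_(j | (s j < r)%N) F j.
Proof.
move=> si; rewrite (bigD1 i) /= ?si ?ltnS //; congr (_ * _); apply: eq_bigl => j.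
have -> : (j != i) = (s j != r :> nat) by rewrite -si val_eqE (inj_eq perm_inj).
by lia.
Qed.

Lemma bern_prod_split f r x : bern_prod f x =
  (\prod_(j | (s j < r)%N) bern (f j x) (tnth x j)) *
  \prod_(j | (r <= s j)%N) bern (f j x) (tnth x j).
Proof.
rewrite /bern_prod (bigID (fun j => (s j < r)%N)) /=; congr (_ * _).
by apply: eq_bigl => j; rewrite -leqNgt.
Qed.

Definition ordered f : Prop := forall i, depends_on (before (s i)) (f i).

Lemma depends_below f r : ordered f ->
  depends_on (before r) (fun x => \prod_(j | (s j < r)%N) bern (f j x) (tnth x j)).
Proof.
move=> of_ x y h; apply: eq_bigr => j jr; rewrite h ?inE //.
rewrite (of_ j x y) // => k; rewrite inE => kj; apply: h; rewrite inE.
exact: ltn_trans jr.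
Qed.

(** The kernels at the last positions are removed first: over a point and its flip the two values of
    a kernel add up to 1. As the sum keeps running over all coordinates, each removal leaves a
    factor [1 / 2]. *)
Lemma sum_tail f r (phi : n.-tuple bool -> R) : ordered f -> (r <= n)%N ->
  depends_on (before r) phi ->
  \sum_x phi x * \prod_(j | (r <= s j)%N) bern (f j x) (tnth x j) =
  2^-1 ^+ (n - r) * \sum_x phi x.
Proof.
move=> of_; move: {2}(n - r)%N (erefl (n - r)%N) => k.
elim: k r phi => [|k IH] r phi ek rn dphi.
  rewrite ek expr0 mul1r; apply: eq_bigr => x _; rewrite big_pred0 ?mulr1 // => j.
  by have := ltn_ord (s j); lia.
have rn' : (r < n)%N by lia.
have [i si] := node_at rn'.
have dsub : before r \subset before r.+1.
  by apply/subsetP => j; rewrite !inE; lia.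
transitivity (\sum_x (phi x * bern (f i x) (tnth x i)) *
    \prod_(j | (r < s j)%N) bern (f j x) (tnth x j)).
  by apply: eq_bigr => x _; rewrite (prod_at _ si) mulrA.
have ek' : (n - r.+1 = k)%N by lia.
rewrite (IH r.+1) //; last first.
  move=> x y h; rewrite (depends_sub dsub dphi h) h ?inE ?si // (of_ i x y) // => j.
  by rewrite inE si => jr; apply: h; rewrite inE; lia.
rewrite ek ek' exprSr -mulrA; congr (_ * _); rewrite (sum_flip i); congr (_ * _).
have iN : i \notin before r by rewrite inE si ltnn.
apply: eq_bigr => x _; rewrite (depends_flip x dphi iN) tnth_flip eqxx.
have iN' : i \notin before (s i) by rewrite inE ltnn.
rewrite (depends_flip x (of_ i) iN') -mulrDr.
by rewrite -[RHS]mulr1; congr (_ * _); rewrite /bern; case: (tnth _ _) => /=; ring.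
Qed.

Lemma bern_prod_law f : ordered f -> (forall i x, 0 <= f i x <= 1) -> is_law (bern_prod f).
Proof.
move=> of_ f01; split=> [x|].
  apply: prodr_ge0 => j _; rewrite /bern; have /andP[] := f01 j x.
  by case: (tnth _ _) => //; rewrite subr_ge0.
have := @sum_tail f 0%N (fun=> 1) of_ isT (fun _ _ _ => erefl).
rewrite sumr_const card_tuple card_bool subn0 => e.
rewrite -[RHS](_ : 2^-1 ^+ n * (1 *+ 2 ^ n) = 1); last first.
  by rewrite natrX exprVn mulVf ?expf_neq0 ?pnatr_eq0.
by rewrite -e; apply: eq_bigr => x _; rewrite mul1r.
Qed.

(** A coordinate minus its kernel is a martingale difference, hence orthogonal to every function of
    the past. *)
Lemma sum_residual f i (psi : n.-tuple bool -> R) : ordered f ->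
  depends_on (before (s i)) psi ->
  \sum_x bern_prod f x * (((tnth x i)%:R - f i x) * psi x) = 0.
Proof.
move=> of_ dpsi.
have dsub : before (s i) \subset before (s i).+1.
  by apply/subsetP => j; rewrite !inE; lia.
pose phi x := (\prod_(j | (s j < (s i).+1)%N) bern (f j x) (tnth x j)) *
  (((tnth x i)%:R - f i x) * psi x).
have -> : \sum_x bern_prod f x * (((tnth x i)%:R - f i x) * psi x) =
   \sum_x phi x * \prod_(j | ((s i).+1 <= s j)%N) bern (f j x) (tnth x j).
  by apply: eq_bigr => x _; rewrite (bern_prod_split f (s i).+1) /phi; ring.
rewrite sum_tail //; last first.
  move=> x y h; rewrite /phi (depends_below of_ h); congr (_ * _).
  by rewrite h ?inE // (depends_sub dsub (of_ i) h) (depends_sub dsub dpsi h).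
rewrite (sum_flip i) big1 ?mulr0 // => x _.
have iN : i \notin before (s i) by rewrite inE ltnn.
rewrite /phi !(@prod_below _ (s i) i) //.
rewrite (depends_flip x (depends_below (r := s i) of_) iN) (depends_flip x dpsi iN).
rewrite (depends_flip x (of_ i) iN) tnth_flip eqxx /bern.
by case: (tnth _ _) => /=; ring.
Qed.

(** The hybrid [H r] takes the kernels of [g] at positions before [r] and those of [f] from [r] on.
    Neighbouring hybrids share a prefix governed by [g] and a tail that sums out, so each gap is a
    mean under [g] alone. *)
Lemma hybrid_bound f g : ordered f -> ordered g ->
  (forall i x, 0 <= f i x <= 1) -> (forall i x, 0 <= g i x <= 1) ->
  \sum_x `|bern_prod f x - bern_prod g x| <=
  \sum_i 2 * \sum_x bern_prod g x * `|g i x - f i x|.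
Proof.
move=> of_ og f01 g01.
have b0 h i x : (forall i x, 0 <= h i x <= 1) -> 0 <= bern (h i x) (tnth x i).
  by move=> h01; rewrite /bern; have /andP[] := h01 i x; case: (tnth _ _) => // ? ?; rewrite subr_ge0.
pose H r x := (\prod_(j | (s j < r)%N) bern (g j x) (tnth x j)) *
  \prod_(j | (r <= s j)%N) bern (f j x) (tnth x j).
have step i : \sum_x `|H (s i).+1 x - H (s i) x| =
   2 * \sum_x bern_prod g x * `|g i x - f i x|.
  pose phi x := (\prod_(j | (s j < s i)%N) bern (g j x) (tnth x j)) * `|g i x - f i x|.
  have dsub : before (s i) \subset before (s i).+1.
    by apply/subsetP => j; rewrite !inE; lia.
  have dphi : depends_on (before (s i)) phi.
    by move=> x y h; rewrite /phi (depends_below og h) (og i _ _ h) (of_ i _ _ h).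
  have -> : \sum_x `|H (s i).+1 x - H (s i) x| =
     \sum_x phi x * \prod_(j | ((s i).+1 <= s j)%N) bern (f j x) (tnth x j).
    apply: eq_bigr => x _; rewrite /H (@prod_below _ (s i) i) // (@prod_at _ (s i) i) //.
    rewrite /phi; set a := \prod_(j | _) _; set b := \prod_(j | _) _.
    have -> : bern (g i x) (tnth x i) * a * b - a * (bern (f i x) (tnth x i) * b) =
       a * (bern (g i x) (tnth x i) - bern (f i x) (tnth x i)) * b by ring.
    rewrite !normrM (ger0_norm (_ : 0 <= a)) ?(ger0_norm (_ : 0 <= b)).
    - congr (_ * _ * _); rewrite /bern; case: (tnth _ _) => //.
      rewrite distrC; have -> // : 1 - f i x - (1 - g i x) = g i x - f i x by ring.
    - by apply: prodr_ge0 => j _; apply: b0.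
    - by apply: prodr_ge0 => j _; apply: b0.
  rewrite (sum_tail of_) //; last exact: (depends_sub dsub dphi).
  have -> : \sum_x bern_prod g x * `|g i x - f i x| =
     \sum_x phi x * \prod_(j | (s i <= s j)%N) bern (g j x) (tnth x j).
    by apply: eq_bigr => x _; rewrite (bern_prod_split g (s i)) /phi; ring.
  rewrite (sum_tail og) //; last by rewrite ltnW.
  (* The tail sums leave [2 ^- (n - s i - 1)] on one side and [2 ^- (n - s i)] on the other, whence
     the factor 2: both values of the bit contribute. *)
  by rewrite -(subnSK (ltn_ord (s i))) exprS !mulrA mulfV ?mul1r ?pnatr_eq0.
have tele x : bern_prod f x - bern_prod g x = - \sum_i (H (s i).+1 x - H (s i) x).
  rewrite (reindex_inj (@perm_inj _ (s^-1)%g)) /=.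
  under eq_bigr do rewrite permKV.
  have := telescope_sumr (fun r => H r x) (leq0n n); rewrite big_mkord => ->.
  rewrite opprB; congr (_ - _).
    rewrite (bern_prod_split f 0) /H; congr (_ * _); by rewrite !big_pred0.
  rewrite (bern_prod_split g n) /H; congr (_ * _).
  by rewrite !big_pred0 // => j; rewrite leqNgt ltn_ord.
under eq_bigr do rewrite tele normrN.
apply: (le_trans (y := \sum_x \sum_i `|H (s i).+1 x - H (s i) x|)).
  by apply: ler_sum => x _; apply: ler_norm_sum.
by rewrite exchange_big /=; apply: ler_sum => i _; rewrite step.
Qed.

End ProductKernels.

(** * Numbering tuples of coordinates and their values *)

Section Codes.
Implicit Types (J : nat -> nat) (x y : seq bool).

Definition code J m x : nat := (\sum_(k < m) nth false x (J k) * 2 ^ k)%N.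

Definition digit n c k : nat := ((c %/ n ^ k) %% n)%N.

Lemma code_lt J m x : (code J m x < 2 ^ m)%N.
Proof.
elim: m => [|m IH]; first by rewrite /code big_ord0.
rewrite /code big_ord_recr /= -/(code J m x) expnS mul2n -addnn -addSn leq_add //.
by case: nth => //=; rewrite mul1n.
Qed.

Lemma code_inj J m x y : code J m x = code J m y ->
  forall k, (k < m)%N -> nth false x (J k) = nth false y (J k).
Proof.
elim: m => [|m IH] //; rewrite /code !big_ord_recr /= -!/(code J m _) => e k.
have hx := code_lt J m x; have hy := code_lt J m y.
have eb : nth false x (J m) = nth false y (J m).
  by move: e; case: (nth false x _); case: (nth false y _) => //=; lia.
rewrite ltnS leq_eqVlt => /orP[/eqP -> //|]; apply: IH.
by move: e; rewrite eb; lia.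
Qed.

(** Codes below [n ^ m] run over all [m]-tuples of nodes, repetitions included. Allowing repetitions
    lets the tester enumerate tuples with a plain counter in base [n]. *)
Lemma digit_surj n (a : nat -> nat) m : (forall k, (a k < n)%N) ->
  exists2 c, (c < n ^ m)%N & forall k, (k < m)%N -> digit n c k = a k.
Proof.
move=> an; elim: m => [|m [c cn IH]]; first by exists 0%N.
have n0 : (0 < n)%N by apply: leq_trans (an 0%N).
exists (a m * n ^ m + c)%N.
  rewrite expnS; apply: (leq_trans (n := (a m * n ^ m + n ^ m)%N)).
    by rewrite ltn_add2l.
  by rewrite -mulSnr leq_mul2r an orbT.
move=> k; rewrite ltnS leq_eqVlt => /orP[/eqP ->|km].
  by rewrite /digit divnMDl ?expn_gt0 ?n0 // divn_small // addn0 modn_small.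
have -> : (a m * n ^ m + c = (a m * n ^ (m - k).-1 * n) * n ^ k + c)%N.
  by congr (_ + c)%N; rewrite -!mulnA -expnS -expnD; congr (_ * n ^ _)%N; lia.
by rewrite -(IH k km) /digit divnMDl ?expn_gt0 ?n0 // modnMDl.
Qed.

End Codes.

(** * Factorization of a Bayes net into kernels *)

Section NetFactorization.
Variables (R : realFieldType) (n : nat).
Implicit Types (P : {ffun n.-tuple bool -> R}) (x y : n.-tuple bool) (A : {set 'I_n}).

Lemma in_agree A x y : reflect (forall j, j \in A -> tnth y j = tnth x j) (y \in agree A x).
Proof.
rewrite inE; apply: (iffP forall_inP) => h j jA; first by apply/eqP; apply: h.
by apply/eqP; apply: h.
Qed.

Lemma prob_sub P (A B : {set n.-tuple bool}) : is_dist P -> A \subset B -> prob P A <= prob P B.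
Proof.
move=> [P0 _] AB; rewrite /prob [leRHS](bigID (mem A)) /=.
rewrite (eq_bigl (fun x => (x \in B) && (x \in A))) => [|x].
  by rewrite lerDl; apply: sumr_ge0.
by rewrite andb_idl // => /(subsetP AB).
Qed.

Lemma prob_ge0 P (A : {set n.-tuple bool}) : is_dist P -> 0 <= prob P A.
Proof. by move=> [P0 _]; apply: sumr_ge0. Qed.

Lemma cprob01 P (A B : {set n.-tuple bool}) : is_dist P -> 0 <= cprob P A B <= 1.
Proof.
move=> dP; have h : prob P (A :&: B) <= prob P B by apply: prob_sub => //; exact: subsetIr.
rewrite /cprob; have := prob_ge0 (A :&: B) dP; have := prob_ge0 B dP; rewrite le_eqVlt => /orP[/eqP <-|B0] a0.
  by rewrite invr0 mulr0 lexx ler01.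
by apply/andP; split; [apply: divr_ge0 => //; exact: ltW|rewrite ler_pdivrMr // mul1r].
Qed.

Lemma agree_sub A (B : {set 'I_n}) x : A \subset B -> agree B x \subset agree A x.
Proof.
move=> /subsetP AB; apply/subsetP => y /in_agree h; apply/in_agree => j /AB; exact: h.
Qed.

Lemma eq_agree A x y : y \in agree A x -> agree A y = agree A x.
Proof.
move=> /in_agree h; apply/setP => z; apply/in_agree/in_agree => h' j jA; rewrite h' ?h //.
Qed.

(** The event on the parents splits into events on all earlier coordinates. On pieces of positive
    probability the net property gives the same conditional probability [c], and pieces of
    probability zero contribute nothing; so the residual of the coordinate against [c] sums to 0 on
    every piece. *)
Lemma cprob_parents (S : rel 'I_n) P (s : 'S_n) i x : is_dist P -> topological S s ->
  (forall x y, 0 < prob P (agree (earlier s i) x) -> 0 < prob P (agree (earlier s i) y) ->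
     y \in agree (parents S i) x ->
     cprob P (coord_one i) (agree (earlier s i) x) =
     cprob P (coord_one i) (agree (earlier s i) y)) ->
  0 < prob P (agree (earlier s i) x) ->
  cprob P (coord_one i) (agree (parents S i) x) =
  cprob P (coord_one i) (agree (earlier s i) x).
Proof.
move=> dP top hP xpos; set c := RHS; set E := earlier s i in xpos hP c *.
have pE : parents S i \subset E by apply/subsetP => j; rewrite !inE; apply: top.
have ppos : 0 < prob P (agree (parents S i) x).
  by apply: (lt_le_trans xpos); apply: prob_sub => //; apply: agree_sub.
have coordE (B : {set n.-tuple bool}) : prob P (coord_one i :&: B) = \sum_(y in B) P y * (tnth y i)%:R.
  rewrite /prob [RHS](bigID (fun y => tnth y i)) /= [X in _ + X]big1 ?addr0.
    apply: eq_big => [y|y /setIP[]]; first by rewrite !inE andbC.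
    by rewrite inE => -> _; rewrite mulr1.
  by move=> y /andP[_ /negPf ->]; rewrite mulr0.
have resid (B : {set n.-tuple bool}) :
    \sum_(y in B) P y * ((tnth y i)%:R - c) = prob P (coord_one i :&: B) - c * prob P B.
  by rewrite coordE /prob big_distrr -sumrB; apply: eq_bigr => y _; rewrite /=; ring.
apply: (mulIf (lt0r_neq0 ppos)); rewrite {1}/cprob divfK ?lt0r_neq0 //.
apply/eqP; rewrite -subr_eq0 -resid; apply/eqP.
(* The pieces are fibres of [mask], which erases the coordinates outside [E]. *)
pose mask y := [tuple (j \in E) && tnth y j | j < n].
rewrite (partition_big mask predT) //= big1 // => z _.
case: (pickP [pred y in agree (parents S i) x | mask y == z]) => [y0|none]; last first.
  by rewrite big_pred0.
move=> /andP[/= y0x /eqP <-].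
rewrite (eq_bigl (mem (agree E y0))); last first.
  move=> y; rewrite /=; apply/andP/in_agree.
    move=> [_ /eqP e] j jE; have := congr1 (fun t : n.-tuple bool => tnth t j) e.
    by rewrite !tnth_mktuple jE.
  move=> h; split; last first.
    apply/eqP; apply: eq_from_tnth => j; rewrite !tnth_mktuple.
    by case: (boolP (j \in E)) => //= jE; rewrite h.
  apply/in_agree => j jp; rewrite h; last exact: (subsetP pE).
  by move/in_agree: y0x => ->.
rewrite resid; have := prob_ge0 (agree E y0) dP; rewrite le_eqVlt => /orP[/eqP e|y0pos].
  rewrite -e mulr0 subr0; apply/eqP; rewrite eq_le prob_ge0 // andbT e.
  by apply: prob_sub => //; apply: subsetIr.
by rewrite /c (hP x y0) // /cprob divfK ?subrr ?lt0r_neq0.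
Qed.

(** Chain rule along the topological order. At parent configurations of probability zero [g] is
    arbitrary, since the prefix has probability zero and both sides vanish; this covers the table
    entries that a description leaves free. *)
Lemma net_factorization (S : rel 'I_n) P (g : 'I_n -> n.-tuple bool -> R) :
  bayes_net S P ->
  (forall i x, 0 < prob P (agree (parents S i) x) ->
     g i x = cprob P (coord_one i) (agree (parents S i) x)) ->
  forall x, P x = bern_prod g x.
Proof.
move=> [_ dP [s [top hP]]] hg x.
suff chain r : (r <= n)%N -> prob P (agree (before s r) x) =
    \prod_(j | (s j < r)%N) bern (g j x) (tnth x j).
  have := chain n (leqnn n).
  rewrite /bern_prod (eq_bigl xpredT) => [<-|j]; last by rewrite ltn_ord.
  rewrite /prob (big_pred1 x) // => y; apply/in_agree/eqP => [h|-> //].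
  by apply: eq_from_tnth => j; apply: h; rewrite inE ltn_ord.
elim: r => [|r IH] rn.
  rewrite big_pred0 // -dP.2 /prob; apply: eq_bigl => y; apply/in_agree => j.
  by rewrite inE.
have [i si] := node_at s rn.
rewrite (prod_below _ si) -IH ?(ltnW rn) //.
have eE : before s r = earlier s i by apply/setP => j; rewrite !inE si.
rewrite eE; set E := earlier s i.
have split : prob P (agree (before s r.+1) x) =
   if tnth x i then prob P (coord_one i :&: agree E x)
   else prob P (agree E x) - prob P (coord_one i :&: agree E x).
  have mem y : (y \in agree (before s r.+1) x) = (y \in agree E x) && (tnth y i == tnth x i).
    apply/in_agree/andP.
      move=> h; split; last by rewrite h // inE si.
      by apply/in_agree => j; rewrite inE => jr; apply: h; rewrite inE -si; lia.
    move=> [/in_agree h /eqP e] j; rewrite inE ltnS leq_eqVlt => /orP[|jr].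
      by rewrite -si val_eqE (inj_eq perm_inj) => /eqP ->.
    by apply: h; rewrite inE si.
  case: (boolP (tnth x i)) => xi.
    by apply: eq_bigl => y; rewrite mem xi eqb_id !inE andbC.
  apply/eqP; rewrite eq_sym subr_eq; apply/eqP.
  rewrite /prob (bigID (fun y => tnth y i)) /= addrC; congr (_ + _); apply: eq_bigl => y.
    by rewrite mem (negPf xi) eqbF_neg.
  by rewrite !inE andbC.
rewrite split; have := prob_ge0 (agree E x) dP; rewrite le_eqVlt => /orP[/eqP e|pos].
  have e0 : prob P (coord_one i :&: agree E x) = 0.
    apply/eqP; rewrite eq_le prob_ge0 // andbT e.
    by apply: prob_sub => //; apply: subsetIr.
  by rewrite e0 -e mulr0 subrr; case: ifP.
have ppos : 0 < prob P (agree (parents S i) x).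
  apply: (lt_le_trans pos); apply: prob_sub => //; apply: agree_sub.
  by apply/subsetP => j; rewrite !inE; apply: top.
rewrite hg // (cprob_parents dP top (hP i)) // -/E /bern /cprob.
case: ifP => _; first by rewrite divfK // lt0r_neq0.
by rewrite mulrBl mul1r divfK // lt0r_neq0.
Qed.

End NetFactorization.

(** * From small marginals to the l1 distance *)

Section Marginals.
Variable R : realFieldType.

(** A test that is constant on the fibres of [phi] is a test of the two image laws, and a test
    bounded by 1 cannot separate them by more than their l1 distance. *)
Lemma mass_test (T : finType) (P Q : T -> R) (phi : T -> nat) K (psi : T -> R) :
  (forall x, (phi x < K)%N) -> (forall x y, phi x = phi y -> psi x = psi y) ->
  (forall x, `|psi x| <= 1) ->
  `|\sum_x P x * psi x - \sum_x Q x * psi x| <=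
  \sum_(c < K) `|mass phi P c - mass phi Q c|.
Proof.
move=> phiK hpsi psi1; rewrite -sumrB.
rewrite (partition_big (fun x => Ordinal (phiK x)) xpredT) //=.
apply: (le_trans (ler_norm_sum _ _ _)); apply: ler_sum => c _.
have massE U : mass phi U c = \sum_(x | Ordinal (phiK x) == c) U x.
  rewrite [RHS]big_mkcond; apply: eq_bigr => x _; rewrite -val_eqE /=.
  by case: eqP => _; rewrite ?mulr1 ?mulr0.
case: (pickP (fun x => Ordinal (phiK x) == c)) => [x0 x0c|none]; last first.
  by rewrite big_pred0 // normr0.
rewrite !massE -sumrB.
have -> : \sum_(x | Ordinal (phiK x) == c) (P x * psi x - Q x * psi x) =
  psi x0 * \sum_(x | Ordinal (phiK x) == c) (P x - Q x).
  rewrite big_distrr; apply: eq_bigr => x xc /=; rewrite (hpsi x x0); first by ring.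
  by move: xc x0c; rewrite -!val_eqE => /eqP /= -> /eqP /= ->.
by rewrite normrM ler_piMl.
Qed.

Variable n : nat.
Implicit Types (P Q : {ffun n.-tuple bool -> R}) (x y : n.-tuple bool).

Definition marginal_dist P Q m c : R :=
  \sum_(b < 2 ^ m) `|mass (fun x : n.-tuple bool => code (digit n c) m x) P b -
                     mass (fun x : n.-tuple bool => code (digit n c) m x) Q b|.

Lemma cover_by_digits (A : {set 'I_n}) (i : 'I_n) m : (#|A| <= m)%N ->
  exists2 c, (c < n ^ m.+1)%N & forall x y,
    code (digit n c) m.+1 x = code (digit n c) m.+1 y ->
    forall j, j \in i |: A -> tnth x j = tnth y j.
Proof.
(* The default value of [nth] is [i]: digits beyond the elements of [A] name the node itself, and as
   [A] has at most [m] elements the digit of index [m] always does. *)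
move=> Am; have [c cn hc] := @digit_surj n (fun k => nth i (enum A) k) m.+1 (fun k => ltn_ord _).
exists c => // x y /code_inj e j jA.
have [k km ek] : exists2 k, (k < m.+1)%N & nth i (enum A) k = j.
  case/setU1P: jA => [->|jA].
    by exists m => //; apply: nth_default; rewrite -cardE.
  exists (index j (enum A)); last by rewrite nth_index // mem_enum.
  by rewrite ltnS; apply: leq_trans Am; rewrite cardE ltnW // index_mem mem_enum.
have := e k km; rewrite hc // ek.
by rewrite !(tnth_nth false).
Qed.

Lemma square_test P Q (A : {set 'I_n}) (i : 'I_n) m (h : n.-tuple bool -> R) (gam : R) :
  (#|A| <= m)%N -> depends_on A h -> (forall x, 0 <= h x <= 1) ->
  (forall c, (c < n ^ m.+1)%N -> marginal_dist P Q m.+1 c <= gam) ->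
  `|\sum_x P x * ((tnth x i)%:R - h x) ^+ 2 - \sum_x Q x * ((tnth x i)%:R - h x) ^+ 2| <= gam.
Proof.
move=> Am dh h01 hgam; have [c cn hc] := cover_by_digits i Am.
apply: le_trans (hgam c cn); apply: mass_test.
- by move=> x; apply: code_lt.
- move=> x y /hc e; rewrite e ?setU11 // (dh x y) // => j jA.
  by apply: e; rewrite setU1r.
- move=> x; rewrite ger0_norm ?sqr_ge0 //; have /andP[] := h01 x.
  by case: (tnth x i) => /=; move: (h x) => z; nra.
Qed.

(* Both conditional expectations are optimal quadratic predictors given the past;
   the prediction errors only involve the marginals on a node and one parent set,
   so comparing them pairwise bounds the distance between the two predictors. *)
Lemma predictors_close (s : 'S_n) (f g : 'I_n -> n.-tuple bool -> R)
    (A B : {set 'I_n}) (i : 'I_n) m (gam : R) P Q :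
  ordered s f -> ordered s g ->
  (forall i x, 0 <= f i x <= 1) -> (forall i x, 0 <= g i x <= 1) ->
  (forall x, P x = bern_prod f x) -> (forall x, Q x = bern_prod g x) ->
  depends_on A (f i) -> depends_on B (g i) -> (#|A| <= m)%N -> (#|B| <= m)%N ->
  (forall c, (c < n ^ m.+1)%N -> marginal_dist P Q m.+1 c <= gam) ->
  \sum_x Q x * (g i x - f i x) ^+ 2 <= 2 * gam.
Proof.
move=> of_ og f01 g01 Pf Qg dA dB cA cB hgam.
have hf := square_test i cA dA (f01 i) hgam; have hg := square_test i cB dB (g01 i) hgam.
(* Pythagoras: both predictors depend on the past only, so the cross term vanishes by
   [sum_residual]. *)
have pyth (u v : 'I_n -> n.-tuple bool -> R) (U : {ffun n.-tuple bool -> R}) :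
    ordered s u -> depends_on (before s (s i)) (v i) -> (forall x, U x = bern_prod u x) ->
    \sum_x U x * ((tnth x i)%:R - v i x) ^+ 2 =
    \sum_x U x * ((tnth x i)%:R - u i x) ^+ 2 + \sum_x U x * (u i x - v i x) ^+ 2.
  move=> ou dv Uu; have r0 := @sum_residual _ _ s u i (fun x => 2 * (u i x - v i x)) ou.
  rewrite -[LHS]addr0 -[X in _ + X](oppr0) -[X in - X]r0; last first.
    by move=> x y h; rewrite (ou i x y h) (dv x y h).
  rewrite -sumrB -big_split; apply: eq_bigr => x _; rewrite Uu /=; ring.
(* [e1] writes the sum to be bounded as the excess loss of [f] over [g] under [Q], while [e2] says
   that under [P] the predictor [f] is no worse than [g]. Passing from [Q] to [P] for each of the
   two losses costs [gam] twice. *)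
have e1 := pyth g f Q og (of_ i) Qg.
have e2 := pyth f g P of_ (og i) Pf.
have p0 : 0 <= \sum_x P x * (f i x - g i x) ^+ 2.
  apply: sumr_ge0 => x _; rewrite mulr_ge0 ?sqr_ge0 // Pf.
  by have [h _] := bern_prod_law of_ f01.
move: hf hg; rewrite !ler_norml => /andP[a1 a2] /andP[a3 a4]; lra.
Qed.

(** With [a = 1 / (2 n E)] the bound [2 * gam] of [predictors_close] is exactly [a ^ 2]. Then
    [z <= z ^ 2 / (2 a) + a / 2] bounds the mean gap of two kernels by [a], and [n] nodes at the
    price [2 a] each add up to [1 / E]. *)
Lemma marginals_determine (SP SQ : rel 'I_n) P Q m (E : nat) :
  (0 < n)%N -> (0 < E)%N -> bayes_net SP P -> bayes_net SQ Q -> same_ordering SP SQ ->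
  (forall i, #|parents SP i| <= m)%N -> (forall i, #|parents SQ i| <= m)%N ->
  (forall c, (c < n ^ m.+1)%N -> marginal_dist P Q m.+1 c <= (8 * n%:R ^+ 2 * E%:R ^+ 2)^-1) ->
  l1dist P Q <= E%:R^-1.
Proof.
move=> n0 E0 bP bQ [s [topP topQ]] dP dQ hgam.
pose f i x := cprob P (coord_one i) (agree (parents SP i) x).
pose g i x := cprob Q (coord_one i) (agree (parents SQ i) x).
have lP : is_dist P by case: bP. have lQ : is_dist Q by case: bQ.
have Pf := net_factorization bP (fun i x _ => erefl (f i x)).
have Qg := net_factorization bQ (fun i x _ => erefl (g i x)).
have dep (S : rel 'I_n) (U : {ffun n.-tuple bool -> R}) i :
    depends_on (parents S i) (fun x => cprob U (coord_one i) (agree (parents S i) x)).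
  by move=> x y h; rewrite (@eq_agree _ _ y x) //; apply/in_agree.
have sub (S : rel 'I_n) i : topological S s -> parents S i \subset before s (s i).
  by move=> top; apply/subsetP => j; rewrite !inE; apply: top.
have of_ : ordered s f by move=> i; apply: depends_sub (sub _ _ topP) (dep SP P i).
have og : ordered s g by move=> i; apply: depends_sub (sub _ _ topQ) (dep SQ Q i).
have f01 i x : 0 <= f i x <= 1 by apply: cprob01.
have g01 i x : 0 <= g i x <= 1 by apply: cprob01.
have nR : 0 < n%:R :> R by rewrite ltr0n.
have ER : 0 < E%:R :> R by rewrite ltr0n.
pose a : R := (2 * n%:R * E%:R)^-1.
have a0 : 0 < a by rewrite invr_gt0 !mulr_gt0.
have ai0 : 0 <= 2^-1 * a^-1 by apply: mulr_ge0 => //; rewrite invr_ge0 ltW.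
apply: (le_trans (y := \sum_i 2 * \sum_x bern_prod g x * `|g i x - f i x|)).
  rewrite /l1dist; under eq_bigr do rewrite Pf Qg.
  exact: hybrid_bound.
have -> : E%:R^-1 = \sum_(i < n) 2 * a.
  rewrite sumr_const card_ord /a -mulr_natl; field.
  by rewrite !lt0r_neq0.
apply: ler_sum => i _; apply: ler_wpM2l => //.
have h := predictors_close of_ og f01 g01 Pf Qg (dep SP P i) (dep SQ Q i) (dP i) (dQ i) hgam.
apply: (le_trans (y := \sum_x (2^-1 * a^-1 * (Q x * (g i x - f i x) ^+ 2) + 2^-1 * a * Q x))).
  apply: ler_sum => x _; rewrite -Qg.
  have -> : 2^-1 * a^-1 * (Q x * (g i x - f i x) ^+ 2) + 2^-1 * a * Q x =
     Q x * (2^-1 * a^-1 * `|g i x - f i x| ^+ 2 + 2^-1 * a).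
    by rewrite real_normK ?num_real //; ring.
  apply: ler_wpM2l; first exact: lQ.1.
  rewrite -subr_ge0; set z := `|_|.
  have -> : 2^-1 * a^-1 * z ^+ 2 + 2^-1 * a - z = 2^-1 * a^-1 * (z - a) ^+ 2.
    by field; exact: lt0r_neq0.
  by apply: mulr_ge0 => //; apply: sqr_ge0.
rewrite big_split /= -!big_distrr /= lQ.2 mulr1.
apply: (le_trans (y := 2^-1 * a^-1 * a ^+ 2 + 2^-1 * a)).
  rewrite lerD2r; apply: ler_wpM2l => //.
  apply: (le_trans h); rewrite le_eqVlt; apply/orP; left; apply/eqP; rewrite /a; field.
  by rewrite !lt0r_neq0.
rewrite le_eqVlt; apply/orP; left; apply/eqP; field; exact: lt0r_neq0.
Qed.

End Marginals.

(** * Hoare logic with time bounds *)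

(* The diagonal of the adjacency matrix of a DAG is zero, so the cells
   2 + v * (n + 1) are free both in its input layout and beyond it: they serve as
   the variables of our programs. *)
Definition num_vars : nat := 40.

(** The variable number [v] is fixed in the program, so the product [v * n] unfolds into [v]
    additions and an address has constant cost. *)
Fixpoint times_n (v : nat) : nexp :=
  if v is v'.+1 then NAdd (times_n v') (NMem (NNum 0)) else NNum 0.

(* The atoms are locked so that rewriting with the evaluation rules stops at them. *)
Definition Vad (v : nat) : nexp := NAdd (NNum (2 + v)) (times_n v).
Definition Va (v : nat) : nexp := locked (NMem (Vad v)).
Definition Nn : nexp := locked (NMem (NNum 0)).
Definition Dn : nexp := locked (NMem (NNum 1)).
Definition Ar (e : nexp) : nexp := locked (NMem (NAdd (Va 0) e)).
Definition Mat (e : nexp) : nexp := locked (NMem (NAdd (NNum 2) e)).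
Definition Rr (e : nexp) : rexp := locked (RMem (NAdd (Va 1) e)).
Definition Tab (e : nexp) : rexp := locked (RMem (NAdd (NNum 1) e)).
Definition Eps : rexp := locked (RMem (NNum 0)).

Definition SetV (v : nat) (e : nexp) : cmd := CSetN (Vad v) e.
Definition SetA (a e : nexp) : cmd := CSetN (NAdd (Va 0) a) e.
Definition SetRr (a : nexp) (e : rexp) : cmd := CSetR (NAdd (Va 1) a) e.
Definition CoinV (v : nat) : cmd := CCoin (Vad v).
Definition LtN (a b : nexp) : bexp := BLeN (NAdd a (NNum 1)) b.
Definition EqN (a b : nexp) : bexp := BAnd (BLeN a b) (BLeN b a).
Definition For (v : nat) (e : nexp) (c : cmd) : cmd :=
  CSeq (SetV v (NNum 0))
    (CWhile (LtN (Va v) e) (CSeq c (SetV v (NAdd (Va v) (NNum 1))))).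

Arguments neval : simpl never.
Arguments reval : simpl never.
Arguments beval : simpl never.

Lemma evalE (R : realFieldType) (s : state R) :
  ((forall k, neval s (NNum k) = k) *
   (forall a, neval s (NMem a) = nmem s (neval s a)) *
   (forall a b, neval s (NAdd a b) = (neval s a + neval s b)%N) *
   (forall a b, neval s (NSub a b) = (neval s a - neval s b)%N)) *
  ((forall a, reval s (RNat a) = (neval s a)%:R) *
   (forall a, reval s (RMem a) = rmem s (neval s a)) *
   (forall a b, reval s (RAdd a b) = reval s a + reval s b) *
   (forall a, reval s (ROpp a) = - reval s a) *
   (forall a b, reval s (RMul a b) = reval s a * reval s b) *
   (forall a, reval s (RInv a) = (reval s a)^-1)) *
  ((forall a b, beval s (BLeN a b) = (neval s a <= neval s b)%N) *
   (forall a b, beval s (BLeR a b) = (reval s a <= reval s b)) *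
   (forall a, beval s (BNot a) = ~~ beval s a) *
   (forall a b, beval s (BAnd a b) = beval s a && beval s b)).
Proof. by []. Qed.

Section Logic.
Variable R : realFieldType.

(** An abstract state separates what the machine keeps in one memory: variables, working array and
    real array become independent functions, and the input becomes constant. Questions of aliasing
    are settled once, in [rep]. *)
Record ast : Type := Ast {
  va : nat -> nat; ar : nat -> nat; rv : nat -> R;
  lt : bool -> seq bool; co : seq bool; sa : bool -> seq (seq bool) }.

Definition wva (s : ast) f := Ast f (ar s) (rv s) (lt s) (co s) (sa s).
Definition war (s : ast) f := Ast (va s) f (rv s) (lt s) (co s) (sa s).
Definition wrv (s : ast) f := Ast (va s) (ar s) f (lt s) (co s) (sa s).
Definition wlt (s : ast) f := Ast (va s) (ar s) (rv s) f (co s) (sa s).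
Definition wco (s : ast) f := Ast (va s) (ar s) (rv s) (lt s) f (sa s).
Definition wsa (s : ast) f := Ast (va s) (ar s) (rv s) (lt s) (co s) f.

(* [eqn] rather than [==], so that reading a numbered variable computes. *)
Definition put (V : Type) (f : nat -> V) (k : nat) (x : V) : nat -> V :=
  fun k' => if eqn k' k then x else f k'.

Arguments put [V] f k x k' /.

Definition setv s v x := wva s (put (va s) v x).
Definition seta s v x := war s (put (ar s) v x).
Definition setr s v x := wrv s (put (rv s) v x).

Variables (n d A0 RB : nat) (mt : nat -> nat -> bool) (eps : R) (tab : nat -> R).
Hypotheses (n0 : (0 < n)%N) (hA0 : (2 + (n + num_vars) * n.+1 <= A0)%N) (hRB : (0 < RB)%N).

Implicit Types (a : ast) (s : state R).

Definition adr (v : nat) : nat := (2 + v * n.+1)%N.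

Definition rep (a : ast) (s : state R) : Prop :=
  [/\ [/\ nmem s 0 = n, nmem s 1 = d & forall v, (v < num_vars)%N -> nmem s (adr v) = va a v],
      forall e, nmem s (A0 + e) = ar a e,
      forall i j, (i < n)%N -> (j < n)%N -> i <> j -> nmem s (2 + (i * n + j)) = mt i j,
      [/\ rmem s 0 = eps, forall k, (k.+1 < RB)%N -> rmem s k.+1 = tab k &
          forall k, rmem s (RB + k) = rv a k] &
      [/\ latest s = lt a, coins s = co a & samples s = sa a]]%N.

Lemma adr_inj v w : adr v = adr w -> v = w.
Proof. by rewrite /adr => /addnI /eqP; rewrite eqn_pmul2r // => /eqP. Qed.

Lemma adr_lt v : (v < num_vars)%N -> (adr v < A0)%N.
Proof.
move=> h; apply: leq_trans hA0; rewrite /adr ltn_add2l ltn_pmul2r //.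
exact: ltn_addl.
Qed.

(** [v * (n + 1) = v * n + v] is the diagonal entry [(v, v)] if [v < n], and lies past the whole
    matrix otherwise. *)
Lemma adr_mat v i j : (i < n)%N -> (j < n)%N -> i <> j -> adr v <> (2 + (i * n + j))%N.
Proof.
move=> hi hj ij /addnI; rewrite mulnS => e.
have [vn|nv] := ltnP v n.
  have e1 : (v * n + v)%N = (i * n + j)%N by rewrite addnC.
  have := congr1 (modn^~ n) e1; rewrite /= !modnMDl !modn_small // => vj.
  by move: e1; rewrite vj => /eqP; rewrite eqn_add2r eqn_pmul2r // => /eqP; exact/nesym.
have : (v + v * n < n * n)%N.
  by rewrite e; apply: (@leq_trans (i * n + n)%N); [rewrite ltn_add2l|rewrite -mulSnr leq_mul2r hi orbT].
by apply/negP; rewrite -leqNgt; apply: (leq_trans _ (leq_addl _ _)); rewrite leq_mul2r nv orbT.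
Qed.

Lemma mat_lt i j : (i < n)%N -> (j < n)%N -> (2 + (i * n + j) < A0)%N.
Proof.
move=> hi hj; apply: leq_trans hA0; rewrite ltn_add2l.
apply: (@leq_trans (i * n + n)%N); first by rewrite ltn_add2l.
rewrite -mulSnr; apply: (leq_mul (leq_trans hi (leq_addr _ _)) (leqnSn n)).
Qed.

Lemma neval_Vad s v : nmem s 0 = n -> neval s (Vad v) = adr v.
Proof.
move=> h; have e : neval s (times_n v) = (v * n)%N.
  by elim: v => [|v IH] //=; rewrite !evalE IH h mulSn addnC.
by rewrite /Vad !evalE e /adr mulnS addnA.
Qed.

Definition evn a e x := forall s, rep a s -> neval s e = x.
Definition evr a e x := forall s, rep a s -> reval s e = x.
Definition evb a e x := forall s, rep a s -> beval s e = x.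

Lemma ev_va a s v : rep a s -> (v < num_vars)%N -> neval s (Va v) = va a v.
Proof. by move=> [[h0 _ hv] _ _ _ _] hvn; rewrite /Va -lock evalE neval_Vad // hv. Qed.

Lemma ev_n a s : rep a s -> neval s Nn = n.
Proof. by case=> [[h h' _] _ _ _ _]; rewrite /Nn -lock !evalE. Qed.

Lemma ev_d a s : rep a s -> neval s Dn = d.
Proof. by case=> [[h h' _] _ _ _ _]; rewrite /Dn -lock !evalE. Qed.

Lemma ev_ar a s e : rep a s -> va a 0 = A0 -> neval s (Ar e) = ar a (neval s e).
Proof. by move=> H e0; have := ev_va H (isT : (0 < num_vars)%N); case: H => _ hr _ _ _ h; rewrite /Ar -lock !evalE h e0 hr. Qed.

Lemma ev_mat a s e i j : rep a s -> (i < n)%N -> (j < n)%N -> i <> j ->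
  neval s e = (i * n + j)%N -> neval s (Mat e) = mt i j.
Proof. by move=> [_ _ h _ _] hi hj ij e1; rewrite /Mat -lock !evalE e1; apply: h. Qed.

Lemma ev_rr a s e : rep a s -> va a 1 = RB -> reval s (Rr e) = rv a (neval s e).
Proof. by move=> H e0; have := ev_va H (isT : (1 < num_vars)%N); case: H => _ _ _ [_ _ hr] _ h; rewrite /Rr -lock !evalE h e0 hr. Qed.

Lemma ev_tab a s e k : rep a s -> neval s e = k -> (k.+1 < RB)%N -> reval s (Tab e) = tab k.
Proof. by move=> [_ _ _ [_ h _] _] e1 hk; rewrite /Tab -lock !evalE e1 add1n h. Qed.

Lemma ev_eps a s : rep a s -> reval s Eps = eps.
Proof. by case=> _ _ _ [h _ _] _; rewrite /Eps -lock !evalE. Qed.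

Lemma ev_bit a s src e : rep a s -> neval s (NBit src e) = nth false (lt a src) (neval s e).
Proof. by case=> _ _ _ _ [h _ _]; rewrite -h. Qed.

(** Execution is deterministic once coins and samples are given lists, so one outcome and one exact
    time serve all concrete states that represent [a]. Quantifying over the continuation [k] makes
    the rules compose. *)
Definition wp (c : cmd) (t : nat) (Phi : ast -> Prop) (a : ast) : Prop :=
  exists a' t', [/\ (t' <= t)%N, Phi a' & forall s k, rep a s ->
    exists2 s', rep a' s' & iter t' (@step R) (c :: k, s) = (k, s')].

Lemma wp_conseq c t u (Phi Psi : ast -> Prop) a :
  wp c t Phi a -> (t <= u)%N -> (forall a', Phi a' -> Psi a') -> wp c u Psi a.
Proof.
move=> [a' [t' [lt' ph h]]] tu hh; exists a', t'; split=> //; last exact: hh.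
exact: leq_trans tu.
Qed.

Lemma wp_le t c u (Phi : ast -> Prop) a :
  (t <= u)%N -> wp c t Phi a -> wp c u Phi a.
Proof. by move=> tu h; apply: wp_conseq h tu _. Qed.

Lemma wp_skip (Phi : ast -> Prop) a : Phi a -> wp CSkip 1 Phi a.
Proof. by move=> h; exists a, 1%N; split=> // s k hs; exists s. Qed.

Lemma wp_seq c1 c2 t1 t2 (Phi : ast -> Prop) a :
  wp c1 t1 (wp c2 t2 Phi) a -> wp (CSeq c1 c2) (t1 + t2).+1 Phi a.
Proof.
move=> [a1 [u1 [l1 [a2 [u2 [l2 ph h2]]] h1]]]; exists a2, (u1 + u2).+1; split=> //.
  by rewrite ltnS leq_add.
move=> s k hs; have [s1 r1 e1] := h1 s (c2 :: k) hs; have [s2 r2 e2] := h2 s1 k r1.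
by exists s2 => //; rewrite iterSr /= addnC iterD e1 e2.
Qed.

Lemma wp_if b c1 c2 t (Phi : ast -> Prop) a x : evb a b x ->
  (if x then wp c1 t Phi a else wp c2 t Phi a) -> wp (CIf b c1 c2) t.+1 Phi a.
Proof.
move=> hb; have -> : (if x then wp c1 t Phi a else wp c2 t Phi a) = wp (if x then c1 else c2) t Phi a by case: x hb.
move=> [a1 [u1 [l1 ph h1]]]; exists a1, u1.+1; split=> // s k hs.
have [s1 r1 e1] := h1 s k hs; exists s1 => //.
by rewrite iterSr /= hb.
Qed.

Lemma wp_while (I : nat -> ast -> Prop) cnt tb b c (Phi : ast -> Prop) a :
  I 0%N a ->
  (forall i a', (i < cnt)%N -> I i a' -> evb a' b true /\ wp c tb (I i.+1) a') ->
  (forall a', I cnt a' -> evb a' b false /\ Phi a') ->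
  wp (CWhile b c) (cnt * tb.+1).+1 Phi a.
Proof.
move=> h0 hstep hend.
suff gen k i a' : (i + k = cnt)%N -> I i a' -> wp (CWhile b c) (k * tb.+1).+1 Phi a'.
  exact: (gen cnt 0%N).
elim: k i a' => [|k IH] i a' ek hI.
  rewrite addn0 in ek; rewrite ek in hI; have [hb ph] := hend _ hI.
  by exists a', 1%N; split=> // s k hs; exists s => //=; rewrite hb.
have [hb [a1 [u1 [l1 hI1 h1]]]] := hstep i a' (ltac:(lia)) hI.
have [a2 [u2 [l2 ph h2]]] := IH i.+1 a1 (ltac:(lia)) hI1.
exists a2, (u1 + u2).+1; split=> //.
  by rewrite ltnS mulSn; apply: leq_trans (leq_add l1 l2) _; rewrite addSn addnS.
move=> s q hs; have [s1 r1 e1] := h1 s (CWhile b c :: q) hs; have [s2 r2 e2] := h2 s1 q r1.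
by exists s2 => //; rewrite iterSr /= hb // addnC iterD e1 e2.
Qed.

Lemma upd_va a s v x : (v < num_vars)%N -> rep a s ->
  [/\ [/\ upd (nmem s) (adr v) x 0 = n, upd (nmem s) (adr v) x 1 = d &
          forall w, (w < num_vars)%N -> upd (nmem s) (adr v) x (adr w) = put (va a) v x w],
      forall e, upd (nmem s) (adr v) x (A0 + e) = ar a e &
      forall i j, (i < n)%N -> (j < n)%N -> i <> j ->
        upd (nmem s) (adr v) x (2 + (i * n + j)) = mt i j]%N.
Proof.
move=> hv [[h0 h1 hvs] ha hm _ _]; split; first split=> //.
- move=> w hw; rewrite /upd /put; case: eqP => [/adr_inj ->|ne]; first by rewrite (introT (@eqnP v v)).
  by rewrite hvs //; case: eqnP => // e; case: ne; rewrite e.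
- move=> e; rewrite /upd; case: eqP => [E|//]; have := adr_lt hv.
  by rewrite -E ltnNge leq_addr.
- move=> i j hi hj ij; rewrite /upd; case: eqP => [E|_]; last exact: hm.
  by case: (adr_mat hi hj ij (esym E)).
Qed.

Lemma wp_setv v e x (Phi : ast -> Prop) a : (v < num_vars)%N -> evn a e x ->
  Phi (setv a v x) -> wp (SetV v e) 1 Phi a.
Proof.
move=> hv he ph; exists (setv a v x), 1%N; split=> // s k hs.
exists (State (upd (nmem s) (adr v) x) (rmem s) (latest s) (coins s) (samples s)).
  have [? ? ?] := upd_va x hv hs; case: hs => _ _ _ hr [hl hc hsa].
  by split=> //=; case: hr.
by rewrite /= neval_Vad ?he //; case: hs => [[]].
Qed.

Lemma wp_coin v b bs (Phi : ast -> Prop) a : (v < num_vars)%N -> co a = b :: bs ->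
  Phi (wco (setv a v b) bs) -> wp (CoinV v) 1 Phi a.
Proof.
move=> hv hb ph; exists (wco (setv a v b) bs), 1%N; split=> // s k hs.
exists (State (upd (nmem s) (adr v) b) (rmem s) (latest s) bs (samples s)).
  have [? ? ?] := upd_va b hv hs; case: hs => _ _ _ hr [hl hc hsa].
  by split=> //=; case: hr.
have hc : coins s = co a by case: hs => _ _ _ _ [].
by rewrite /= hc hb neval_Vad //; case: hs => [[]].
Qed.

Lemma wp_draw src x xs (Phi : ast -> Prop) a : sa a src = x :: xs ->
  Phi (wsa (wlt a (upd (lt a) src x)) (upd (sa a) src xs)) -> wp (CDraw src) 1 Phi a.
Proof.
move=> hx ph; exists (wsa (wlt a (upd (lt a) src x)) (upd (sa a) src xs)), 1%N; split=> // s k hs.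
exists (State (nmem s) (rmem s) (upd (latest s) src x) (coins s) (upd (samples s) src xs)).
  case: hs => hv ha hm hr [hl hc hsa]; split=> //=; last by rewrite hl hsa.
have hc : samples s = sa a by case: hs => _ _ _ _ [].
by rewrite /= hc hx.
Qed.

Lemma wp_seta e1 e2 i x (Phi : ast -> Prop) a : va a 0 = A0 -> evn a e1 i -> evn a e2 x ->
  Phi (seta a i x) -> wp (SetA e1 e2) 1 Phi a.
Proof.
move=> h0 he1 he2 ph; exists (seta a i x), 1%N; split=> // s k hs.
exists (State (upd (nmem s) (A0 + i) x) (rmem s) (latest s) (coins s) (samples s)).
  case: hs => [[h0' h1 hv] ha hm hr [hl hc hsa]].
  have big q : (q < A0)%N -> upd (nmem s) (A0 + i) x q = nmem s q.
    by move=> qA; rewrite /upd; case: eqP => // E; rewrite E ltnNge leq_addr in qA.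
  have A2 : (2 <= A0)%N by apply: leq_trans hA0; rewrite leq_addr.
  split=> //=.
  - split; rewrite ?big //; first exact: ltnW.
    by move=> v hvn; rewrite big ?hv // adr_lt.
  - move=> e; rewrite /upd /put eqn_add2l; case: eqnP => [->|ne]; first by rewrite eqxx.
    by rewrite ha; case: eqP.
  - by move=> p q hp hq pq; rewrite big ?hm // mat_lt.
by rewrite /= !evalE (ev_va hs) // h0 he1 // he2.
Qed.

Lemma wp_setr e1 e2 i x (Phi : ast -> Prop) a : va a 1 = RB -> evn a e1 i -> evr a e2 x ->
  Phi (setr a i x) -> wp (SetRr e1 e2) 1 Phi a.
Proof.
move=> h0 he1 he2 ph; exists (setr a i x), 1%N; split=> // s k hs.
exists (State (nmem s) (upd (rmem s) (RB + i) x) (latest s) (coins s) (samples s)).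
  case: hs => hv ha hm [r0 rt rr] [hl hc hsa].
  have big q : (q < RB)%N -> upd (rmem s) (RB + i) x q = rmem s q.
    by move=> qA; rewrite /upd; case: eqP => // E; rewrite E ltnNge leq_addr in qA.
  split=> //=; split.
  - by rewrite big.
  - by move=> q hq; rewrite big ?rt.
  - move=> e; rewrite /upd /put eqn_add2l; case: eqnP => [->|ne]; first by rewrite eqxx.
    by rewrite rr; case: eqP.
by rewrite /= !evalE (ev_va hs) // h0 he1 // he2.
Qed.

Lemma wp_for (I : nat -> ast -> Prop) v e c cnt tb (Phi : ast -> Prop) a :
  (v < num_vars)%N ->
  I 0%N (setv a v 0%N) ->
  (forall i a', (i <= cnt)%N -> va a' v = i -> I i a' -> evn a' e cnt) ->
  (forall i a', (i < cnt)%N -> va a' v = i -> I i a' ->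
     wp c tb (fun b => va b v = i /\ I i.+1 (setv b v i.+1)) a') ->
  (forall a', va a' v = cnt -> I cnt a' -> Phi a') ->
  wp (For v e c) (cnt * tb.+3 + 3) Phi a.
Proof.
move=> hv h0 he hc hend.
have evc i a' : (i <= cnt)%N -> va a' v = i -> I i a' -> evb a' (LtN (Va v) e) (i < cnt)%N.
  move=> ic ei hI s hs; rewrite /LtN !evalE (ev_va hs) // ei.
  by rewrite (he _ _ ic ei hI s hs) addn1.
apply: (@wp_conseq _ (1 + (cnt * (tb + 1).+2).+1).+1 _ Phi) => //; last by lia.
apply: wp_seq; apply: (wp_setv (x := 0%N)) => //.
apply: (wp_while (I := fun i a' => [/\ (i <= cnt)%N, va a' v = i & I i a'])).
- by split=> //; rewrite /setv /put /= (introT (@eqnP v v)).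
- move=> i a' ic [_ ei hI]; split.
    by move=> s hs; rewrite (evc i a' (ltnW ic) ei hI s hs) ic.
  apply: wp_seq; apply: wp_conseq (hc i a' ic ei hI) (leqnn _) _ => b [eb hb].
  apply: (wp_setv (x := i.+1)) => //.
    by move=> s hs; rewrite !evalE (ev_va hs) // eb addn1.
  by split=> //; rewrite /setv /put /= (introT (@eqnP v v)).
- move=> a' [_ ei hI]; split; last exact: hend.
  by move=> s hs; rewrite (evc cnt a' (leqnn _) ei hI s hs) ltnn.
Qed.

End Logic.

Arguments put [V] f k x k' /.

(** * The tester as a program *)

Notation vdd := 2%N (only parsing).
Notation vE := 3%N (only parsing).
Notation vh := 4%N (only parsing).
Notation vm1 := 5%N (only parsing).
Notation vm := 6%N (only parsing).
Notation vt := 7%N (only parsing).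
Notation vK := 8%N (only parsing).
Notation vD := 9%N (only parsing).
Notation vkc := 10%N (only parsing).
Notation vst := 11%N (only parsing).
Notation vptr := 12%N (only parsing).
Notation vacc := 13%N (only parsing).
Notation vpw := 14%N (only parsing).
Notation vk := 15%N (only parsing).
Notation vi := 16%N (only parsing).
Notation vc := 17%N (only parsing).
Notation vcnt := 28%N (only parsing).
Notation vnum := 29%N (only parsing).
Notation vF := 18%N (only parsing).
Notation vX := 19%N (only parsing).
Notation vY := 20%N (only parsing).
Notation vX' := 21%N (only parsing).
Notation vY' := 22%N (only parsing).
Notation vbp := 23%N (only parsing).
Notation vbad := 24%N (only parsing).
Notation vb := 25%N (only parsing).
Notation vcarry := 26%N (only parsing).
Notation vans := 27%N (only parsing).

(** Cells 0 to [dd] of the array hold the current tuple and [vptr] is the start of the current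
    sample. Powers of 2 arise by doubling, as naturals cannot be multiplied. *)
Definition Code : cmd :=
  CSeq (SetV vacc (NNum 0)) (CSeq (SetV vpw (NNum 1))
  (For vk (NAdd (Va vdd) (NNum 1))
    (CSeq (CIf (BLeN (NNum 1) (Ar (NAdd (Va vptr) (Ar (Va vk)))))
               (SetV vacc (NAdd (Va vacc) (Va vpw))) CSkip)
          (SetV vpw (NAdd (Va vpw) (Va vpw)))))).

Definition Count : cmd :=
  CSeq (SetV vcnt (NNum 0))
  (For vi (Va vnum)
    (CSeq Code
    (CSeq (CIf (EqN (Va vacc) (Va vc)) (SetV vcnt (NAdd (Va vcnt) (NNum 1))) CSkip)
          (SetV vptr (NAdd (Va vptr) Nn))))).

Definition CountTo (num out : nat) (k : cmd) : cmd :=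
  CSeq (SetV vnum (Va num)) (CSeq Count (CSeq (SetV out (Va vcnt)) k)).

Definition Zv : rexp := Rr (NNum 0).

Definition RDiffV (v w : nat) : rexp := RAdd (RNat (Va v)) (ROpp (RNat (Va w))).

(** The counts are recomputed for every bin instead of being tabulated. For each bin [vptr] is
    rewound to the start [vbp] of the block, and it ends at the start of the next block. *)
Definition ZStat : cmd :=
  CSeq (SetRr (NNum 0) (RNat (NNum 0)))
  (For vc (Va vK)
    (CSeq (SetV vptr (Va vbp))
    (CountTo vm1 vF (CountTo vm vX (CountTo vm vY (CountTo vm vX' (CountTo vm vY'
    (SetRr (NNum 0)
      (RAdd Zv (RMul (RMul (RDiffV vX vY) (RDiffV vX' vY'))
                     (RInv (RNat (NAdd (Va vF) (NNum 1)))))))))))))).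

(** Half of the mean [m ^ 2 / ((K + m1) * D ^ 2)] that a far marginal guarantees. *)
Definition Threshold : rexp :=
  RMul (RMul (RNat (Va vm)) (RNat (Va vm)))
    (RInv (RMul (RNat (NAdd (NAdd (Va vK) (Va vm1)) (NAdd (Va vK) (Va vm1))))
                (RMul (RNat (Va vD)) (RNat (Va vD))))).

Definition TestTuple : cmd :=
  CSeq (SetV vbad (NNum 1)) (CSeq (SetV vbp (NAdd (Va vdd) (NNum 1)))
  (For vb (Va vt)
    (CSeq ZStat
    (CSeq (CIf (BLeR Zv Threshold) (SetV vbad (NNum 0)) CSkip)
          (SetV vbp (Va vptr)))))).

(** Incrementation of a counter in base [n]; a carry out of the last digit ends the enumeration in
    [Tester]. *)
Definition NextTuple : cmd :=
  CSeq (SetV vcarry (NNum 1))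
  (For vk (NAdd (Va vdd) (NNum 1))
    (CSeq (SetA (Va vk) (NAdd (Ar (Va vk)) (Va vcarry)))
          (CIf (BLeN Nn (Ar (Va vk)))
               (CSeq (SetA (Va vk) (NNum 0)) (SetV vcarry (NNum 1)))
               (SetV vcarry (NNum 0))))).

Definition Tester : cmd :=
  CSeq (SetV vans (NNum 1)) (CSeq (SetV vcarry (NNum 0))
  (CWhile (EqN (Va vcarry) (NNum 0))
    (CSeq TestTuple
    (CSeq (CIf (EqN (Va vbad) (NNum 1)) (SetV vans (NNum 0)) CSkip)
          NextTuple)))).

Definition frame (ms : seq nat) (f g : nat -> nat) : Prop :=
  forall v, v \notin ms -> g v = f v.

Lemma put_same (V : Type) (f : nat -> V) k x : put f k x k = x.
Proof. by rewrite /put (introT (@eqnP k k)). Qed.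

Lemma put_other (V : Type) (f : nat -> V) k x j : j != k -> put f k x j = f j.
Proof. by move=> h; rewrite /put; case: eqnP => // e; rewrite e eqxx in h. Qed.

Lemma frame_refl ms f : frame ms f f.
Proof. by []. Qed.

Lemma frame_put ms f g v x : frame ms f g -> v \in ms -> frame ms f (put g v x).
Proof.
move=> h vms w wms; rewrite put_other ?h //.
by apply/eqP => e; rewrite e vms in wms.
Qed.

Lemma frame_trans ms ms' f g h : {subset ms' <= ms} -> frame ms f g -> frame ms' g h ->
  frame ms f h.
Proof. by move=> sub fg gh v vms; rewrite gh ?fg //; apply: contra vms => /sub. Qed.

Lemma frame_sub ms ms' f g : {subset ms' <= ms} -> frame ms' f g -> frame ms f g.
Proof. by move=> sub h; apply: frame_trans (sub) (@frame_refl _ _) h. Qed.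

Ltac frm := rewrite /=;
  repeat (match goal with H : frame _ _ ?f |- context [?f ?v] => rewrite (H v isT) end;
          rewrite /=).
Ltac frd := by frm.
Ltac evs s hs := repeat first
  [ rewrite (evalE s) | rewrite (ev_va hs); [|by []] | rewrite (ev_n hs) | rewrite (ev_d hs)
  | rewrite (ev_eps hs) | rewrite (ev_ar _ hs); [|frd] | rewrite (ev_rr _ hs); [|frd]
  | rewrite (ev_bit _ _ hs) ].
Ltac ev := let s := fresh "s" in let hs := fresh "hs" in move=> s hs; evs s hs; try done.
Ltac putv y := apply: (wp_setv _ _ (x := y)); [assumption|assumption|by []|by ev|].

Definition stored (n : nat) (mem : nat -> nat) (p : nat) (l : seq (seq bool)) : Prop :=
  forall k j, (k < size l)%N -> (j < n)%N -> mem (p + (k * n + j))%N = nth false (nth [::] l k) j.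

Lemma stored_take n mem p l k : stored n mem p l -> stored n mem p (take k l).
Proof.
move=> h i j; rewrite size_take => ik jn.
have ik' : (i < k)%N by move: ik; case: (ltnP k (size l)); lia.
by rewrite nth_take // h //; move: ik; case: (ltnP k (size l)); lia.
Qed.

Lemma stored_drop n mem p l k : (k <= size l)%N ->
  stored n mem p l -> stored n mem (p + k * n)%N (drop k l).
Proof.
move=> kl h i j; rewrite size_drop => ik jn; rewrite nth_drop -h //; last by lia.
by congr mem; rewrite mulnDl; lia.
Qed.

Section TesterSpec.
Variable R : realFieldType.
Variables (n d A0 RB : nat) (mt : nat -> nat -> bool) (eps : R) (tab : nat -> R).
Hypotheses (n0 : (0 < n)%N) (hA0 : (2 + (n + num_vars) * n.+1 <= A0)%N) (hRB : (0 < RB)%N).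
Local Notation wp := (wp n d A0 RB mt eps tab).
Implicit Types (a : ast R).

Lemma codeS J m x : code J m.+1 x = (code J m x + nth false x (J m) * 2 ^ m)%N.
Proof. by rewrite /code big_ord_recr. Qed.

Lemma wp_code J dd x a (Phi : ast R -> Prop) :
  va a 0 = A0 -> va a vdd = dd ->
  (forall k, (k <= dd)%N -> ar a k = J k) ->
  (forall k, (k <= dd)%N -> ar a (va a vptr + J k)%N = nth false x (J k)) ->
  (forall f, frame [:: vacc; vpw; vk] (va a) f -> f vacc = code J dd.+1 x -> Phi (wva a f)) ->
  wp Code (dd.+1 * 7 + 7) Phi a.
Proof.
move=> h0 hdd hJ hx ph.
apply: (wp_le (t := (1 + (1 + (dd.+1 * 7 + 3)).+1).+1)); first by lia.
apply: wp_seq; putv 0%N.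
apply: wp_seq; putv 1%N.
apply: (wp_for n0 hA0 hRB (cnt := dd.+1) (tb := 4) (I := fun i b => exists f,
  [/\ b = wva a f, frame [:: vacc; vpw; vk] (va a) f, f vacc = code J i x & f vpw = 2 ^ i]%N)) => //.
- eexists; split; first by [].
  + by do 3 (apply: frame_put => //).
  + by rewrite /code big_ord0.
  + by [].
- by move=> i b _ _ [f [-> hf _ _]]; ev; frm; rewrite hdd addn1.
- move=> i b idd ei [f [eb hf e1 e2]]; subst b.
  apply: (wp_le (t := (1.+1 + 1).+1)) => //.
  apply: wp_seq.
  have hb : evb n d A0 RB mt eps tab (wva a f) (BLeN (NNum 1) (Ar (NAdd (Va vptr) (Ar (Va vk)))))
     (nth false x (J i)).
    rewrite /= in ei; ev; frm; rewrite ei (hJ i) // hx //.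
    by case: (nth _ _ _).
  apply: (wp_if hb); rewrite /= in ei.
  have e3 := codeS J i x; move: e3; case: (nth false x (J i)) => /= e3.
    putv (f vacc + f vpw)%N.
    putv (f vpw + f vpw)%N.
    split=> //; eexists; split; first by [].
    + by do 3 (apply: frame_put => //).
    + by rewrite /= e3 e1 e2 mul1n.
    + by rewrite /= e2 expnS mul2n addnn.
  apply: wp_skip.
  putv (f vpw + f vpw)%N.
  split=> //; eexists; split; first by [].
  + by do 2 (apply: frame_put => //).
  + by rewrite /= e3 e1 addn0.
  + by rewrite /= e2 expnS mul2n addnn.
- by move=> b _ [f [-> hf e1 _]]; apply: ph.
Qed.

Definition time_code (dd : nat) : nat := (dd.+1 * 7 + 7)%N.

Lemma wp_count J dd c l a (Phi : ast R -> Prop) :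
  va a 0 = A0 -> va a vdd = dd -> va a vc = c -> va a vnum = size l ->
  (forall k, (k <= dd)%N -> ar a k = J k /\ (J k < n)%N) ->
  stored n (ar a) (va a vptr) l ->
  (forall f, frame [:: vcnt; vptr; vacc; vpw; vk; vi] (va a) f ->
     f vcnt = cnt (code J dd.+1) c l -> f vptr = (va a vptr + size l * n)%N ->
     Phi (wva a f)) ->
  wp Count (size l * (time_code dd + 8) + 5) Phi a.
Proof.
move=> h0 hdd hc hnum hJ hst ph.
apply: (wp_le (t := (1 + (size l * (time_code dd + 5).+3 + 3)).+1)); first by lia.
apply: wp_seq; putv 0%N.
apply: (wp_for n0 hA0 hRB (cnt := size l) (tb := (time_code dd + 5)) (I := fun i b => exists f,
  [/\ b = wva a f, frame [:: vcnt; vptr; vacc; vpw; vk; vi] (va a) f,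
     f vcnt = cnt (code J dd.+1) c (take i l) & f vptr = va a vptr + i * n]%N)) => //.
- eexists; split; first by [].
  + by do 2 (apply: frame_put => //).
  + by rewrite take0.
  + by rewrite /= mul0n addn0.
- by move=> i b _ _ [f [-> hf _ _]]; ev; frm; rewrite hnum.
- move=> i b il ei [f [eb hf e1 e2]]; subst b; rewrite /= in ei.
  apply: (wp_le (t := (time_code dd + (2 + 1).+1).+1)); first by lia.
  apply: wp_seq; apply: (wp_code (J := J) (dd := dd) (x := nth [::] l i)); rewrite /=; try by frm.
  + by move=> k /hJ[].
  + by move=> k /hJ[_ kn]; rewrite e2 -addnA hst.
  move=> g hg eacc; rewrite /= in eacc hg.
  apply: wp_seq.
  have hb : evb n d A0 RB mt eps tab (wva (wva a f) g) (EqN (Va vacc) (Va vc))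
     (code J dd.+1 (nth [::] l i) == c).
    by rewrite /EqN; ev; frm; rewrite eacc hc eqn_leq.
  apply: (wp_if hb).
  have ecnt : cnt (code J dd.+1) c (take i.+1 l) =
    (cnt (code J dd.+1) c (take i l) + (code J dd.+1 (nth [::] l i) == c))%N.
    by rewrite (take_nth [::]) // /cnt -cats1 count_cat /= addn0.
  have fin g' : frame [:: vcnt; vacc; vpw; vk] f g' ->
     g' vcnt = cnt (code J dd.+1) c (take i.+1 l) ->
     wp (SetV vptr (NAdd (Va vptr) Nn)) 1 (fun b => va b vi = i /\
       exists f0, [/\ setv b vi i.+1 = wva a f0,
         frame [:: vcnt; vptr; vacc; vpw; vk; vi] (va a) f0,
         f0 vcnt = cnt (code J dd.+1) c (take i.+1 l)
         & f0 vptr = (va a vptr + i.+1 * n)%N]) (wva a g').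
    move=> hg' eu; putv (g' vptr + n)%N.
    split; first by frm.
    eexists; split; first by [].
    - do 2 (apply: frame_put => //).
      by apply: (frame_trans _ hf hg'); apply/allP.
    - by rewrite /= eu.
    - by frm; rewrite e2 mulSn; lia.
  move: ecnt fin; case: (_ == c) => /= ecnt fin.
    putv (g vcnt + 1)%N.
    apply: fin; last by frm; rewrite ecnt e1.
    by apply: frame_put => //; apply: (frame_sub _ hg); apply/allP.
  apply: wp_skip; apply: fin; last by frm; rewrite ecnt e1 addn0.
  by apply: (frame_sub _ hg); apply/allP.
- move=> b _ [f [-> hf e1 e2]]; apply: ph => //.
  by rewrite e1 take_size.
Qed.

Lemma wp_countTo J dd c l num out k tk a (Phi : ast R -> Prop) :
  (num < num_vars)%N -> (out < num_vars)%N -> out != vptr ->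
  va a 0 = A0 -> va a vdd = dd -> va a vc = c -> va a num = size l ->
  (forall k, (k <= dd)%N -> ar a k = J k /\ (J k < n)%N) ->
  stored n (ar a) (va a vptr) l ->
  (forall f, frame [:: vnum; out; vcnt; vptr; vacc; vpw; vk; vi] (va a) f ->
     f out = cnt (code J dd.+1) c l -> f vptr = (va a vptr + size l * n)%N ->
     wp k tk Phi (wva a f)) ->
  wp (CountTo num out k) (size l * (time_code dd + 8) + 10 + tk) Phi a.
Proof.
move=> hn ho op h0 hdd hc hnum hJ hst ph.
apply: (wp_le (t := (1 + ((size l * (time_code dd + 8) + 5) + (1 + tk).+1).+1).+1)); first by lia.
apply: wp_seq; apply: (wp_setv n0 hA0 (x := size l)) => //; first by ev; rewrite hnum.
apply: wp_seq; apply: (@wp_count J dd c l) => //= f hf e1 e2; rewrite /= in e2.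
apply: wp_seq; apply: (wp_setv n0 hA0 (x := f vcnt)) => //; first by ev.
apply: ph.
- apply: frame_put; last by rewrite !inE eqxx orbT.
  apply: (@frame_trans _ [:: vcnt; vptr; vacc; vpw; vk; vi] _ (put (va a) vnum (size l))) => //.
    by move=> v; rewrite !inE => /or3P[||/or4P[]] /eqP ->; rewrite ?eqxx ?orbT.
  by apply: frame_put.
- by rewrite put_same.
- by rewrite put_other // eq_sym.
Qed.

Record par (dd m1 m t K D : nat) (f : nat -> nat) : Prop := Par {
  par_A0 : f 0%N = A0; par_RB : f 1%N = RB; par_dd : f vdd = dd; par_m1 : f vm1 = m1;
  par_m : f vm = m; par_t : f vt = t; par_K : f vK = K; par_D : f vD = D }.

Lemma par_frame dd m1 m t K D f g ms : all (leq 12) ms -> frame ms f g ->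
  par dd m1 m t K D f -> par dd m1 m t K D g.
Proof.
move=> /allP hms h [h0 h1 h2 h3 h4 h5 h6 h7].
by split; rewrite h //; apply/negP => /hms.
Qed.

Definition time_zstat dd m1 m K : nat :=
  (K * ((m1 + m * 4) * (time_code dd + 8) + 60) + 10)%N.

Definition zstat_vars : seq nat :=
  [:: vc; vnum; vF; vX; vY; vX'; vY'; vcnt; vptr; vacc; vpw; vk; vi].

Lemma wp_zstat J dd m1 m t K D l a (Phi : ast R -> Prop) :
  par dd m1 m t K D (va a) -> (0 < K)%N ->
  (forall k, (k <= dd)%N -> ar a k = J k /\ (J k < n)%N) ->
  (block_size m1 m <= size l)%N -> stored n (ar a) (va a vbp) l ->
  (forall f g, frame zstat_vars (va a) f ->
     f vptr = (va a vbp + block_size m1 m * n)%N ->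
     g 0%N = block_stat R m1 m (code J dd.+1) K l -> Phi (wrv (wva a f) g)) ->
  wp ZStat (time_zstat dd m1 m K) Phi a.
Proof.
move=> [h0 h1 hdd hm1 hm ht hK hD] K0 hJ sl hst ph; rewrite /block_size in sl.
set tb := ((m1 + m * 4) * (time_code dd + 8) + 55)%N.
apply: (wp_le (t := (1 + (K * tb.+3 + 3)).+1)).
  by rewrite /time_zstat /tb; lia.
apply: wp_seq; apply: (wp_setr hRB (i := 0%N) (x := 0)); [by []|by ev|by ev|].
pose sF := take m1 l; pose sX := take m (drop m1 l); pose sY := take m (drop (m1 + m) l).
pose sX' := take m (drop (m1 + m + m) l); pose sY' := take m (drop (m1 + m + m + m) l).
have zF : size sF = m1 by rewrite size_takel //; lia.
have zX : size sX = m by rewrite size_takel // size_drop; lia.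
have zY : size sY = m by rewrite size_takel // size_drop; lia.
have zX' : size sX' = m by rewrite size_takel // size_drop; lia.
have zY' : size sY' = m by rewrite size_takel // size_drop; lia.
pose p := va a vbp.
have tF : stored n (ar a) p sF by apply: stored_take.
have tX : stored n (ar a) (p + m1 * n) sX by apply: stored_take; apply: stored_drop => //; lia.
have tY : stored n (ar a) (p + (m1 + m) * n) sY by apply: stored_take; apply: stored_drop => //; lia.
have tX' : stored n (ar a) (p + (m1 + m + m) * n) sX' by apply: stored_take; apply: stored_drop => //; lia.
have tY' : stored n (ar a) (p + (m1 + m + m + m) * n) sY' by apply: stored_take; apply: stored_drop => //; lia.
(* Nothing is known of [vptr] before the first bin, hence the guard [0 < i] on its value; [0 < K]
   discharges it after the loop. *)
apply: (wp_for n0 hA0 hRB (cnt := K) (tb := tb) (I := fun i b => exists f g,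
  [/\ b = wrv (wva a f) g, frame zstat_vars (va a) f,
     g 0%N = stat R (code J dd.+1) i sF sX sY sX' sY' &
     (0 < i)%N -> f vptr = p + (m1 + m + m + m + m) * n]%N)) => //.
- eexists; exists (put (rv a) 0%N 0); split=> //; first by apply: frame_put.
  by rewrite /= /stat big_ord0.
- by move=> i b _ _ [f [g [-> hf _ _]]]; ev; frm; rewrite hK.
- move=> i b iK ei [f [g [eb hf e1 _]]]; subst b; rewrite /= in ei.
  apply: (wp_le (t := (1 + ((size sF * (time_code dd + 8) + 10 + (size sX * (time_code dd + 8) + 10
    + (size sY * (time_code dd + 8) + 10 + (size sX' * (time_code dd + 8) + 10
    + (size sY' * (time_code dd + 8) + 10 + 1))))))).+1)).
    by rewrite zF zX zY zX' zY' /tb; lia.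
  apply: wp_seq; putv (f vbp).
  have ep : f vbp = p by frm.
  rewrite ep.
  apply: (@wp_countTo J dd i sF) => //=; try (by frm); first by frm; rewrite hm1 zF.
  move=> f1 hf1 c1 p1; rewrite /= in p1 hf1 c1.
  apply: (@wp_countTo J dd i sX) => //=; try (by frm).
  - by frm; rewrite hm zX.
  - by rewrite p1 zF.
  move=> f2 hf2 c2 p2; rewrite /= in p2 hf2 c2.
  apply: (@wp_countTo J dd i sY) => //=; try (by frm).
  - by frm; rewrite hm zY.
  - by rewrite p2 p1 zF zX -addnA -mulnDl.
  move=> f3 hf3 c3 p3; rewrite /= in p3 hf3 c3.
  apply: (@wp_countTo J dd i sX') => //=; try (by frm).
  - by frm; rewrite hm zX'.
  - by rewrite p3 p2 p1 zF zX zY -!addnA -!mulnDl !addnA.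
  move=> f4 hf4 c4 p4; rewrite /= in p4 hf4 c4.
  apply: (@wp_countTo J dd i sY') => //=; try (by frm).
  - by frm; rewrite hm zY'.
  - by rewrite p4 p3 p2 p1 zF zX zY zX' -!addnA -!mulnDl !addnA.
  move=> f5 hf5 c5 p5; rewrite /= in p5 hf5 c5.
  apply: (wp_setr hRB (i := 0%N) (x := stat R (code J dd.+1) i.+1 sF sX sY sX' sY')).
  - by frm.
  - by ev.
  - move=> s hs; rewrite /RDiffV /Zv; evs s hs; frm.
    rewrite e1 c5; have -> : f4 21 = cnt (code J dd.+1) i sX' by rewrite c4.
    rewrite c3 c2 c1 /stat big_ord_recr /= /cdiff addn1; congr (_ + _).
  split; first by frm.
  eexists; eexists; split; first by [].
  - apply: frame_put => //.
    apply: (frame_trans _ _ hf5); first by apply/allP.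
    apply: (frame_trans _ _ hf4); first by apply/allP.
    apply: (frame_trans _ _ hf3); first by apply/allP.
    apply: (frame_trans _ _ hf2); first by apply/allP.
    apply: (frame_trans _ _ hf1); first by apply/allP.
    by apply: frame_put.
  - by [].
  - by move=> _; rewrite /= p5 p4 p3 p2 p1 zF zX zY zX' zY' -!addnA -!mulnDl !addnA.
- move=> b _ [f [g [-> hf e1 e2]]]; apply: ph => //.
  by rewrite e2.
Qed.

Definition threshold (m1 m K D : nat) : R :=
  m%:R * m%:R / ((K + m1 + (K + m1))%:R * (D%:R * D%:R)).

Definition time_test dd m1 m t K : nat := (t * (time_zstat dd m1 m K + 10) + 10)%N.

Lemma all_exceedS m1 m phi K tau b (l : seq (seq bool)) :
  all_exceed m1 m phi K tau b.+1 l =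
  all_exceed m1 m phi K tau b l &&
  (tau < block_stat R m1 m phi K (drop (b * block_size m1 m) l)).
Proof. by rewrite /all_exceed -addn1 iotaD all_cat /= andbT. Qed.

Lemma wp_test J dd m1 m t K D l a (Phi : ast R -> Prop) :
  par dd m1 m t K D (va a) -> (0 < K)%N ->
  (forall k, (k <= dd)%N -> ar a k = J k /\ (J k < n)%N) ->
  size l = (t * block_size m1 m)%N -> stored n (ar a) dd.+1 l ->
  (forall f g, frame ([:: vb; vbp; vbad] ++ zstat_vars) (va a) f ->
     f vbad = all_exceed m1 m (code J dd.+1) K (threshold m1 m K D) t l ->
     Phi (wrv (wva a f) g)) ->
  wp TestTuple (time_test dd m1 m t K) Phi a.
Proof.
move=> hp K0 hJ sl hst ph; have [h0 h1 hdd hm1 hm ht hK hD] := hp.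
set tz := time_zstat dd m1 m K; set L := block_size m1 m in sl *.
set tau := threshold m1 m K D.
apply: (wp_le (t := (1 + (1 + (t * (tz + 5).+3 + 3)).+1).+1)).
  by rewrite /time_test -/tz; lia.
apply: wp_seq; putv 1%N.
apply: wp_seq; apply: (wp_setv n0 hA0 (x := dd.+1)); [by []|by ev; frm; rewrite hdd addn1|].
apply: (wp_for n0 hA0 hRB (cnt := t) (tb := (tz + 5)%N) (I := fun b a' => exists f g,
  [/\ a' = wrv (wva a f) g, frame ([:: vb; vbp; vbad] ++ zstat_vars) (va a) f,
     f vbad = all_exceed m1 m (code J dd.+1) K tau b l &
     f vbp = dd.+1 + b * L * n]%N)) => //.
- exists (put (put (put (va a) vbad 1%N) vbp dd.+1) vb 0%N), (rv a); split; first by [].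
  + by do 3 (apply: frame_put => //).
  + by [].
  + by rewrite /= mul0n addn0.
- by move=> i b _ _ [f [g [-> hf _ _]]]; ev; frm; rewrite ht.
- move=> i b it ei [f [g [eb hf e1 e2]]]; subst b; rewrite /= in ei.
  apply: (wp_le (t := (tz + (2 + 1).+1).+1)); first by lia.
  have iL : (i * L + L <= size l)%N by rewrite sl -mulSnr leq_mul2r it orbT.
  apply: wp_seq; apply: (@wp_zstat J dd m1 m t K D (drop (i * L) l)) => //.
  + by apply: (par_frame _ hf hp).
  + by rewrite size_drop -/L; lia.
  + by rewrite /= e2; apply: stored_drop => //; lia.
  move=> f1 g1 hf1 p1 z1; rewrite /= -/L in hf1 p1.
  have hp1 : par dd m1 m t K D f1 by apply: (par_frame _ hf1) => //; apply: (par_frame _ hf hp).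
  have [k0 k1 kdd km1 km kt kK kD] := hp1.
  have hf01 : frame ([:: vb; vbp; vbad] ++ zstat_vars) (va a) f1.
    by apply: (frame_trans _ hf hf1); apply/allP.
  apply: wp_seq.
  have hb : evb n d A0 RB mt eps tab (wrv (wva a f1) g1) (BLeR Zv Threshold)
      (g1 0%N <= tau).
    move=> s hs; rewrite /Zv /Threshold; evs s hs; rewrite /= km kK km1 kD.
    by [].
  apply: (wp_if hb).
  have fin f2 : frame [:: vbad] f1 f2 ->
     f2 vbad = all_exceed m1 m (code J dd.+1) K tau i.+1 l ->
     wp (SetV vbp (Va vptr)) 1 (fun b => va b vb = i /\
       exists f0 g0, [/\ setv b vb i.+1 = wrv (wva a f0) g0,
         frame ([:: vb; vbp; vbad] ++ zstat_vars) (va a) f0,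
         f0 vbad = all_exceed m1 m (code J dd.+1) K tau i.+1 l
         & f0 vbp = (dd.+1 + i.+1 * L * n)%N]) (wrv (wva a f2) g1).
    move=> hf2 e; putv (f2 vptr); split; first by frm.
    eexists; exists g1; split; first by [].
    - do 2 (apply: frame_put => //).
      by apply: (frame_trans _ hf01 hf2); apply/allP.
    - by [].
    - by frm; rewrite p1 e2 mulSn mulnDl; lia.
  have := all_exceedS m1 m (code J dd.+1) K tau i l; rewrite -/L -z1.
  case: (leP (g1 0%N) tau) => htau; rewrite ?andbF ?andbT => ea.
    putv 0%N; apply: fin; first by apply: frame_put.
    by rewrite ea.
  by apply: wp_skip; apply: fin => //; frm; rewrite e1 ea.
- by move=> b _ [f [g [-> hf e1 _]]]; apply: ph.
Qed.

Definition time_next dd : nat := (dd.+1 * 10 + 6)%N.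

(** Here [b] is the carry that enters digit [k] when 1 is added to [c]; the last two clauses give
    the new digit together with the carry into the next position. *)
Lemma digit_next c k : let b := (c.+1 %/ n ^ k - c %/ n ^ k)%N in
  [/\ (b <= 1)%N, (c.+1 %/ n ^ k = c %/ n ^ k + b)%N,
    (n <= digit n c k + b)%N ->
      digit n c.+1 k = 0%N /\ (c.+1 %/ n ^ k.+1 - c %/ n ^ k.+1 = 1)%N &
    (digit n c k + b < n)%N ->
      digit n c.+1 k = (digit n c k + b)%N /\ (c.+1 %/ n ^ k.+1 - c %/ n ^ k.+1 = 0)%N].
Proof.
have p0 : (0 < n ^ k)%N by rewrite expn_gt0 n0.
set q := (c %/ n ^ k)%N; set q' := (c.+1 %/ n ^ k)%N; move=> b.
have hle : (q <= q')%N by apply: leq_div2r.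
have hb : (q' <= q.+1)%N.
  apply: (@leq_trans ((c + n ^ k) %/ n ^ k)); first by apply: leq_div2r; lia.
  by rewrite divnDr ?dvdnn // divnn p0 addn1.
have eq' : q' = (q + b)%N by rewrite /b; lia.
have b1 : (b <= 1)%N by rewrite /b; lia.
rewrite /digit -/q -/q' expnSr !divnMA -/q -/q' eq'; split=> //.
  move=> hn; have qm : (q %% n < n)%N by rewrite ltn_mod.
  have e : (q %% n + b = n)%N by lia.
  have -> : (q + b = (q %/ n).+1 * n)%N by rewrite {1}(divn_eq q n) mulSn; lia.
  by rewrite modnMl mulnK // subSnn.
move=> hn; have -> : (q + b = q %/ n * n + (q %% n + b))%N by rewrite {1}(divn_eq q n); lia.
by rewrite modnMDl modn_small // divnMDl // (divn_small hn) addn0 subnn.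
Qed.

Lemma wp_next dd c a (Phi : ast R -> Prop) :
  va a 0 = A0 -> va a vdd = dd -> (forall k, (k <= dd)%N -> ar a k = digit n c k) ->
  (forall f g, frame [:: vcarry; vk] (va a) f ->
     f vcarry = (c.+1 %/ n ^ dd.+1 - c %/ n ^ dd.+1)%N ->
     (forall k, (k <= dd)%N -> g k = digit n c.+1 k) ->
     (forall k, (dd < k)%N -> g k = ar a k) -> Phi (war (wva a f) g)) ->
  wp NextTuple (time_next dd) Phi a.
Proof.
move=> h0 hdd hJ ph.
apply: (wp_le (t := (1 + (dd.+1 * 7.+3 + 3)).+1)).
  by rewrite /time_next; lia.
apply: wp_seq; putv 1%N.
apply: (wp_for n0 hA0 hRB (cnt := dd.+1) (tb := 7) (I := fun i a' => exists f g,
  [/\ a' = war (wva a f) g, frame [:: vcarry; vk] (va a) f,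
     f vcarry = c.+1 %/ n ^ i - c %/ n ^ i,
     (forall k, k < i -> g k = digit n c.+1 k) &
     (forall k, i <= k -> g k = ar a k)]%N)) => //.
- exists (put (put (va a) vcarry 1%N) vk 0%N), (ar a); split=> //; first by do 2 (apply: frame_put => //).
  by rewrite /= expn0 !divn1 subSn // subnn.
- by move=> i b _ _ [f [g [-> hf _ _ _]]]; ev; frm; rewrite hdd addn1.
- move=> i b idd ei [f [g [eb hf e1 e2 e3]]]; subst b; rewrite /= in ei.
  have [b1 _ hcarry hno] := digit_next c i; rewrite -e1 in b1 hcarry hno.
  set x := (digit n c i + f vcarry)%N in hcarry hno.
  apply: (wp_le (t := (1 + (1 + 1).+1.+1).+1)) => //.
  apply: wp_seq; apply: (wp_seta hA0 (i := i) (x := x)).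
  + by frm.
  + by ev.
  + by ev; rewrite /= ei e3 // hJ.
  have hb : evb n d A0 RB mt eps tab (seta (war (wva a f) g) i x) (BLeN Nn (Ar (Va vk))) (n <= x)%N.
    by ev; rewrite /= ei (introT (@eqnP i i)).
  apply: (wp_if hb).
  have low u y : (forall k, (k < i)%N -> u k = g k) -> u i = y -> y = digit n c.+1 i ->
      forall k, (k < i.+1)%N -> u k = digit n c.+1 k.
    move=> hu ui hy k; rewrite ltnS leq_eqVlt => /orP[/eqP ->|ki]; first by rewrite ui.
    by rewrite hu // e2.
  case: (leqP n x) => hx.
    have [c1 c2] := hcarry hx.
    apply: wp_seq; apply: (wp_seta hA0 (i := i) (x := 0%N)); [by frm|by ev|by ev|].
    putv 1%N; split; first by [].
    exists (put (put f vcarry 1%N) vk i.+1), (put (put g i x) i 0%N); split; first by [].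
    + by do 2 (apply: frame_put => //).
    + by rewrite /= c2.
    + apply: (low _ 0%N); last by rewrite c1.
      * by move=> k ki; rewrite !put_other //; lia.
      * by rewrite put_same.
    + by move=> k ki; rewrite !put_other ?e3 //; lia.
  have [c1 c2] := hno hx.
  apply: (wp_le (t := 1)) => //.
  putv 0%N; split; first by [].
  exists (put (put f vcarry 0%N) vk i.+1), (put g i x); split; first by [].
  + by do 2 (apply: frame_put => //).
  + by rewrite /= c2.
  + apply: (low _ x); last by rewrite c1.
    * by move=> k ki; rewrite !put_other //; lia.
    * by rewrite put_same.
  + by move=> k ki; rewrite !put_other ?e3 //; lia.
- move=> b _ [f [g [-> hf e1 e2 e3]]]; apply: ph => // k kd; exact: e2.
Qed.

Definition time_tester dd m1 m t K : nat :=
  (n ^ dd.+1 * (time_test dd m1 m t K + time_next dd + 10) + 10)%N.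

Definition decide dd m1 m t K D (l : seq (seq bool)) : bool :=
  ~~ has (fun c => all_exceed m1 m (code (digit n c) dd.+1) K (threshold m1 m K D) t l)
       (iota 0 (n ^ dd.+1)).

Lemma wp_tester dd m1 m t K D l a (Phi : ast R -> Prop) :
  par dd m1 m t K D (va a) -> (0 < K)%N -> (forall k, (k <= dd)%N -> ar a k = 0%N) ->
  size l = (t * block_size m1 m)%N -> stored n (ar a) dd.+1 l ->
  (forall (f : nat -> nat) g h, f vans = decide dd m1 m t K D l -> Phi (wrv (war (wva a f) g) h)) ->
  wp Tester (time_tester dd m1 m t K) Phi a.
Proof.
move=> hp K0 hz sl hst ph; have [h0 h1 hdd hm1 hm ht hK hD] := hp.
set tt := time_test dd m1 m t K; set tn := time_next dd; set N := (n ^ dd.+1)%N.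
pose ms := [:: vans; vcarry; vk] ++ ([:: vb; vbp; vbad] ++ zstat_vars).
pose ex c := all_exceed m1 m (code (digit n c) dd.+1) K (threshold m1 m K D) t l.
apply: (wp_le (t := (1 + (1 + (N * (tt + tn + 6).+1).+1).+1).+1)).
  by rewrite /time_tester -/tt -/tn -/N; lia.
have N0 : (0 < N)%N by rewrite expn_gt0 n0.
apply: wp_seq; putv 1%N.
apply: wp_seq; putv 0%N.
(* The carry is zero exactly while tuples remain. After the last one the counter has wrapped around,
   so the clause on its digits is guarded by [i < N]. *)
apply: (wp_while n0 hA0 hRB (cnt := N) (tb := (tt + tn + 6)%N) (I := fun i a' => exists f g h,
  [/\ a' = wrv (war (wva a f) g) h, frame ms (va a) f /\ (f vcarry == 0%N) = (i < N)%N,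
     f vans = ~~ has ex (iota 0 i),
     (i < N)%N -> (forall k, (k <= dd)%N -> g k = digit n i k) &
     (forall k, (dd < k)%N -> g k = ar a k)])) => //.
- exists (put (put (va a) vans 1%N) vcarry 0%N), (ar a), (rv a); split; first by [].
  + split; first by do 2 (apply: frame_put => //).
    by rewrite /= N0.
  + by [].
  + by move=> _ k /hz ->; rewrite /digit div0n mod0n.
  + by [].
- move=> i b iN [f [g [h [-> [hf ec] ea hg hg']]]].
  have hpf : par dd m1 m t K D f by apply: (par_frame _ hf hp).
  have [k0 k1 kdd km1 km kt kK kD] := hpf.
  split; first by rewrite /EqN; ev; rewrite /= andbT leqn0 ec iN.
  apply: (wp_le (t := (tt + (1.+1 + tn).+1).+1)); first by lia.
  have hgi := hg iN.
  apply: wp_seq; apply: (@wp_test (digit n i) dd m1 m t K D l) => //.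
  + by move=> k kd; rewrite /= hgi // ltn_mod.
  + move=> p q ps qn; rewrite /= hg'; last by lia.
    by apply: hst.
  move=> f1 g1 hf1 e1; rewrite /= in hf1.
  apply: wp_seq.
  have hb : evb n d A0 RB mt eps tab (wrv (wva (wrv (war (wva a f) g) h) f1) g1)
      (EqN (Va vbad) (NNum 1)) (ex i).
    by rewrite /EqN; ev; rewrite /= e1 -/(ex i); case: (ex i).
  apply: (wp_if hb).
  have fin f2 : frame [:: vans] f1 f2 -> f2 vans = ~~ has ex (iota 0 i.+1) ->
      wp NextTuple tn (fun a' => exists f g h,
  [/\ a' = wrv (war (wva a f) g) h, frame ms (va a) f /\ (f vcarry == 0%N) = (i.+1 < N)%N,
     f vans = ~~ has ex (iota 0 i.+1),
     (i.+1 < N)%N -> (forall k, (k <= dd)%N -> g k = digit n i.+1 k) &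
     (forall k, (dd < k)%N -> g k = ar a k)]) (wrv (war (wva a f2) g) g1).
    move=> hf2 e2; apply: (@wp_next dd i) => //=; try by frm.
    move=> f3 g3 hf3 e3 hg3 hg3'; rewrite /= in hf3 hg3'.
    exists f3, g3, g1; split=> //.
    - split.
        apply: (frame_trans _ _ hf3); first by apply/allP.
        apply: (frame_trans _ _ hf2); first by apply/allP.
        by apply: (frame_trans _ hf hf1); apply/allP.
      rewrite e3 -/N (divn_small iN) subn0; case: (ltnP i.+1 N) => hN.
        by rewrite divn_small.
      by have -> : i.+1 = N by [lia]; rewrite divnn N0.
    - by frm.
    - by move=> k kd; rewrite hg3' // hg'.
  have eh : has ex (iota 0 i.+1) = has ex (iota 0 i) || ex i.
    by rewrite -addn1 iotaD has_cat /= orbF.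
  case: (ex i) eh => eh; rewrite ?orbT ?orbF in eh.
    putv 0%N; apply: fin; first by apply: frame_put.
    by rewrite eh.
  by apply: wp_skip; apply: fin => //; rewrite eh; frm; rewrite ea.
- move=> b [f [g [h [-> [hf ec] ea _ _]]]]; split.
    by rewrite /EqN; ev; rewrite /= andbT leqn0 ec ltnn.
  by apply: ph; rewrite ea.
Qed.

End TesterSpec.

(** * Storing the samples and setting the parameters *)

Notation vfi := 30%N (only parsing).
Notation vj := 31%N (only parsing).

Definition Store (src : bool) : cmd :=
  For vj Nn (CSeq (SetA (Va vptr) (NBit src (Va vj)))
                  (SetV vptr (NAdd (Va vptr) (NNum 1)))).

Definition GetSample (src : bool) : cmd := CSeq (CDraw src) (Store src).

Definition FillBlocks (gF gX gY : cmd) : cmd :=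
  For vb (Va vt)
    (CSeq (For vfi (Va vm1) gF)
    (CSeq (For vfi (Va vm) gX) (CSeq (For vfi (Va vm) gY)
    (CSeq (For vfi (Va vm) gX) (For vfi (Va vm) gY))))).

Definition ghost : Type := (seq (seq bool) * seq (seq bool))%type.
Definition transition : Type := ghost -> seq bool -> ghost -> Prop.

Definition trX : transition := fun g x g' => g.1 = x :: g'.1 /\ g.2 = g'.2.
Definition trY : transition := fun g y g' => g.1 = g'.1 /\ g.2 = y :: g'.2.
(** In the closeness problem each reference sample is accompanied by a discarded sample from the
    first source, so that both sources are read equally often. *)
Definition trF (skip : bool) : transition := fun g y g' =>
  (if skip then exists x, g.1 = x :: g'.1 else g.1 = g'.1) /\ g.2 = y :: g'.2.

Fixpoint transitions (tr : transition) (l : seq (seq bool)) (g g' : ghost) : Prop :=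
  if l is x :: l' then exists2 g1, tr g x g1 & transitions tr l' g1 g' else g = g'.

Lemma transitions_X k xs ys : (k <= size xs)%N ->
  transitions trX (take k xs) (xs, ys) (drop k xs, ys).
Proof.
elim: k xs => [|k IH] [|x xs] //= h.
by exists (xs, ys) => //; apply: IH.
Qed.

Lemma transitions_Y k xs ys : (k <= size ys)%N ->
  transitions trY (take k ys) (xs, ys) (xs, drop k ys).
Proof.
elim: k ys => [|k IH] [|x ys] //= h.
by exists (xs, ys) => //; apply: IH.
Qed.

Lemma transitions_F (skip : bool) k xs ys : (skip -> k <= size xs)%N -> (k <= size ys)%N ->
  transitions (trF skip) (take k ys) (xs, ys) (drop (if skip then k else 0) xs, drop k ys).
Proof.
case: skip => /= [/(_ isT)|_]; last rewrite drop0.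
  elim: k xs ys => [|k IH] [|x xs] [|y ys] //= hx hy.
  by exists (xs, ys); [split=> //; exists x|exact: IH].
elim: k ys => [|k IH] [|y ys] //= hy.
by exists (xs, ys) => //; exact: IH.
Qed.

Section FillSpec.
Variable R : realFieldType.
Variables (n d A0 RB : nat) (mt : nat -> nat -> bool) (eps : R) (tab : nat -> R).
Hypotheses (n0 : (0 < n)%N) (hA0 : (2 + (n + num_vars) * n.+1 <= A0)%N) (hRB : (0 < RB)%N).
Local Notation wp := (wp n d A0 RB mt eps tab).
Implicit Types (a : ast R).

(* The state [St g] holds when the tapes still provide the two lists of samples
   in g; [Pr] is a condition on the parameters, kept in the variables below 12. *)
Variables (St : ghost -> ast R -> Prop) (Pr : (nat -> nat) -> Prop).
Hypothesis St_eq : forall g a b, co a = co b -> sa a = sa b -> St g a -> St g b.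
Hypothesis Pr_frame : forall f g, (forall v, (v < 12)%N -> g v = f v) -> Pr f -> Pr g.
Hypothesis Pr_A0 : forall f, Pr f -> f 0%N = A0.

Definition getter_vars : seq nat := [:: vptr; vj; 32; 33; 34; 35; 36; 37; 38; 39]%N.

(** The contract shared by reading a tape and simulating a net: one sample is appended at [vptr] and
    everything below is kept. It lets [FillBlocks] be verified once for both problems. *)
Definition getter_ok (tr : transition) (c : cmd) (tc : nat) : Prop :=
  forall a g x g' (Phi : ast R -> Prop), Pr (va a) -> St g a -> tr g x g' ->
  (va a vptr > 0)%N ->
  (forall b, St g' b -> frame getter_vars (va a) (va b) ->
     va b vptr = (va a vptr + n)%N -> (forall p, (p < va a vptr)%N -> ar b p = ar a p) ->
     (forall j, (j < n)%N -> ar b (va a vptr + j)%N = nth false x j) -> Phi b) ->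
  wp c tc Phi a.

Lemma Pr_frames ms f g : all (leq 12) ms -> frame ms f g -> Pr f -> Pr g.
Proof.
move=> /allP hms h; apply: Pr_frame => v v12; apply: h.
by apply/negP => /hms; rewrite leqNgt v12.
Qed.

Lemma wp_fill tr c tc num l a g g' (Phi : ast R -> Prop) : getter_ok tr c tc ->
  (num < 12)%N -> Pr (va a) -> St g a -> transitions tr l g g' -> va a num = size l ->
  (va a vptr > 0)%N ->
  (forall b, St g' b -> frame (vfi :: getter_vars) (va a) (va b) ->
     va b vptr = (va a vptr + size l * n)%N ->
     (forall p, (p < va a vptr)%N -> ar b p = ar a p) ->
     stored n (ar b) (va a vptr) l -> Phi b) ->
  wp (For vfi (Va num) c) (size l * tc.+3 + 3) Phi a.
Proof.
move=> hc num12 hPr hSt htr hnum ptr0 ph.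
have hnumv : (num < num_vars)%N by apply: ltn_trans num12 _.
apply: (wp_for n0 hA0 hRB (cnt := size l) (tb := tc) (I := fun i b => exists gi,
  [/\ St gi b /\ transitions tr (drop i l) gi g', frame (vfi :: getter_vars) (va a) (va b),
    va b vptr = va a vptr + i * n,
    (forall p, p < va a vptr -> ar b p = ar a p) &
    stored n (ar b) (va a vptr) (take i l)]%N)) => //.
- exists g; rewrite drop0 take0; split=> //.
  + by split=> //; apply: St_eq hSt.
  + exact: frame_put.
  + by rewrite /= mul0n addn0.
- move=> i b _ _ [gi [_ hf _ _ _]]; ev; rewrite hf //.
  by rewrite !inE; do !(case: eqP => [e|_]; first by rewrite e in num12).
- move=> i b il ei [gi [[hSi htri] hf eptr hlow hst]].
  rewrite (drop_nth [::] il) in htri; case: htri => g1 ht1 htr1.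
  apply: (hc _ _ _ _ _ _ hSi ht1).
  + by apply: (Pr_frames _ hf hPr).
  + by rewrite eptr ltn_addr.
  move=> b' hSb hfb eptrb hlowb hstb; split; first by rewrite hfb.
  exists g1; split.
  + by split=> //; apply: St_eq hSb.
  + apply: frame_put => //; apply: (frame_trans _ hf hfb).
    by apply/allP.
  + by rewrite /= eptrb eptr mulSn; lia.
  + by move=> p hp; rewrite /= hlowb ?hlow // eptr; lia.
  + move=> k j; rewrite size_take_min => kl jn /=.
    have [ki|ki] := ltnP k i; last first.
      have -> : k = i by lia.
      by rewrite addnA -eptr hstb // nth_take.
    rewrite hlowb; last first.
      rewrite eptr; apply: (@leq_trans (va a vptr + (k * n + n))%N).
        by rewrite ltn_add2l ltn_add2l.
      by rewrite leq_add2l -mulSnr leq_mul2r ki orbT.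
    by rewrite hst // ?size_take_min ?nth_take //; lia.
- move=> b _ [gi [[hSi htri] hf eptr hlow hst]].
  rewrite drop_size in htri; rewrite take_size in hst.
  by apply: ph => //; rewrite -htri.
Qed.

Lemma stored_cat mem p l l' : stored n mem p l -> stored n mem (p + size l * n)%N l' ->
  stored n mem p (l ++ l').
Proof.
move=> h h' k j; rewrite size_cat nth_cat => hk jn.
case: (ltnP k (size l)) => kl; first exact: h.
rewrite -h' //; last by lia.
have e : k = (size l + (k - size l))%N by lia.
by rewrite {1}e mulnDl -!addnA.
Qed.

Lemma stored_low mem mem' p l : stored n mem p l ->
  (forall q, (q < p + size l * n)%N -> mem' q = mem q) -> stored n mem' p l.
Proof.
move=> h hm k j kl jn; rewrite -h // hm // ltn_add2l.
by apply: (@leq_trans (k.+1 * n)); [rewrite mulSnr ltn_add2l|rewrite leq_mul2r kl orbT].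
Qed.

Lemma wp_fill_blocks skip o gF gX gY tc m1 m t xs ys a (Phi : ast R -> Prop) :
  o = (if skip then m1 else 0)%N ->
  getter_ok (trF skip) gF tc -> getter_ok trX gX tc -> getter_ok trY gY tc ->
  Pr (va a) -> (forall f, Pr f -> [/\ f vm1 = m1, f vm = m & f vt = t]) ->
  size xs = (t * (o + m + m))%N -> size ys = (t * (m1 + m + m))%N ->
  St (xs, ys) a -> (va a vptr > 0)%N ->
  (forall b, St ([::], [::]) b -> frame [:: vb, vfi & getter_vars] (va a) (va b) ->
     (forall p, (p < va a vptr)%N -> ar b p = ar a p) ->
     stored n (ar b) (va a vptr) (interleave m1 m o t xs ys) -> Phi b) ->
  wp (FillBlocks gF gX gY) (t * ((m1 + m * 4) * tc.+3 + 25) + 3) Phi a.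
Proof.
move=> eo hgF hgX hgY hPr hpar sxs sys hSt ptr0 ph.
set L := block_size m1 m.
pose rest i := interleave m1 m o (t - i) (drop (i * (o + m + m)) xs) (drop (i * (m1 + m + m)) ys).
have size_rest i : (i <= t)%N -> size (rest i) = ((t - i) * L)%N.
  rewrite /rest => it.
  have : size (drop (i * (o + m + m)) xs) = ((t - i) * (o + m + m))%N by rewrite size_drop sxs -mulnBl.
  have : size (drop (i * (m1 + m + m)) ys) = ((t - i) * (m1 + m + m))%N by rewrite size_drop sys -mulnBl.
  elim: (t - i)%N (drop _ ys) (drop _ xs) => [|k IH] ys' xs' hy hx //=.
  rewrite mulSn in hy; rewrite mulSn in hx.
  rewrite !size_cat !size_takel ?size_drop; try lia.
  by rewrite IH ?size_drop; try lia; rewrite mulSn /L /block_size; lia.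
apply: (wp_le (t := (t * ((m1 + m * 4) * tc.+3 + 22).+3 + 3))); first by lia.
apply: (wp_for n0 hA0 hRB (cnt := t) (tb := ((m1 + m * 4) * tc.+3 + 22)%N) (I := fun i b => exists l,
  [/\ St (drop (i * (o + m + m)) xs, drop (i * (m1 + m + m)) ys) b,
     frame [:: vb, vfi & getter_vars] (va a) (va b),
     l ++ rest i = interleave m1 m o t xs ys /\ size l = i * L,
     va b vptr = va a vptr + i * L * n &
     (forall p, p < va a vptr -> ar b p = ar a p) /\ stored n (ar b) (va a vptr) l]%N)) => //.
- exists [::]; rewrite !mul0n !drop0; split=> //.
  + exact: St_eq hSt.
  + exact: frame_put.
  + by rewrite /rest !mul0n !drop0 subn0.
  + by rewrite /= addn0.
- by move=> i b _ _ [l [_ hf _ _ _]]; ev; have [_ _ <-] := hpar _ hPr; rewrite hf.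
- move=> i b it ei [l [hSi hf [el sl] eptr [hlow hst]]].
  set xs1 := drop (i * _) xs in hSi; set ys1 := drop (i * _) ys in hSi.
  have sx1 : (o + m + m <= size xs1)%N.
    by rewrite size_drop sxs -mulnBl leq_pmull // subn_gt0.
  have sy1 : (m1 + m + m <= size ys1)%N.
    by rewrite size_drop sys -mulnBl leq_pmull // subn_gt0.
  set F := take m1 ys1; set X := take m (drop o xs1); set Y := take m (drop m1 ys1).
  set X' := take m (drop (o + m) xs1); set Y' := take m (drop (m1 + m) ys1).
  have er : rest i = F ++ X ++ Y ++ X' ++ Y' ++ rest i.+1.
    rewrite /rest (_ : t - i = (t - i.+1).+1)%N; last by lia.
    rewrite /= -/xs1 -/ys1; do 5 (congr (_ ++ _)).
    by rewrite /xs1 /ys1 !drop_drop !mulSn.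
  have zF : size F = m1 by rewrite size_takel //; lia.
  have zX : size X = m by rewrite size_takel // size_drop; lia.
  have zY : size Y = m by rewrite size_takel // size_drop; lia.
  have zX' : size X' = m by rewrite size_takel // size_drop; lia.
  have zY' : size Y' = m by rewrite size_takel // size_drop; lia.
  have hPb : Pr (va b) by apply: (Pr_frames _ hf hPr).
  have step ms f f' : all (leq 12) ms -> Pr f -> frame ms f f' -> Pr f'.
    by move=> h1 h2 h3; apply: (Pr_frames h1 h3 h2).
  apply: (wp_le (t := ((size F * tc.+3 + 3) + ((size X * tc.+3 + 3) + ((size Y * tc.+3 + 3)
     + ((size X' * tc.+3 + 3) + (size Y' * tc.+3 + 3)).+1).+1).+1).+1)).
    by rewrite zF zX zY zX' zY'; lia.
  have [pm1 pm pt] := hpar _ hPb.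
  apply: wp_seq; apply: (wp_fill hgF _ hPb hSi (transitions_F (skip := skip) (k := m1) _ _)) => //.
  + by move=> hs; move: sx1; rewrite eo hs; lia.
  + by lia.
  + by rewrite pm1 zF.
  + by rewrite eptr ltn_addr.
  move=> b1 S1 f1 p1 l1 st1; rewrite -eo in S1; have P1 : Pr (va b1) by apply: (step _ _ _ _ hPb f1).
  have [p1m1 p1m p1t] := hpar _ P1.
  apply: wp_seq; apply: (wp_fill hgX _ P1 S1 (@transitions_X m _ _ _)) => //.
  + by rewrite size_drop; lia.
  + by rewrite p1m zX.
  + by rewrite p1 eptr; lia.
  move=> b2 S2 f2 p2 l2 st2; have P2 : Pr (va b2) by apply: (step _ _ _ _ P1 f2).
  have [p2m1 p2m p2t] := hpar _ P2.
  apply: wp_seq; apply: (wp_fill hgY _ P2 S2 (@transitions_Y m _ _ _)) => //.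
  + by rewrite size_drop; lia.
  + by rewrite p2m zY.
  + by rewrite p2 p1 eptr; lia.
  move=> b3 S3 f3 p3 l3 st3; have P3 : Pr (va b3) by apply: (step _ _ _ _ P2 f3).
  have [p3m1 p3m p3t] := hpar _ P3.
  rewrite (drop_drop xs1) (drop_drop ys1) (addnC m o) (addnC m m1) in S3.
  apply: wp_seq; apply: (wp_fill hgX _ P3 S3 (@transitions_X m _ _ _)) => //.
  + by rewrite size_drop; lia.
  + by rewrite p3m zX'.
  + by rewrite p3 p2 p1 eptr; lia.
  move=> b4 S4 f4 p4 l4 st4; have P4 : Pr (va b4) by apply: (step _ _ _ _ P3 f4).
  have [p4m1 p4m p4t] := hpar _ P4.
  apply: (wp_fill hgY _ P4 S4 (@transitions_Y m _ _ _)) => //.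
  + by rewrite size_drop; lia.
  + by rewrite p4m zY'.
  + by rewrite p4 p3 p2 p1 eptr; lia.
  move=> b5 S5 f5 p5 l5 st5.
  rewrite -!/X -!/Y -!/X' -!/Y' -!/F in st1 st2 st3 st4 st5 p1 p2 p3 p4 p5.
  have q1 : va b1 vptr = (va b vptr + m1 * n)%N by rewrite p1 zF.
  have q2 : va b2 vptr = (va b vptr + (m1 + m) * n)%N by rewrite p2 q1 zX mulnDl addnA.
  have q3 : va b3 vptr = (va b vptr + (m1 + m + m) * n)%N by rewrite p3 q2 zY [in RHS]mulnDl addnA.
  have q4 : va b4 vptr = (va b vptr + (m1 + m + m + m) * n)%N by rewrite p4 q3 zX' [in RHS]mulnDl addnA.
  have q5 : va b5 vptr = (va b vptr + L * n)%N by rewrite p5 q4 zY' [in RHS]mulnDl addnA.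
  have stB : stored n (ar b5) (va b vptr) (F ++ X ++ Y ++ X' ++ Y').
    apply: stored_cat.
      apply: (stored_low st1) => q hq; rewrite -p1 in hq.
      by rewrite l5 ?l4 ?l3 ?l2 //; lia.
    rewrite -p1; apply: stored_cat.
      apply: (stored_low st2) => q hq; rewrite -p2 in hq.
      by rewrite l5 ?l4 ?l3 //; lia.
    rewrite -p2; apply: stored_cat.
      apply: (stored_low st3) => q hq; rewrite -p3 in hq.
      by rewrite l5 ?l4 //; lia.
    rewrite -p3; apply: stored_cat; last by rewrite -p4.
    apply: (stored_low st4) => q hq; rewrite -p4 in hq.
    by rewrite l5 //; lia.
  have lowB q : (q < va b vptr)%N -> ar b5 q = ar b q.
    by move=> hq; rewrite l5 ?l4 ?l3 ?l2 ?l1 //; lia.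
  split; first by rewrite f5 // f4 // f3 // f2 // f1.
  exists (l ++ F ++ X ++ Y ++ X' ++ Y'); split.
  + have -> : drop (i.+1 * (o + m + m)) xs = drop m (drop (o + m) xs1).
      by rewrite /xs1 !drop_drop mulSn; congr drop; lia.
    have -> : drop (i.+1 * (m1 + m + m)) ys = drop m (drop (m1 + m) ys1).
      by rewrite /ys1 !drop_drop mulSn; congr drop; lia.
    exact: St_eq (S5).
  + apply: frame_put => //.
    apply: (frame_trans _ _ f5); first by apply/allP.
    apply: (frame_trans _ _ f4); first by apply/allP.
    apply: (frame_trans _ _ f3); first by apply/allP.
    apply: (frame_trans _ _ f2); first by apply/allP.
    by apply: (frame_trans _ hf f1); apply/allP.
  + rewrite -el er -!catA; split=> //.
    by rewrite !size_cat sl zF zX zY zX' zY' mulSn /L /block_size; lia.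
  + by rewrite /= q5 eptr mulSn mulnDl; lia.
  + split=> [p hp|] /=; first by rewrite lowB ?hlow // eptr ltn_addr.
    apply: stored_cat.
      by apply: (stored_low hst) => q; rewrite sl -eptr; apply: lowB.
    by rewrite sl -eptr.
- move=> b eb [l [hSi hf [el sl] eptr [hlow hst]]].
  rewrite !drop_oversize ?sxs ?sys // in hSi; apply: ph => //.
  by move: el; rewrite /rest subnn cats0 => <-.
Qed.

Definition time_get : nat := (n * 6 + 7)%N.

Lemma wp_get src x rest a (Phi : ast R -> Prop) : va a 0 = A0 -> sa a src = x :: rest ->
  (forall b, sa b = upd (sa a) src rest -> co b = co a -> frame getter_vars (va a) (va b) ->
     va b vptr = (va a vptr + n)%N -> (forall p, (p < va a vptr)%N -> ar b p = ar a p) ->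
     (forall j, (j < n)%N -> ar b (va a vptr + j)%N = nth false x j) -> Phi b) ->
  wp (GetSample src) time_get Phi a.
Proof.
move=> h0 hx ph.
apply: (wp_le (t := (1 + (n * 3.+3 + 3)).+1)); first by rewrite /time_get; lia.
apply: wp_seq; apply: (wp_draw _ _ _ _ _ _ _ hx).
set a1 := wsa _ _.
have l1 : lt a1 src = x by rewrite /a1 /= /upd eqxx.
apply: (wp_for n0 hA0 hRB (cnt := n) (tb := 3) (I := fun i b => exists f g,
  [/\ b = war (wva a1 f) g, frame getter_vars (va a) f, f vptr = va a vptr + i,
    (forall p, p < va a vptr -> g p = ar a p) &
    (forall j, j < i -> g (va a vptr + j) = nth false x j)]%N)) => //.
- exists (put (va a) vj 0%N), (ar a); split=> //; first by apply: frame_put.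
  by rewrite /= addn0.
- by move=> i b _ _ [f [g [-> hf _ _ _]]]; ev.
- move=> i b iltn ei [f [g [eb hf eptr hlow hst]]]; subst b; rewrite /= in ei.
  apply: (wp_le (t := (1 + 1).+1)) => //.
  apply: wp_seq; apply: (wp_seta hA0 (i := f vptr) (x := nth false x i)).
  + by frm.
  + by ev.
  + by ev; rewrite -[lt _ src]/(lt a1 src) l1 /= ei.
  putv (f vptr + 1)%N.
  split; first by [].
  exists (put (put f vptr (f vptr + 1)%N) vj i.+1), (put g (f vptr) (nth false x i)); split.
  + by [].
  + by do 2 (apply: frame_put => //).
  + by rewrite /= eptr addn1 addnS.
  + by move=> p hp; rewrite put_other ?hlow // eptr; lia.
  + move=> j; rewrite ltnS leq_eqVlt => /orP[/eqP ->|ji]; first by rewrite eptr put_same.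
    by rewrite put_other ?hst // eptr; lia.
- by move=> b _ [f [g [-> hf eptr hlow hst]]]; apply: ph.
Qed.

End FillSpec.

Section TapeGetters.
Variable R : realFieldType.
Variables (n d A0 RB : nat) (mt : nat -> nat -> bool) (eps : R) (tab : nat -> R).
Hypotheses (n0 : (0 < n)%N) (hA0 : (2 + (n + num_vars) * n.+1 <= A0)%N) (hRB : (0 < RB)%N).
Variable Pr : (nat -> nat) -> Prop.
Hypothesis Pr_A0 : forall f, Pr f -> f 0%N = A0.

Definition on_tapes (g : ghost) (a : ast R) : Prop := sa a false = g.1 /\ sa a true = g.2.

Local Notation getter_ok St := (getter_ok n d A0 RB mt eps tab St Pr).

Lemma getX_ok (St' : seq (seq bool) -> ast R -> Prop) tc : (time_get n <= tc)%N ->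
  (forall ys a b, co a = co b -> sa a true = sa b true -> St' ys a -> St' ys b) ->
  getter_ok (fun g a => sa a false = g.1 /\ St' g.2 a) trX (GetSample false) tc.
Proof.
move=> htc hSt' a [xs ys] x [xs' ys'] Phi hPr [/= hs hS] [/= e1 e2] _ ph.
have hz : sa a false = x :: xs' by rewrite hs.
apply: (wp_le htc); apply: (@wp_get R n d A0 RB mt eps tab n0 hA0 hRB _ _ _ _ _ (Pr_A0 hPr) hz).
move=> b esa eco; apply: ph; split; first by rewrite esa.
by rewrite -e2; apply: hSt' hS; rewrite ?esa.
Qed.

Lemma get_true_ok tc : (time_get n <= tc)%N -> getter_ok on_tapes trY (GetSample true) tc.
Proof.
move=> htc a [xs ys] x [xs' ys'] Phi hPr [/= hs1 hs2] [/= e1 e2] _ ph.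
have hz : sa a true = x :: ys' by rewrite hs2.
apply: (wp_le htc); apply: (@wp_get R n d A0 RB mt eps tab n0 hA0 hRB _ _ _ _ _ (Pr_A0 hPr) hz).
by move=> b esa eco; apply: ph; split; rewrite esa //= -e1.
Qed.

Lemma get_skip_ok tc : (time_get n + 2 <= tc)%N ->
  getter_ok on_tapes (trF true) (CSeq (CDraw false) (GetSample true)) tc.
Proof.
move=> htc a [xs ys] x [xs' ys'] Phi hPr [/= hs1 hs2] [/= [z e1] e2] _ ph.
apply: (wp_le (t := (1 + time_get n).+1)); first by lia.
have hz : sa a false = z :: xs' by rewrite hs1.
apply: wp_seq; apply: (wp_draw _ _ _ _ _ _ _ hz).
set a1 := wsa _ _; have hy : sa a1 true = x :: ys' by rewrite /= /upd /= hs2.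
have h0 : va a1 0 = A0 by exact: Pr_A0 hPr.
apply: (@wp_get R n d A0 RB mt eps tab n0 hA0 hRB _ _ _ _ _ h0 hy).
by move=> b esa eco; apply: ph; split; rewrite esa.
Qed.

End TapeGetters.

Notation vmi := 32%N (only parsing).
Notation vs1 := 33%N (only parsing).
Notation vs2 := 34%N (only parsing).

(** Repeated addition takes time linear in the value of the first factor, so first factors must stay
    polynomial in the number of samples. *)
Definition Mul (dst : nat) (e1 e2 : nexp) : cmd :=
  CSeq (SetV dst (NNum 0)) (For vmi e1 (SetV dst (NAdd (Va dst) e2))).

Definition SetupBase : cmd :=
  CSeq (SetV 0 (NNum 2))
    (For vmi (NAdd Nn (NNum num_vars)) (SetV 0 (NAdd (Va 0) (NAdd Nn (NNum 1))))).

(** In the absence of rounding, the least [E] with [E * eps > 1] is found by search. *)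
Definition SetupE : cmd :=
  CSeq (SetV vE (NNum 0))
    (CWhile (BLeR (RMul (RNat (Va vE)) Eps) (RNat (NNum 1)))
       (SetV vE (NAdd (Va vE) (NNum 1)))).

Definition SetupK : cmd :=
  CSeq (SetV vK (NNum 2)) (For vmi (Va vdd) (SetV vK (NAdd (Va vK) (Va vK)))).

(* Doubling with q = 2 and quadrupling with q = 3 give the two values of h, about
   2 ^ (dd / 2) and 2 ^ (2 dd / 3). *)
Definition SetupH (grow : nexp) (q : nat) : cmd :=
  CSeq (SetV vh (NNum 1)) (CSeq (SetV vs1 (Va vdd))
    (CWhile (BLeN (NNum 1) (Va vs1))
       (CSeq (SetV vh grow) (SetV vs1 (NSub (Va vs1) (NNum q)))))).

Definition Double : nexp := NAdd (Va vh) (Va vh).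
Definition Quadruple : nexp := NAdd (NAdd (Va vh) (Va vh)) (NAdd (Va vh) (Va vh)).

Definition SetupCommon (setH setM1 : cmd) : cmd :=
  CSeq (CIf (BLeN Dn Nn) (SetV vdd Dn) (SetV vdd Nn))
  (CSeq SetupE (CSeq SetupK (CSeq setH (CSeq setM1
  (CSeq (Mul vt Nn (NAdd (Va vdd) (NNum 3)))
  (CSeq (Mul vs1 Nn Nn) (CSeq (Mul vs2 (Va vE) (Va vE)) (CSeq (Mul vD (Va vs1) (Va vs2))
  (CSeq (SetV vD (NAdd (Va vD) (Va vD))) (CSeq (SetV vD (NAdd (Va vD) (Va vD)))
  (CSeq (SetV vD (NAdd (Va vD) (Va vD)))
  (CSeq (Mul vs1 (Va vD) (Va vD)) (CSeq (Mul vs2 (Va vs1) (Va vh))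
  (CSeq (Mul vs1 (Va vs2) (Va vt)) (CSeq (Mul vm (NNum 600) (Va vs1))
  (SetV vptr (NAdd (Va vdd) (NNum 1)))))))))))))))))).

Section SetupSpec.
Variable R : realFieldType.
Variables (n d A0 RB : nat) (mt : nat -> nat -> bool) (eps : R) (tab : nat -> R).
Hypotheses (n0 : (0 < n)%N) (hA0 : (2 + (n + num_vars) * n.+1 <= A0)%N) (hRB : (0 < RB)%N).
Local Notation wp := (wp n d A0 RB mt eps tab).
Local Notation evn := (evn n d A0 RB mt eps tab).
Implicit Types (a : ast R).

Lemma wp_mul dst e1 e2 x y a (Phi : ast R -> Prop) :
  (dst < num_vars)%N -> dst != vmi ->
  (forall f, frame [:: dst; vmi] (va a) f -> evn (wva a f) e1 x /\ evn (wva a f) e2 y) ->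
  (forall f, frame [:: dst; vmi] (va a) f -> f dst = (x * y)%N -> Phi (wva a f)) ->
  wp (Mul dst e1 e2) (x * 4 + 5) Phi a.
Proof.
move=> hd dm he ph.
apply: (wp_le (t := (1 + (x * 1.+3 + 3)).+1)); first by lia.
apply: wp_seq; apply: (wp_setv n0 hA0 (x := 0%N)) => //.
apply: (wp_for n0 hA0 hRB (cnt := x) (tb := 1%N) (I := fun i b => exists f,
  [/\ b = wva a f, frame [:: dst; vmi] (va a) f & f dst = i * y]%N)) => //.
- exists (put (put (va a) dst 0%N) vmi 0%N); split=> //.
    by apply: frame_put; [apply: frame_put => //; rewrite !inE eqxx|rewrite !inE eqxx orbT].
  by rewrite put_other // put_same.
- by move=> i b _ _ [f [-> hf _]]; have [] := he f hf.
- move=> i b ix ei [f [eb hf e]]; subst b; have [_ h2] := he f hf.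
  apply: (wp_setv n0 hA0 (x := (f dst + y)%N)) => //.
    by move=> s hs; rewrite (evalE s) (ev_va hs) // h2.
  split; first by rewrite /setv /wva [va _]/= put_other // eq_sym.
  exists (put (put f dst (f dst + y)%N) vmi i.+1); split=> //.
    by apply: frame_put; [apply: frame_put => //; rewrite !inE eqxx|rewrite !inE eqxx orbT].
  by rewrite put_other // put_same e mulSn addnC.
- by move=> b _ [f [-> hf e]]; apply: ph.
Qed.

Lemma wp_base a (Phi : ast R -> Prop) :
  (forall f, frame [:: 0%N; vmi] (va a) f -> f 0%N = (2 + (n + num_vars) * n.+1)%N ->
     Phi (wva a f)) ->
  wp SetupBase ((n + num_vars) * 4 + 5) Phi a.
Proof.
move=> ph.
apply: (wp_le (t := (1 + ((n + num_vars) * 1.+3 + 3)).+1)); first by lia.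
apply: wp_seq; putv 2%N.
apply: (wp_for n0 hA0 hRB (cnt := (n + num_vars)%N) (tb := 1%N) (I := fun i b => exists f,
  [/\ b = wva a f, frame [:: 0; vmi] (va a) f & f 0 = 2 + i * n.+1]%N)) => //.
- exists (put (put (va a) 0%N 2%N) vmi 0%N); split=> //.
  by do 2 (apply: frame_put => //).
- by move=> i b _ _ [f [-> hf _]]; ev.
- move=> i b ix ei [f [eb hf e]]; subst b.
  putv (f 0%N + (n + 1))%N; split; first by [].
  exists (put (put f 0%N (f 0 + (n + 1))%N) vmi i.+1); split=> //.
    by do 2 (apply: frame_put => //).
  by rewrite /= e mulSn; lia.
- by move=> b _ [f [-> hf e]]; apply: ph.
Qed.

Lemma wp_E E a (Phi : ast R -> Prop) :
  (forall i : nat, (i%:R * eps <= 1) = (i < E)%N) ->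
  (forall f, frame [:: vE] (va a) f -> f vE = E -> Phi (wva a f)) ->
  wp SetupE (E * 2 + 3) Phi a.
Proof.
move=> hE ph.
apply: (wp_le (t := (1 + (E * 2).+1).+1)); first by lia.
apply: wp_seq; putv 0%N.
apply: (wp_while n0 hA0 hRB (cnt := E) (tb := 1%N) (I := fun i b => exists f,
  [/\ b = wva a f, frame [:: vE] (va a) f & f vE = i])).
- exists (put (va a) vE 0%N); split=> //; exact: frame_put.
- move=> i b iE [f [-> hf e]]; split.
    by move=> s hs; evs s hs; rewrite /= e hE.
  putv (f vE + 1)%N; exists (put f vE (f vE + 1)%N); split=> //; first exact: frame_put.
  by rewrite /= e addn1.
- move=> b [f [-> hf e]]; split; last by apply: ph.
  by move=> s hs; evs s hs; rewrite /= e hE ltnn.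
Qed.

Lemma wp_K dd a (Phi : ast R -> Prop) : va a vdd = dd ->
  (forall f, frame [:: vK; vmi] (va a) f -> f vK = (2 ^ dd.+1)%N -> Phi (wva a f)) ->
  wp SetupK (dd * 4 + 5) Phi a.
Proof.
move=> hdd ph.
apply: (wp_le (t := (1 + (dd * 1.+3 + 3)).+1)); first by lia.
apply: wp_seq; putv 2%N.
apply: (wp_for n0 hA0 hRB (cnt := dd) (tb := 1%N) (I := fun i b => exists f,
  [/\ b = wva a f, frame [:: vK; vmi] (va a) f & f vK = 2 ^ i.+1]%N)) => //.
- exists (put (put (va a) vK 2%N) vmi 0%N); split=> //.
  by do 2 (apply: frame_put => //).
- by move=> i b _ _ [f [-> hf _]]; ev; frm.
- move=> i b ix ei [f [eb hf e]]; subst b.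
  putv (f vK + f vK)%N; split; first by [].
  exists (put (put f vK (f vK + f vK)%N) vmi i.+1); split=> //.
    by do 2 (apply: frame_put => //).
  by rewrite /= e [in RHS]expnS mul2n addnn.
- by move=> b _ [f [-> hf e]]; apply: ph.
Qed.

Definition divup (x q : nat) : nat := ((x + q.-1) %/ q)%N.

Lemma ltn_divup x q i : (0 < q)%N -> (i < divup x q)%N = (q * i < x)%N.
Proof.
move=> q0; rewrite /divup ltnNge -ltnS ltn_divLR // -ltnNge.
by apply/idP/idP; lia.
Qed.

Lemma wp_h grow q b0 dd a (Phi : ast R -> Prop) : va a vdd = dd -> (0 < q)%N ->
  (forall f, evn (wva a f) grow (b0 * f vh)%N) ->
  (forall f, frame [:: vh; vs1] (va a) f -> f vh = (b0 ^ divup dd q)%N -> Phi (wva a f)) ->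
  wp (SetupH grow q) (divup dd q * 4 + 5) Phi a.
Proof.
move=> hdd q0 hg ph.
apply: (wp_le (t := (1 + (1 + (divup dd q * 4).+1).+1).+1)); first by lia.
apply: wp_seq; putv 1%N.
apply: wp_seq; putv (va a vdd).
apply: (wp_while n0 hA0 hRB (cnt := divup dd q) (tb := 3%N) (I := fun i b => exists f,
  [/\ b = wva a f, frame [:: vh; vs1] (va a) f, f vh = b0 ^ i & f vs1 = dd - q * i]%N)).
- exists (put (put (va a) vh 1%N) vs1 (va a vdd)); split=> //.
    by do 2 (apply: frame_put => //).
  by rewrite /= hdd muln0 subn0.
- move=> i b; rewrite ltn_divup // => iq [f [-> hf e1 e2]]; split.
    by ev; rewrite /= e2; lia.
  apply: (wp_le (t := (1 + 1).+1)) => //.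
  apply: wp_seq; apply: (wp_setv n0 hA0 (x := (b0 * f vh)%N)) => //.
  putv (f vs1 - q)%N.
  exists (put (put f vh (b0 * f vh)%N) vs1 (f vs1 - q)%N); split=> //.
  + by do 2 (apply: frame_put => //).
  + by rewrite /= e1 expnS.
  + by rewrite /= e2; lia.
- move=> b [f [-> hf e1 e2]]; split; last by apply: ph.
  have := ltn_divup dd (divup dd q) q0; rewrite ltnn => h.
  by ev; rewrite /= e2; lia.
Qed.

Record params (dd E h m1 m t K D : nat) (f : nat -> nat) : Prop := Params {
  pdd : f vdd = dd; pE : f vE = E; ph : f vh = h; pm1 : f vm1 = m1;
  pm : f vm = m; pt : f vt = t; pK : f vK = K; pD : f vD = D }.

Definition time_setup (th tm1 dd E h D : nat) : nat :=
  (th + tm1 + E * 6 + dd * 4 + n * 12 + D * 8 + D * D * 4 + D * D * h * 4 + 3000)%N.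

Lemma wp_common setH setM1 th tm1 h m1 E a (Phi : ast R -> Prop) :
  let dd := minn d n in let t := (n * (dd + 3))%N in let D := (8 * (n * n * (E * E)))%N in
  let m := (600 * (D * D * h * t))%N in
  (forall i : nat, (i%:R * eps <= 1) = (i < E)%N) ->
  (forall b (Psi : ast R -> Prop), va b vdd = dd ->
     (forall f, frame [:: vh; vs1] (va b) f -> f vh = h -> Psi (wva b f)) ->
     wp setH th Psi b) ->
  (forall b (Psi : ast R -> Prop), va b vh = h ->
     (forall f, frame [:: vm1; vmi] (va b) f -> f vm1 = m1 -> Psi (wva b f)) ->
     wp setM1 tm1 Psi b) ->
  (forall f, frame [:: vdd; vE; vh; vm1; vm; vt; vK; vD; vptr; vmi; vs1; vs2] (va a) f ->
     params dd E h m1 m t (2 ^ dd.+1) D f -> f vptr = dd.+1 -> Phi (wva a f)) ->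
  wp (SetupCommon setH setM1) (time_setup th tm1 dd E h D) Phi a.
Proof.
move=> dd t D m hE hH hM1 fin; set D0 := (n * n * (E * E))%N.
apply: (wp_le (t := (2 + ((E * 2 + 3) + ((dd * 4 + 5) + (th + (tm1
  + ((n * 4 + 5) + ((n * 4 + 5) + ((E * 4 + 5) + ((n * n * 4 + 5) + (1 + (1 + (1
  + ((D * 4 + 5) + ((D * D * 4 + 5) + ((D * D * h * 4 + 5) + ((600 * 4 + 5)
  + 1).+1).+1).+1).+1).+1).+1).+1).+1).+1).+1).+1).+1).+1).+1).+1).+1)).
  rewrite /time_setup; have : (n * n <= D)%N.
    rewrite /D; have E0 : (0 < E)%N by rewrite -hE mul0r.
    have : (n * n * 1 <= n * n * (E * E))%N by rewrite leq_mul2l muln_gt0 E0 orbT.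
    by lia.
  lia.
apply: wp_seq.
have hb : evb n d A0 RB mt eps tab a (BLeN Dn Nn) (d <= n)%N by ev.
apply: (wp_if hb).
have next : wp (CSeq SetupE (CSeq SetupK (CSeq setH (CSeq setM1
  (CSeq (Mul vt Nn (NAdd (Va vdd) (NNum 3)))
  (CSeq (Mul vs1 Nn Nn) (CSeq (Mul vs2 (Va vE) (Va vE)) (CSeq (Mul vD (Va vs1) (Va vs2))
  (CSeq (SetV vD (NAdd (Va vD) (Va vD))) (CSeq (SetV vD (NAdd (Va vD) (Va vD)))
  (CSeq (SetV vD (NAdd (Va vD) (Va vD)))
  (CSeq (Mul vs1 (Va vD) (Va vD)) (CSeq (Mul vs2 (Va vs1) (Va vh))
  (CSeq (Mul vs1 (Va vs2) (Va vt)) (CSeq (Mul vm (NNum 600) (Va vs1))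
  (SetV vptr (NAdd (Va vdd) (NNum 1)))))))))))))))))) ((E * 2 + 3) + ((dd * 4 + 5) + (th + (tm1
  + ((n * 4 + 5) + ((n * 4 + 5) + ((E * 4 + 5) + ((n * n * 4 + 5) + (1 + (1 + (1
  + ((D * 4 + 5) + ((D * D * 4 + 5) + ((D * D * h * 4 + 5) + ((600 * 4 + 5)
  + 1).+1).+1).+1).+1).+1).+1).+1).+1).+1).+1).+1).+1).+1).+1).+1 Phi (wva a (put (va a) vdd dd)).
  apply: wp_seq; apply: (wp_E hE) => f1 h1 e1; rewrite /= in h1.
  apply: wp_seq; apply: (@wp_K dd); first by frm.
  move=> f2 h2 e2; rewrite /= in h2.
  apply: wp_seq; apply: hH; first by frm.
  move=> f3 h3 e3; rewrite /= in h3.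
  apply: wp_seq; apply: hM1 => //.
  move=> f4 h4 e4; rewrite /= in h4.
  apply: wp_seq; apply: (@wp_mul _ _ _ n (dd + 3)) => // [f hf|f5 h5 e5].
    by split; ev; frm.
  apply: wp_seq; apply: (@wp_mul _ _ _ n n) => // [f hf|f6 h6 e6].
    by split; ev; frm.
  rewrite /= in h5 h6.
  apply: wp_seq; apply: (@wp_mul _ _ _ E E) => // [f hf|f7 h7 e7].
    by rewrite /= in hf; split; ev; frm; rewrite e1.
  rewrite /= in h7.
  apply: wp_seq; apply: (@wp_mul _ _ _ (n * n) (E * E)) => // [f hf|f8 h8 e8].
    by rewrite /= in hf; split; ev; frm; rewrite ?e6 ?e7.
  rewrite /= in h8.
  apply: wp_seq; apply: (wp_setv n0 hA0 (x := (D0 + D0)%N)); [by []|by ev; rewrite /= e8|].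
  apply: wp_seq; putv (D0 + D0 + (D0 + D0))%N.
  apply: wp_seq; apply: (wp_setv n0 hA0 (x := D)); [by []|by ev; rewrite /= /D -/D0; lia|].
  apply: wp_seq; apply: (@wp_mul _ _ _ D D) => // [f hf|f9 h9 e9].
    by rewrite /= in hf; split; ev; frm.
  rewrite /= in h9.
  apply: wp_seq; apply: (@wp_mul _ _ _ (D * D) h) => // [f hf|f10 h10 e10].
    by rewrite /= in hf; split; ev; frm; rewrite ?e9 ?e3.
  rewrite /= in h10.
  apply: wp_seq; apply: (@wp_mul _ _ _ (D * D * h) t) => // [f hf|f11 h11 e11].
    by rewrite /= in hf; split; ev; frm; rewrite ?e10 ?e5.
  rewrite /= in h11.
  apply: wp_seq; apply: (@wp_mul _ _ _ 600 (D * D * h * t)) => // [f hf|f12 h12 e12].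
    by rewrite /= in hf; split; ev; frm; rewrite ?e11.
  rewrite /= in h12.
  apply: (wp_setv n0 hA0 (x := dd.+1)); [by []|by ev; frm; rewrite addn1|].
  apply: fin => //.
  - apply: frame_put => //.
    apply: (frame_trans _ _ h12); first by apply/allP.
    apply: (frame_trans _ _ h11); first by apply/allP.
    apply: (frame_trans _ _ h10); first by apply/allP.
    apply: (frame_trans _ _ h9); first by apply/allP.
    do 3 (apply: frame_put => //).
    apply: (frame_trans _ _ h8); first by apply/allP.
    apply: (frame_trans _ _ h7); first by apply/allP.
    apply: (frame_trans _ _ h6); first by apply/allP.
    apply: (frame_trans _ _ h5); first by apply/allP.
    apply: (frame_trans _ _ h4); first by apply/allP.
    apply: (frame_trans _ _ h3); first by apply/allP.
    apply: (frame_trans _ _ h2); first by apply/allP.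
    apply: (frame_trans _ _ h1); first by apply/allP.
    by apply: frame_put.
  - by split; frm; rewrite ?e1 ?e2 ?e3 ?e4 ?e5 ?e12.
case: (leqP d n) => hdn.
  apply: (wp_setv n0 hA0 (x := d)); [by []|by ev|].
  move: next; rewrite (_ : put (va a) vdd dd = put (va a) vdd d) //.
  by rewrite /dd (minn_idPl hdn).
apply: (wp_setv n0 hA0 (x := n)); [by []|by ev|].
move: next; rewrite (_ : put (va a) vdd dd = put (va a) vdd n) //.
by rewrite /dd (minn_idPr (ltnW hdn)).
Qed.
End SetupSpec.

(** * Simulating a Bayes net from coin tosses *)

Section FixedPoint.
Variables (R : realFieldType) (n : nat) (S : rel 'I_n) (theta : 'I_n -> nat -> R).
Implicit Types (U : 'I_n -> R) (x y : n.-tuple bool).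

(** Each step halves what came before, so the last coin carries the largest weight. For [k] fair
    coins the value is uniform on the multiples of [2 ^- k] in [[0, 1)]. *)
Definition unif (bs : seq bool) : R := foldl (fun u (b : bool) => (u + b%:R) / 2) 0 bs.

(** All nodes are updated in parallel from the old values of their parents. The sample is the fixed
    point of this map, which is meaningful without a topological order at hand. *)
Definition sample_step U x : n.-tuple bool :=
  [tuple U i < theta i (parent_code S i x) | i < n].

Definition sample_of U : n.-tuple bool := iter n (sample_step U) [tuple false | i < n].

Definition coin_sample (kc : nat) (cs : seq bool) : n.-tuple bool :=
  sample_of (fun i => unif (take kc (drop (i * kc) cs))).

Fixpoint coin_samples (kc N : nat) (cs : seq bool) : seq (n.-tuple bool) :=
  if N is N'.+1 then coin_sample kc cs :: coin_samples kc N' (drop (n * kc) cs) else [::].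

Lemma eq_parent_code i x y : (forall j, S j i -> tnth x j = tnth y j) ->
  parent_code S i x = parent_code S i y.
Proof. by move=> h; apply: eq_bigr => j; rewrite inE => /h ->. Qed.

Variable s : 'S_n.
Hypothesis top : topological S s.

Lemma sample_step_local U r x y :
  (forall j, (s j < r)%N -> tnth x j = tnth y j) ->
  forall i, (s i <= r)%N -> tnth (sample_step U x) i = tnth (sample_step U y) i.
Proof.
move=> h i ir; rewrite !tnth_mktuple; congr (_ < theta i _).
by apply: eq_parent_code => j /top ji; apply: h; apply: leq_trans ir.
Qed.

Lemma sample_ofP U : sample_step U (sample_of U) = sample_of U.
Proof.
suff h r x : (r <= n)%N -> forall i, (s i < r)%N ->
    tnth (sample_step U (iter r (sample_step U) x)) i = tnth (iter r (sample_step U) x) i.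
  by apply: eq_from_tnth => i; apply: h => //; apply: ltn_ord.
elim: r => [|r IH] rn i //; rewrite ltnS => ir.
by apply: (@sample_step_local U r) ir; apply: IH; apply: ltnW.
Qed.

Lemma sample_step_unique U x y : sample_step U x = x -> sample_step U y = y -> x = y.
Proof.
move=> hx hy; suff h r i : (s i < r)%N -> tnth x i = tnth y i.
  by apply: eq_from_tnth => i; apply: (h n).
elim: r i => [|r IH] i //; rewrite ltnS => ir.
by rewrite -hx -hy; apply: (@sample_step_local U r).
Qed.

(** This removes the iteration: the event of a given outcome becomes one condition on each [U i],
    and these are independent when the [U i] are. *)
Lemma sample_of_eq U x : (sample_of U == x) = [forall i, (U i < theta i (parent_code S i x)) == tnth x i].
Proof.
apply/eqP/forallP => [<- i|h].
  by rewrite -{2}(sample_ofP U) tnth_mktuple.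
apply: (@sample_step_unique U); first exact: sample_ofP.
by apply: eq_from_tnth => i; rewrite tnth_mktuple; apply/eqP.
Qed.

End FixedPoint.

Notation vq := 35%N (only parsing).
Notation vrow := 36%N (only parsing).
Notation voff := 37%N (only parsing).
Notation vcode := 38%N (only parsing).
Notation vpow := 39%N (only parsing).

Definition DrawUniforms : cmd :=
  For vmi Nn
    (CSeq (SetRr (Va vmi) (RNat (NNum 0)))
    (For vs1 (Va vkc)
       (CSeq (CoinV vs2)
         (SetRr (Va vmi) (RMul (RAdd (Rr (Va vmi)) (RNat (Va vs2))) (RInv (RNat (NNum 2)))))))).

(** The diagonal cells of the matrix hold program variables, so the node itself has to be masked
    when its row is read. *)
Definition ParentCode : cmd :=
  CSeq (SetV vcode (NNum 0)) (CSeq (SetV vpow (NNum 1))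
  (For vs1 Nn
    (CIf (BAnd (BNot (EqN (Va vmi) (Va vs1))) (BLeN (NNum 1) (Mat (NAdd (Va vrow) (Va vs1)))))
       (CSeq (CIf (BLeN (NNum 1) (Ar (NAdd (Va vptr) (Va vs1))))
                  (SetV vcode (NAdd (Va vcode) (Va vpow))) CSkip)
             (SetV vpow (NAdd (Va vpow) (Va vpow))))
       CSkip))).

Definition Pass : cmd :=
  CSeq (SetV vrow (NNum 0)) (CSeq (SetV voff (NNum 0))
  (For vmi Nn
    (CSeq ParentCode
    (CSeq (CIf (BLeR (Tab (NAdd (Va voff) (Va vcode))) (Rr (Va vmi)))
               (SetA (NAdd (Va vptr) (Va vmi)) (NNum 0))
               (SetA (NAdd (Va vptr) (Va vmi)) (NNum 1)))
    (CSeq (SetV vrow (NAdd (Va vrow) Nn)) (SetV voff (NAdd (Va voff) (Va vst)))))))).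

Definition Clear : cmd := For vmi Nn (SetA (NAdd (Va vptr) (Va vmi)) (NNum 0)).

(* After r passes the nodes at the first r positions of any topological order have
   their final values, so n passes compute the fixed point without sorting. *)
Definition Simulate : cmd :=
  CSeq DrawUniforms (CSeq Clear
    (CSeq (For vq Nn Pass) (SetV vptr (NAdd (Va vptr) Nn)))).

Section SimulateSpec.
Variable R : realFieldType.
Variables (n d A0 RB : nat) (mt : nat -> nat -> bool) (eps : R) (tab : nat -> R).
Hypotheses (n0 : (0 < n)%N) (hA0 : (2 + (n + num_vars) * n.+1 <= A0)%N) (hRB : (0 < RB)%N).
Local Notation wp := (wp n d A0 RB mt eps tab).
Local Notation evn := (evn n d A0 RB mt eps tab).
Local Notation evb := (evb n d A0 RB mt eps tab).
Implicit Types (a : ast R).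

Variables (S : rel 'I_n) (theta : 'I_n -> nat -> R) (s : 'S_n) (kc st : nat).
Hypothesis top : topological S s.
Hypothesis hmt : forall i j : 'I_n, mt i j = S j i.
Hypothesis htab : forall (i : 'I_n) (x : n.-tuple bool),
  ((i * st + parent_code S i x).+1 < RB)%N /\
  tab (i * st + parent_code S i x)%N = theta i (parent_code S i x).

Definition sim_par (f : nat -> nat) : Prop :=
  [/\ f 0%N = A0, f 1%N = RB, f vkc = kc & f vst = st].

Lemma wp_uniforms cs a (Phi : ast R -> Prop) : sim_par (va a) -> co a = cs ->
  (n * kc <= size cs)%N ->
  (forall f g, frame [:: vmi; vs1; vs2] (va a) f ->
     (forall i, (i < n)%N -> g i = unif R (take kc (drop (i * kc) cs))) ->
     Phi (wco (wrv (wva a f) g) (drop (n * kc) cs))) ->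
  wp DrawUniforms (n * (kc * 6 + 8) + 3) Phi a.
Proof.
move=> [h0 h1 hkc hst] hco hsz ph.
apply: (wp_le (t := (n * (kc * 6 + 5).+3 + 3))); first by lia.
apply: (wp_for n0 hA0 hRB (cnt := n) (tb := (kc * 6 + 5)%N) (I := fun i b => exists f g,
  [/\ b = wco (wrv (wva a f) g) (drop (i * kc) cs), frame [:: vmi; vs1; vs2] (va a) f &
     (forall k, (k < i)%N -> g k = unif R (take kc (drop (k * kc) cs)))])) => //.
- exists (put (va a) vmi 0%N), (rv a); split=> //; last exact: frame_put.
  by rewrite mul0n drop0 -hco.
- by move=> i b _ _ [f [g [-> hf _]]]; ev.
- move=> i b iltn ei [f [g [eb hf hg]]]; subst b; rewrite /= in ei.
  apply: (wp_le (t := (1 + (kc * 3.+3 + 3)).+1)); first by lia.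
  apply: wp_seq; apply: (wp_setr hRB (i := i) (x := 0)); [by frm|by ev|by ev|].
  set ch := drop (i * kc) cs.
  have sch : (kc <= size ch)%N.
    rewrite /ch size_drop; apply: leq_trans (leq_sub2r _ hsz).
    by rewrite -mulnBl leq_pmull // subn_gt0.
  apply: (wp_for n0 hA0 hRB (cnt := kc) (tb := 3) (I := fun j b => exists f1 g1,
    [/\ b = wco (wrv (wva a f1) g1) (drop j ch), frame [:: vmi; vs1; vs2] (va a) f1,
       f1 vmi = i, g1 i = unif R (take j ch) &
       (forall k, (k < i)%N -> g1 k = unif R (take kc (drop (k * kc) cs)))])) => //.
  + exists (put f vs1 0%N), (put g i 0); split=> //.
    * by rewrite drop0.
    * exact: frame_put.
    * by rewrite take0 put_same.
    * by move=> k ki; rewrite put_other ?hg //; lia.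
  + by move=> j b _ _ [f1 [g1 [-> hf1 _ _ _]]]; ev; frm; rewrite hkc.
  + move=> j b jk ej [f1 [g1 [eb hf1 e1 e2 hg1]]]; subst b; rewrite /= in ej.
    apply: (wp_le (t := (1 + 1).+1)) => //.
    have jc : (j < size ch)%N by apply: leq_trans sch.
    have hc : co (wco (wrv (wva a f1) g1) (drop j ch)) = nth false ch j :: drop j.+1 ch.
      by rewrite /= (drop_nth false jc).
    apply: wp_seq; apply: (wp_coin _ _ _ _ _ n0 hA0 _ hc) => //.
    apply: (wp_setr hRB (i := i) (x := (g1 i + (nth false ch j)%:R) / 2)).
    * by frm.
    * by ev; rewrite /= e1.
    * by move=> s' hs; evs s' hs; rewrite /= e1.
    split; first by [].
    exists (put (put f1 vs2 (nth false ch j)) vs1 j.+1), (put g1 i ((g1 i + (nth false ch j)%:R) / 2)).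
    split=> //.
    * by do 2 (apply: frame_put => //).
    * by rewrite put_same (take_nth false) // /unif foldl_rcons e2.
    * by move=> k ki; rewrite put_other ?hg1 //; lia.
  + move=> b _ [f1 [g1 [-> hf1 e1 e2 hg1]]]; split; first by [].
    exists (put f1 vmi i.+1), g1; split=> //.
    * by rewrite mulSn addnC -drop_drop drop_drop addnC -drop_drop.
    * exact: frame_put.
    * by move=> k; rewrite ltnS leq_eqVlt => /orP[/eqP ->|/hg1 //]; rewrite e2.
- by move=> b _ [f [g [-> hf hg]]]; apply: ph.
Qed.

Lemma wp_parent_code (i : 'I_n) (x : n.-tuple bool) a (Phi : ast R -> Prop) :
  va a 0 = A0 -> va a vmi = i -> va a vrow = (i * n)%N -> ~~ S i i ->
  (forall j : 'I_n, S j i -> ar a (va a vptr + j)%N = tnth x j) ->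
  (forall f, frame [:: vs1; vcode; vpow] (va a) f -> f vcode = parent_code S i x ->
     Phi (wva a f)) ->
  wp ParentCode (n * 8 + 7) Phi a.
Proof.
move=> h0 hi hrow Sii hx ph.
apply: (wp_le (t := (1 + (1 + (n * 5.+3 + 3)).+1).+1)); first by lia.
apply: wp_seq; putv 0%N.
apply: wp_seq; putv 1%N.
pose pa k := [set j in parents S i | (j < k)%N].
pose pc k := (\sum_(j in pa k) tnth x j * 2 ^ #|pa j|)%N.
have pn : pa n = parents S i.
  by apply/setP => j; rewrite !inE ltn_ord andbT.
have paS (k : 'I_n) : pa k.+1 = if S k i then k |: pa k else pa k.
  apply/setP => j; rewrite !inE ltnS leq_eqVlt val_eqE.
  have [->|ne] /= := eqVneq j k.
    by case: (boolP (S k i)) => /= h; rewrite !inE ?eqxx // (negPf h).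
  by case: (S k i); rewrite !inE ?(negPf ne).
have kN (k : 'I_n) : k \notin pa k by rewrite inE ltnn andbF.
apply: (wp_for n0 hA0 hRB (cnt := n) (tb := 5) (I := fun k b => exists f,
  [/\ b = wva a f, frame [:: vs1; vcode; vpow] (va a) f,
      f vcode = pc k & f vpow = 2 ^ #|pa k|]%N)) => //.
- have e0 : pa 0%N = set0 by apply/setP => j; rewrite !inE andbF.
  exists (put (put (put (va a) vcode 0%N) vpow 1%N) vs1 0%N); split=> //.
  + by do 3 (apply: frame_put => //).
  + by rewrite /pc e0 big_set0.
  + by rewrite e0 cards0.
- by move=> k b _ _ [f [-> hf _ _]]; ev.
- move=> k0 b kn ek [f [eb hf e1 e2]]; subst b; rewrite /= in ek.
  pose k := Ordinal kn; have ekk : k0 = k by []; rewrite ekk in ek e1 e2 *.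
  have hb : evb (wva a f) (BAnd (BNot (EqN (Va vmi) (Va vs1)))
      (BLeN (NNum 1) (Mat (NAdd (Va vrow) (Va vs1))))) (S k i).
    move=> s' hs; rewrite /EqN; evs s' hs; frm; rewrite hi ek.
    rewrite -eqn_leq; have [e|ne] := eqVneq (i : nat) k.
      by have -> : k = i by [apply: val_inj]; rewrite (negPf Sii).
    rewrite /= (ev_mat (i := i) (j := k) hs) //.
    - by rewrite hmt; case: (S k i).
    - exact/eqP.
    - by evs s' hs; frm; rewrite hrow ek.
  apply: (wp_if hb).
  have pcS : pc k.+1 = if S k i then (pc k + tnth x k * 2 ^ #|pa k|)%N else pc k.
    rewrite /pc paS; case: (S k i) => //; rewrite big_setU1 //= addnC.
    by [].
  have pwS : (#|pa k.+1| = S k i + #|pa k|)%N.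
    by rewrite paS; case: (S k i) => //; rewrite cardsU1 kN.
  case: (boolP (S k i)) pcS pwS => Ski pcS pwS; last first.
    apply: (wp_le (t := 1)) => //; apply: wp_skip.
    split; first by []. exists (put f vs1 k.+1); split=> //.
    + exact: frame_put.
    + by rewrite /= pcS.
    + by rewrite /= pwS.
  apply: (wp_le (t := (2 + 1).+1)) => //.
  have hb2 : evb (wva a f) (BLeN (NNum 1) (Ar (NAdd (Va vptr) (Va vs1)))) (tnth x k).
    by ev; frm; rewrite ek hx //; case: (tnth x k).
  apply: wp_seq; apply: (wp_if hb2).
  case: (tnth x k) pcS => pcS.
    putv (f vcode + f vpow)%N; putv (f vpow + f vpow)%N; split; first by [].
    exists (put (put (put f vcode (f vcode + f vpow)%N) vpow (f vpow + f vpow)%N) vs1 k.+1); split=> //.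
    + by do 3 (apply: frame_put => //).
    + by rewrite /= e1 e2 pcS mul1n.
    + by rewrite /= e2 pwS expnS mul2n addnn.
  apply: wp_skip; putv (f vpow + f vpow)%N; split; first by [].
  exists (put (put f vpow (f vpow + f vpow)%N) vs1 k.+1); split=> //.
  + by do 2 (apply: frame_put => //).
  + by rewrite /= e1 pcS addn0.
  + by rewrite /= e2 pwS expnS mul2n addnn.
- move=> b _ [f [-> hf e1 _]]; apply: ph => //.
  rewrite e1 /pc pn; apply: eq_bigr => j _; congr (_ * 2 ^ #|_|)%N.
Qed.

Lemma wp_clear a (Phi : ast R -> Prop) : va a 0 = A0 ->
  (forall f g, frame [:: vmi] (va a) f -> (forall q, (q < va a vptr)%N -> g q = ar a q) ->
     (forall j, (j < n)%N -> g (va a vptr + j)%N = 0%N) -> Phi (war (wva a f) g)) ->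
  wp Clear (n * 4 + 3) Phi a.
Proof.
move=> h0 ph.
apply: (wp_for n0 hA0 hRB (cnt := n) (tb := 1) (I := fun i b => exists f g,
  [/\ b = war (wva a f) g, frame [:: vmi] (va a) f,
     (forall q, q < va a vptr -> g q = ar a q) &
     (forall j, j < i -> g (va a vptr + j) = 0)]%N)) => //.
- by exists (put (va a) vmi 0%N), (ar a); split=> //; exact: frame_put.
- by move=> i b _ _ [f [g [-> hf _ _]]]; ev.
- move=> i b iltn ei [f [g [eb hf hlow h]]]; subst b; rewrite /= in ei.
  apply: (wp_seta hA0 (i := (va a vptr + i)%N) (x := 0%N)).
  + by frm.
  + by ev; frm; rewrite ei.
  + by ev.
  split; first by [].
  exists (put f vmi i.+1), (put g (va a vptr + i)%N 0%N); split=> //.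
  + exact: frame_put.
  + by move=> q hq; rewrite put_other ?hlow //; lia.
  + move=> j; rewrite ltnS leq_eqVlt => /orP[/eqP ->|ji]; first by rewrite put_same.
    by rewrite put_other ?h //; lia.
- by move=> b _ [f [g [-> hf hlow h]]]; apply: ph.
Qed.

Definition pass_vars : seq nat := [:: vmi; vs1; vcode; vpow; vrow; voff].

(** Unlike [sample_step], a pass works in place, so a node may see old and new values of its parents
    mixed. This is harmless: a node at a position up to [r] reads only positions before [r], whose
    values are already final and do not change when recomputed. *)
Lemma wp_pass U r (x : n.-tuple bool) a (Phi : ast R -> Prop) : sim_par (va a) -> (forall i, ~~ S i i) ->
  let sol := sample_of S theta U in
  (forall i : 'I_n, rv a i = U i) ->
  (forall j : 'I_n, ar a (va a vptr + j)%N = tnth x j) ->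
  (forall j : 'I_n, (s j < r)%N -> tnth x j = tnth sol j) ->
  (forall f g (y : n.-tuple bool), frame pass_vars (va a) f ->
     (forall q, (q < va a vptr)%N -> g q = ar a q) ->
     (forall j : 'I_n, g (va a vptr + j)%N = tnth y j) ->
     (forall j : 'I_n, (s j < r.+1)%N -> tnth y j = tnth sol j) ->
     Phi (war (wva a f) g)) ->
  wp Pass (n * (n * 8 + 17) + 7) Phi a.
Proof.
move=> [h0 h1 hkc hst] irr sol hU hx hsol ph.
apply: (wp_le (t := (1 + (1 + (n * (n * 8 + 14).+3 + 3)).+1).+1)); first by lia.
apply: wp_seq; putv 0%N.
apply: wp_seq; putv 0%N.
apply: (wp_for n0 hA0 hRB (cnt := n) (tb := (n * 8 + 14)%N) (I := fun i b => exists f g (y : n.-tuple bool),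
  [/\ b = war (wva a f) g /\ frame pass_vars (va a) f,
     f vrow = i * n /\ f voff = i * st,
     (forall q, q < va a vptr -> g q = ar a q),
     (forall j : 'I_n, g (va a vptr + j) = tnth y j) &
     (forall j : 'I_n, (s j < r) || ((s j <= r) && (j < i)) -> tnth y j = tnth sol j)]%N)) => //.
- exists (put (put (put (va a) vrow 0%N) voff 0%N) vmi 0%N), (ar a), x; split=> //.
  + by split=> //; do 3 (apply: frame_put => //).
  + by move=> j; rewrite andbF orbF; apply: hsol.
- by move=> i b _ _ [f [g [y [[-> hf] _ _ _ _]]]]; ev.
- move=> i0 b iltn ei [f [g [y [[eb hf] [er eo] hlow hy hs]]]]; subst b; rewrite /= in ei.
  pose i := Ordinal iltn; have eii : i0 = i by []; rewrite eii in ei er eo hs *.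
  apply: (wp_le (t := ((n * 8 + 7) + (1.+1 + (1 + 1).+1).+1).+1)); first by lia.
  apply: wp_seq; apply: (@wp_parent_code i y) => //=; first by frm.
    by move=> j _; frm; apply: hy.
  move=> f1 hf1 e1; rewrite /= in hf1.
  have [hb1 hb2] := htab i y.
  apply: wp_seq.
  have hb : evb (wva (war (wva a f) g) f1) (BLeR (Tab (NAdd (Va voff) (Va vcode))) (Rr (Va vmi)))
      (theta i (parent_code S i y) <= U i).
    move=> s' hs'; evs s' hs'; rewrite (ev_tab (k := (i * st + parent_code S i y)%N) hs') //.
      by frm; rewrite ei hU hb2.
    by evs s' hs'; frm; rewrite e1 eo.
  apply: (wp_if hb).
  pose v := U i < theta i (parent_code S i y).
  pose y' : n.-tuple bool := [tuple if j == i then v else tnth y j | j < n].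
  have fin : wp (CSeq (SetV vrow (NAdd (Va vrow) Nn)) (SetV voff (NAdd (Va voff) (Va vst)))) (1 + 1).+1
     (fun b => va b vmi = i /\ exists f g (y : n.-tuple bool),
  [/\ setv b vmi i.+1 = war (wva a f) g /\ frame pass_vars (va a) f,
     f vrow = i.+1 * n /\ f voff = i.+1 * st,
     (forall q, q < va a vptr -> g q = ar a q),
     (forall j : 'I_n, g (va a vptr + j) = tnth y j) &
     (forall j : 'I_n, (s j < r) || ((s j <= r) && (j < i.+1)) -> tnth y j = tnth sol j)]%N)
     (war (wva a f1) (put g (va a vptr + i)%N v)).
    apply: wp_seq; putv (f1 vrow + n)%N.
    apply: (wp_setv n0 hA0 (x := (f1 voff + st)%N)); [by []|by ev; frm; rewrite hst|].
    split; first by frm.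
    exists (put (put (put f1 vrow (f1 vrow + n)%N) voff (f1 voff + st)%N) vmi i.+1),
       (put g (va a vptr + i)%N v), y'; split.
    - split=> //; do 3 (apply: frame_put => //).
      by apply: (frame_trans _ hf hf1); apply/allP.
    - by split; frm; rewrite ?er ?eo mulSn addnC.
    - by move=> q hq; rewrite put_other ?hlow //; lia.
    - move=> j; rewrite tnth_mktuple; case: eqVneq => [->|ne]; first by rewrite put_same.
      by rewrite put_other ?hy // eqn_add2l.
    - move=> j hj; rewrite tnth_mktuple; case: eqVneq => [ej|ne]; last first.
        apply: hs; case/orP: hj => [->//|/andP[-> ji]]; apply/orP; right.
        by rewrite ltnS leq_eqVlt val_eqE (negPf ne) in ji.
      have sr : (s i <= r)%N by case/orP: hj => [/ltnW|/andP[]]; rewrite ej.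
      rewrite ej /v /sol -(sample_ofP theta top) tnth_mktuple; congr (_ < theta i _).
      apply: eq_parent_code => k /top ki; apply: hs; apply/orP; left.
      exact: leq_trans ki sr.
  have setbit (c : bool) : v = c -> wp (SetA (NAdd (Va vptr) (Va vmi)) (NNum c)) 1
     (wp (CSeq (SetV vrow (NAdd (Va vrow) Nn)) (SetV voff (NAdd (Va voff) (Va vst)))) (1 + 1).+1
     (fun b => va b vmi = i /\ exists f g (y : n.-tuple bool),
  [/\ setv b vmi i.+1 = war (wva a f) g /\ frame pass_vars (va a) f,
     f vrow = i.+1 * n /\ f voff = i.+1 * st,
     (forall q, q < va a vptr -> g q = ar a q),
     (forall j : 'I_n, g (va a vptr + j) = tnth y j) &
     (forall j : 'I_n, (s j < r) || ((s j <= r) && (j < i.+1)) -> tnth y j = tnth sol j)]%N))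
     (wva (war (wva a f) g) f1).
    move=> ec; apply: (wp_seta hA0 (i := (va a vptr + i)%N) (x := c)).
    - by frm.
    - by ev; frm; rewrite ei.
    - by ev.
    by rewrite -ec.
  rewrite leNgt -/v; case: (boolP v) => hv /=.
    exact: (setbit true).
  exact: (setbit false (negbTE hv)).
- move=> b _ [f [g [y [[-> hf] _ hlow hy hs]]]]; apply: (ph f g y) => // j.
  by rewrite ltnS => jr; apply: hs; rewrite jr ltn_ord orbT.
Qed.

Lemma wp_passes U a (Phi : ast R -> Prop) : sim_par (va a) -> (forall i, ~~ S i i) ->
  let sol := sample_of S theta U in
  (forall i : 'I_n, rv a i = U i) ->
  (forall j, (j < n)%N -> ar a (va a vptr + j)%N = 0%N) ->
  (forall f g, frame (vq :: pass_vars) (va a) f ->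
     (forall q, (q < va a vptr)%N -> g q = ar a q) ->
     (forall j : 'I_n, g (va a vptr + j)%N = tnth sol j) ->
     Phi (war (wva a f) g)) ->
  wp (For vq Nn Pass) (n * (n * (n * 8 + 17) + 10) + 3) Phi a.
Proof.
move=> hsim irr sol hU hz ph.
apply: (wp_le (t := (n * (n * (n * 8 + 17) + 7).+3 + 3))); first by lia.
apply: (wp_for n0 hA0 hRB (cnt := n) (tb := (n * (n * 8 + 17) + 7)%N) (I := fun r b => exists f g (y : n.-tuple bool),
  [/\ b = war (wva a f) g, frame (vq :: pass_vars) (va a) f,
     (forall q, q < va a vptr -> g q = ar a q),
     (forall j : 'I_n, g (va a vptr + j) = tnth y j) &
     (forall j : 'I_n, (s j < r) -> tnth y j = tnth sol j)]%N)) => //.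
- exists (put (va a) vq 0%N), (ar a), [tuple false | j < n]; split=> //; first exact: frame_put.
  by move=> j; rewrite tnth_mktuple hz.
- by move=> r b _ _ [f [g [y [-> hf _ _ _]]]]; ev.
- move=> r b rn er [f [g [y [eb hf hlow hy hs]]]]; subst b; rewrite /= in er.
  have ep : f vptr = va a vptr by frm.
  apply: (@wp_pass U r y) => //.
  + by case: hsim => *; split; frm.
  + by move=> j; rewrite /= ep.
  move=> f1 g1 y1 hf1 hl1 hy1 hs1; rewrite /= ep in hf1 hl1 hy1.
  split; first by frm.
  exists (put f1 vq r.+1), g1, y1; split=> //.
  + by apply: frame_put => //; apply: (frame_trans _ hf hf1); apply/allP.
  + by move=> q hq; rewrite hl1 // hlow.
- move=> b _ [f [g [y [-> hf hlow hy hs]]]]; apply: ph => // j.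
  by rewrite hy hs.
Qed.

Definition time_simulate : nat := (n * (kc * 6 + 12) + n * (n * (n * 8 + 17) + 10) + 13)%N.

Lemma wp_simulate cs a (Phi : ast R -> Prop) : sim_par (va a) -> (forall i, ~~ S i i) ->
  co a = cs -> (n * kc <= size cs)%N ->
  (forall b, co b = drop (n * kc) cs -> sa b = sa a -> frame getter_vars (va a) (va b) ->
     va b vptr = (va a vptr + n)%N -> (forall p, (p < va a vptr)%N -> ar b p = ar a p) ->
     (forall j, (j < n)%N ->
        ar b (va a vptr + j)%N = nth false (coin_sample S theta kc cs) j) -> Phi b) ->
  wp Simulate time_simulate Phi a.
Proof.
move=> hsim irr hco hsz ph; have [h0 h1 hkc hst] := hsim.
apply: (wp_le (t := ((n * (kc * 6 + 8) + 3) + ((n * 4 + 3) +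
  ((n * (n * (n * 8 + 17) + 10) + 3) + 1).+1).+1).+1)); first by rewrite /time_simulate; lia.
apply: wp_seq; apply: (wp_uniforms hsim hco hsz) => f g hf hg.
apply: wp_seq; apply: wp_clear; first by frm.
move=> f1 g1 hf1 hl1 hz1; rewrite /= in hf1 hl1 hz1.
have ep1 : f vptr = va a vptr by frm.
rewrite ep1 in hl1 hz1.
have ep : f1 vptr = va a vptr by frm.
apply: wp_seq; apply: (@wp_passes (fun i => unif R (take kc (drop (i * kc) cs)))) => //.
- by split; frm.
- by move=> i; rewrite /= hg.
- by move=> j jn; rewrite /= ep hz1.
move=> f2 g2 hf2 hl2 hy2; rewrite /= ep in hf2 hl2 hy2.
apply: (wp_setv n0 hA0 (x := (va a vptr + n)%N)); [by []|by ev; frm|].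
apply: ph => //.
- apply: frame_put => //.
  apply: (frame_trans _ _ hf2); first by apply/allP.
  apply: (frame_trans _ _ hf1); first by apply/allP.
  by apply: (frame_sub _ hf); apply/allP.
- by move=> q hq; rewrite /= hl2 // hl1.
- by move=> j jn; rewrite /= (hy2 (Ordinal jn)) (tnth_nth false).
Qed.

End SimulateSpec.

(** The answer overwrites cell 0, which holds [n] and enters every variable address; hence it is
    written last. *)
Definition Finish (c : cmd) : cmd := CSeq c (CSetN (NNum 0) (Va vans)).

Definition ClosenessMain : cmd :=
  CSeq SetupBase (CSeq (SetV 1 (NNum 1))
  (CSeq (SetupCommon (SetupH Quadruple 3) (SetV vm1 (Va vh)))
  (CSeq (FillBlocks (CSeq (CDraw false) (GetSample true)) (GetSample false) (GetSample true))
        Tester))).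

Definition SetupStride : cmd :=
  CSeq (SetV vst (NNum 1))
  (CSeq (CIf (BLeN (NNum 2) Nn) (For vmi Dn (SetV vst (NAdd (Va vst) (Va vst)))) CSkip)
  (CSeq (Mul 1 Nn (Va vst)) (SetV 1 (NAdd (Va 1) (NNum 1))))).

(** The number of digits is linear in [n] times the number of simulated samples. This exceeds the
    logarithm that the error requires and is computed by multiplications alone. *)
Definition SetupKc : cmd :=
  CSeq (Mul vs1 (Va vt) (NAdd (NAdd (Va vm1) (Va vm)) (Va vm)))
  (CSeq (Mul vs2 (Va vs1) Nn) (SetV vkc (NAdd (Va vs2) (NNum 5)))).

Definition IdentityMain : cmd :=
  CSeq SetupBase (CSeq SetupStride
  (CSeq (SetupCommon (SetupH Double 2) (Mul vm1 (Va vh) (Va vh)))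
  (CSeq SetupKc
  (CSeq (FillBlocks Simulate (GetSample false) Simulate) Tester)))).

Lemma size_interleave T m1 m o t (xs ys : seq T) :
  size xs = (t * (o + m + m))%N -> size ys = (t * (m1 + m + m))%N ->
  size (interleave m1 m o t xs ys) = (t * block_size m1 m)%N.
Proof.
elim: t xs ys => [|t IH] xs ys //=; rewrite !mulSn => hx hy.
rewrite !size_cat !size_takel ?size_drop; try lia.
by rewrite IH ?size_drop; try lia; rewrite /block_size; lia.
Qed.

Lemma size_coin_samples (R : realFieldType) n (S : rel 'I_n) (theta : 'I_n -> nat -> R) kc N cs :
  size (coin_samples S theta kc N cs) = N.
Proof. by elim: N cs => //= N IH cs; rewrite IH. Qed.

Section Programs.
Variable R : realFieldType.

Lemma iter_halted T (s : state R) : iter T (@step R) ([::], s) = ([::], s).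
Proof. by elim: T => //= T ->. Qed.

Section Common.
Variables (n d A0 RB : nat) (mt : nat -> nat -> bool) (eps : R) (tab : nat -> R).
Hypotheses (n0 : (0 < n)%N) (hRB : (0 < RB)%N) (eA0 : A0 = (2 + (n + num_vars) * n.+1)%N).
Local Notation wp := (wp n d A0 RB mt eps tab).
Implicit Types (a : ast R).

Let hA0 : (2 + (n + num_vars) * n.+1 <= A0)%N.
Proof. by rewrite eA0. Qed.

Lemma finish_run c tc (Post : nat -> ast R -> Prop) a s T :
  wp c tc (fun b => Post (va b vans) b) a -> rep n d A0 RB mt eps tab a s -> (tc + 2 <= T)%N ->
  exists b, let r := iter T (@step R) ([:: Finish c], s) in
    [/\ r.1 = [::], nmem r.2 0 = va b vans, samples r.2 = sa b & Post (va b vans) b].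
Proof.
move=> [b [t' [lt' hb h]]] hs hT; exists b => r.
have [s' hs' e'] := h s [:: CSetN (NNum 0) (Va vans)] hs.
have -> : r = ([::], State (upd (nmem s') 0 (va b vans)) (rmem s') (latest s') (coins s') (samples s')).
  rewrite /r (_ : T = ((T - t'.+2) + t'.+2)%N); last by lia.
  rewrite iterD iterS iterSr.
  have -> : step ([:: Finish c], s) = ([:: c; CSetN (NNum 0) (Va vans)], s) by [].
  by rewrite e' /= (ev_va hs') // iter_halted.
split=> //=.
by case: hs' => _ _ _ _ [].
Qed.

Definition initial (f : nat -> R) cs xs ys : ast R :=
  Ast (fun=> 0%N) (fun=> 0%N) f (fun=> [::]) cs (fun src : bool => if src then ys else xs).

Definition par_of dd E h m1 : (nat -> nat) -> Prop :=
  let t := (n * (dd + 3))%N in let D := (8 * (n * n * (E * E)))%N in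
  par A0 RB dd m1 (600 * (D * D * h * t)) t (2 ^ dd.+1) D.

Lemma par_frames dd E h m1 ms f g : all (leq 12) ms -> frame ms f g ->
  par_of dd E h m1 f -> par_of dd E h m1 g.
Proof. exact: par_frame. Qed.

Definition m_of dd E h : nat :=
  (600 * (8 * (n * n * (E * E)) * (8 * (n * n * (E * E))) * h * (n * (dd + 3))))%N.
Definition t_of dd : nat := (n * (dd + 3))%N.
Definition D_of E : nat := (8 * (n * n * (E * E)))%N.

Definition time_fill t m1 m tc : nat := (t * ((m1 + m * 4) * tc.+3 + 25) + 3)%N.

Definition time_closeness dd E h : nat :=
  ((n + num_vars) * 4 + time_setup n (divup dd 3 * 4 + 5) 1 dd E h (D_of E) +
   time_fill (t_of dd) h (m_of dd E h) (n * 6 + 9) +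
   time_tester n dd h (m_of dd E h) (t_of dd) (2 ^ dd.+1) + 20)%N.

Lemma par_of_frame dd E h m1 f g : (forall v, (v < 12)%N -> g v = f v) ->
  par_of dd E h m1 f -> par_of dd E h m1 g.
Proof. by move=> e [*]; split; rewrite e. Qed.

Lemma closeness_main E cs xs ys f :
  let dd := minn d n in let h := (4 ^ divup dd 3)%N in let m := m_of dd E h in
  let t := t_of dd in
  RB = 1%N -> (forall i : nat, (i%:R * eps <= 1) = (i < E)%N) ->
  size xs = (t * (h + m + m))%N -> size ys = (t * (h + m + m))%N ->
  wp ClosenessMain (time_closeness dd E h)
    (fun b => [/\ va b vans = decide R n dd h m t (2 ^ dd.+1) (D_of E) (interleave h m h t xs ys),
        sa b false = [::] & sa b true = [::]]) (initial f cs xs ys).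
Proof.
move=> dd h m t eRB hE sxs sys.
set tester := time_tester n dd h m t (2 ^ dd.+1).
set fill := time_fill t h m (n * 6 + 9).
set setup := time_setup n (divup dd 3 * 4 + 5) 1 dd E h (D_of E).
apply: (wp_le (t := (((n + num_vars) * 4 + 5) + (1 + (setup + (fill + tester).+1).+1).+1).+1)).
  by rewrite /time_closeness -/tester -/fill -/setup; lia.
apply: wp_seq; apply: wp_base => // f1 h1 e1; rewrite /= in h1.
apply: wp_seq; putv 1%N.
apply: wp_seq; apply: (@wp_common R n d A0 RB mt eps tab n0 hA0 hRB _ _ _ _ h h E) => //.
- move=> b Psi hb k; apply: (wp_h (q := 3) (b0 := 4) n0 hA0 hRB hb) => // g.
  by rewrite /Quadruple; ev; rewrite /=; lia.
- move=> b Psi hb k; putv h.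
  by apply: k => //; apply: frame_put.
move=> f2 h2 p2 ptr2; rewrite /= in h2.
have hp : par_of dd E h h f2.
  by case: p2 => *; split=> //; frm; rewrite ?e1 ?eA0 ?eRB.
apply: wp_seq.
apply: (@wp_fill_blocks R n d A0 RB mt eps tab n0 hA0 hRB (@on_tapes R) (par_of dd E h h) _ _ true h
   _ _ _ (n * 6 + 9) h m t xs ys) => //.
- by move=> g a b _ e [e1' e2']; split; rewrite -e.
- by move=> f' g' /par_of_frame; apply.
- by apply: (@get_skip_ok R n d A0 RB mt eps tab n0 hA0 hRB) => [f' []|] //; rewrite /time_get; lia.
- apply: (@getX_ok R n d A0 RB mt eps tab n0 hA0 hRB _ _ (fun ys a => sa a true = ys)).
  + by move=> f' [].
  + by rewrite /time_get; lia.
  + by move=> ys' a b _ ->.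
- by apply: (@get_true_ok R n d A0 RB mt eps tab n0 hA0 hRB) => [f' []|] //; rewrite /time_get; lia.
- by move=> f' [].
- by rewrite /= ptr2.
move=> b [sb1 sb2] hb hlow hst; rewrite /= ptr2 in hlow hst hb.
apply: (@wp_tester R n d A0 RB mt eps tab n0 hA0 hRB dd h m t (2 ^ dd.+1) (D_of E)
   (interleave h m h t xs ys)) => //.
- by apply: (par_frames _ hb hp).
- by rewrite expn_gt0.
- by apply: size_interleave.
Qed.

(* The stride of the table is not needed for a single node, where 2 ^ d steps
   would be too many. *)
Definition stride : nat := if (1 < n)%N then (2 ^ d)%N else 1%N.

Lemma wp_stride a (Phi : ast R -> Prop) :
  (forall f, frame [:: 1%N; vst; vmi] (va a) f -> f vst = stride -> f 1%N = (n * stride).+1 ->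
     Phi (wva a f)) ->
  wp SetupStride ((1 < n) * d * 4 + n * 4 + 20) Phi a.
Proof.
move=> fin.
apply: (wp_le (t := (1 + (((1 < n) * d * 4 + 3).+1 + ((n * 4 + 5) + 1).+1).+1).+1)); first by lia.
apply: wp_seq; putv 1%N.
apply: wp_seq.
have hb : evb n d A0 RB mt eps tab (setv a vst 1%N) (BLeN (NNum 2) Nn) (1 < n)%N by ev.
apply: (wp_if hb).
have next f : frame [:: vst; vmi] (va a) f -> f vst = stride ->
    wp (CSeq (Mul 1 Nn (Va vst)) (SetV 1 (NAdd (Va 1) (NNum 1)))) ((n * 4 + 5) + 1).+1 Phi (wva a f).
  move=> hf e; apply: wp_seq; apply: (@wp_mul _ _ _ _ _ _ _ _ n0 hA0 hRB _ _ _ n stride) => // [g hg|g hg eg].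
    by rewrite /= in hg; split; ev; frm; rewrite e.
  rewrite /= in hg; putv (g 1 + 1)%N; apply: fin.
  - by apply: frame_put => //; apply: (frame_trans _ (frame_sub _ hf) hg); apply/allP.
  - by frm.
  - by rewrite /= eg addn1.
rewrite /stride in next; case: (ltnP 1 n) next => n1 next; last first.
  apply: (wp_le (t := 1)) => //; apply: wp_skip; apply: next => //.
  exact: frame_put.
apply: (wp_le (t := (d * 1.+3 + 3))); first by lia.
apply: (wp_for n0 hA0 hRB (cnt := d) (tb := 1%N) (I := fun i b => exists f,
  [/\ b = wva a f, frame [:: vst; vmi] (va a) f & f vst = 2 ^ i]%N)) => //.
- exists (put (put (va a) vst 1%N) vmi 0%N); split=> //.
  by do 2 (apply: frame_put => //).
- by move=> i b _ _ [f [-> hf _]]; ev.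
- move=> i b ix ei [f [eb hf e]]; subst b.
  putv (f vst + f vst)%N; split; first by [].
  exists (put (put f vst (f vst + f vst)%N) vmi i.+1); split=> //.
    by do 2 (apply: frame_put => //).
  by rewrite /= e [in RHS]expnS mul2n addnn.
- by move=> b _ [f [-> hf e]]; apply: next.
Qed.

Definition kc_of dd E h m1 : nat := (t_of dd * (m1 + m_of dd E h + m_of dd E h) * n + 5)%N.

Lemma wp_kc dd E h m1 a (Phi : ast R -> Prop) : par_of dd E h m1 (va a) ->
  (forall f, frame [:: vkc; vmi; vs1; vs2] (va a) f -> f vkc = kc_of dd E h m1 -> Phi (wva a f)) ->
  wp SetupKc (t_of dd * 4 + t_of dd * (m1 + m_of dd E h + m_of dd E h) * 4 + 20) Phi a.
Proof.
move=> [p0 p1 p2 p3 p4 p5 p6 p7] fin.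
set x := (t_of dd * (m1 + m_of dd E h + m_of dd E h))%N.
apply: (wp_le (t := ((t_of dd * 4 + 5) + ((x * 4 + 5) + 1).+1).+1)); first by lia.
apply: wp_seq; apply: (@wp_mul _ _ _ _ _ _ _ _ n0 hA0 hRB _ _ _ (t_of dd) (m1 + m_of dd E h + m_of dd E h)) => // [g hg|g hg eg].
  by split; ev; frm; rewrite ?p5 ?p4 ?p3.
apply: wp_seq; apply: (@wp_mul _ _ _ _ _ _ _ _ n0 hA0 hRB _ _ _ x n) => // [g' hg'|g' hg' eg'].
  by rewrite /= in hg'; split; ev; frm; rewrite ?eg.
rewrite /= in hg'; putv (g' vs2 + 5)%N; apply: fin.
- by apply: frame_put => //; apply: (frame_trans _ (frame_sub _ hg) hg'); apply/allP.
- by rewrite /= eg'.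
Qed.

Section Identity.
Variables (S : rel 'I_n) (theta : 'I_n -> nat -> R) (s : 'S_n).
Hypothesis top : topological S s.
Hypothesis hmt : forall i j : 'I_n, mt i j = S j i.
Hypothesis htab : forall (i : 'I_n) (x : n.-tuple bool),
  ((i * stride + parent_code S i x).+1 < RB)%N /\
  tab (i * stride + parent_code S i x)%N = theta i (parent_code S i x).
Hypothesis irr : forall i, ~~ S i i.

(** The second tape is empty in the identity problem: the second list of the ghost consists of the
    samples that the coins to come will produce. *)
Definition on_coins kc (g : ghost) (a : ast R) : Prop :=
  sa a false = g.1 /\ (sa a true = [::] /\ exists2 N,
    g.2 = [seq tval x | x <- coin_samples S theta kc N (co a)] &
    (N * (n * kc) <= size (co a))%N).

Lemma simulate_ok kc st Pr tc : st = stride ->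
  (forall f, Pr f -> sim_par A0 RB kc st f) -> (time_simulate n kc <= tc)%N ->
  getter_ok n d A0 RB mt eps tab (on_coins kc) Pr trY Simulate tc.
Proof.
move=> est hPr htc a [xs ys] x [xs' ys'] Phi pa [/= h1 [h2 [N eN hN]]] [/= e1 e2] _ fin.
rewrite e2 in eN; case: N eN hN => [|N] //= [ex ey] hN.
have hle : (n * kc <= size (co a))%N by apply: leq_trans hN; rewrite mulSn leq_addr.
apply: (wp_le htc).
rewrite est in hPr.
apply: (@wp_simulate R n d A0 RB mt eps tab n0 hA0 hRB S theta s kc stride top hmt htab (co a)) => //.
  exact: hPr.
move=> b cb sb fb pb lb hb; apply: fin => //.
- split; rewrite sb -?e1 //; split=> //; exists N; rewrite cb //.
  by rewrite size_drop; move: hN; rewrite mulSn; lia.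
- by move=> j jn; rewrite hb // ex.
Qed.

Definition time_identity dd E h m1 : nat :=
  ((n + num_vars) * 4 + ((1 < n) * d * 4 + n * 4) +
   time_setup n (divup dd 2 * 4 + 5) (h * 4 + 5) dd E h (D_of E) +
   (t_of dd * 4 + t_of dd * (m1 + m_of dd E h + m_of dd E h) * 4) +
   time_fill (t_of dd) m1 (m_of dd E h) (time_simulate n (kc_of dd E h m1)) +
   time_tester n dd m1 (m_of dd E h) (t_of dd) (2 ^ dd.+1) + 60)%N.

Lemma identity_main E cs xs f :
  let dd := minn d n in let h := (2 ^ divup dd 2)%N in let m1 := (h * h)%N in
  let m := m_of dd E h in let t := t_of dd in let kc := kc_of dd E h m1 in
  let NQ := (t * (m1 + m + m))%N in
  RB = (n * stride).+1 -> (forall i : nat, (i%:R * eps <= 1) = (i < E)%N) ->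
  size xs = (t * (0 + m + m))%N -> (NQ * (n * kc) <= size cs)%N ->
  wp IdentityMain (time_identity dd E h m1)
    (fun b => [/\ va b vans = decide R n dd m1 m t (2 ^ dd.+1) (D_of E)
         (interleave m1 m 0 t xs [seq tval x | x <- coin_samples S theta kc NQ cs]),
        sa b false = [::] & sa b true = [::]]) (initial f cs xs [::]).
Proof.
move=> dd h m1 m t kc NQ eRB hE sxs scs.
set ys := [seq tval x | x <- coin_samples S theta kc NQ cs].
have sys : size ys = NQ.
  by rewrite size_map size_coin_samples.
set tester := time_tester n dd m1 m t (2 ^ dd.+1).
set fill := time_fill t m1 m (time_simulate n kc).
set setup := time_setup n (divup dd 2 * 4 + 5) (h * 4 + 5) dd E h (D_of E).
apply: (wp_le (t := (((n + num_vars) * 4 + 5) + (((1 < n) * d * 4 + n * 4 + 20) + (setup +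
   ((t_of dd * 4 + t_of dd * (m1 + m_of dd E h + m_of dd E h) * 4 + 20) + (fill + tester).+1).+1).+1).+1).+1)).
  by rewrite /time_identity -/tester -/fill -/setup; lia.
apply: wp_seq; apply: wp_base => // f1 h1 e1; rewrite /= in h1.
apply: wp_seq; apply: wp_stride => f2 h2 e2 e2'; rewrite /= in h2.
apply: wp_seq; apply: (@wp_common R n d A0 RB mt eps tab n0 hA0 hRB _ _ _ _ h m1 E) => //.
- move=> b Psi hb k; apply: (wp_h (q := 2) (b0 := 2) n0 hA0 hRB hb) => // g.
  by rewrite /Double; ev; rewrite /=; lia.
- move=> b Psi hb k; apply: (@wp_mul _ _ _ _ _ _ _ _ n0 hA0 hRB _ _ _ h h) => // g hg.
  by split; ev; frm.
move=> f3 h3 p3 ptr3; rewrite /= in h3.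
have hp : par_of dd E h m1 f3.
  by case: p3 => *; split=> //; frm; rewrite ?e1 ?eA0 ?eRB ?e2'.
apply: wp_seq; apply: (@wp_kc dd E h m1) => // f4 h4 e4; rewrite /= in h4.
have hp4 : par_of dd E h m1 f4.
  by case: hp => *; split; rewrite h4.
pose Pr g := par_of dd E h m1 g /\ sim_par A0 RB kc stride g.
have hPr : Pr f4.
  split=> //; split=> //; [by case: hp4|by case: hp4|].
  by frm; rewrite e2.
apply: wp_seq.
have hsim : getter_ok n d A0 RB mt eps tab (on_coins kc) Pr trY Simulate (time_simulate n kc).
  by apply: (@simulate_ok kc stride) => // g [].
apply: (@wp_fill_blocks R n d A0 RB mt eps tab n0 hA0 hRB (on_coins kc) Pr _ _ false 0
   _ _ _ (time_simulate n kc) m1 m t xs ys) => //.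
- move=> g a b eco e [g1 g2]; split; first by rewrite -e.
  by rewrite -e -eco.
- move=> f' g' e [hp' hs]; split; first exact: (par_of_frame e).
  by case: hs => *; split; rewrite e.
- apply: (@getX_ok R n d A0 RB mt eps tab n0 hA0 hRB _ _ (fun ys a => sa a true = [::] /\
    exists2 N, ys = [seq tval x | x <- coin_samples S theta kc N (co a)] & (N * (n * kc) <= size (co a))%N)).
  + by move=> f' [[]].
  + by rewrite /time_get /time_simulate; lia.
  + by move=> ys' a b -> ->.
- by move=> f' [[]].
- by split=> //=; split=> //; exists NQ.
- by frm; rewrite ptr3.
have ptr4 : f4 vptr = dd.+1 by frm; rewrite ptr3.
move=> b [sb1 [sb2 _]] hb hlow hst; rewrite /= ptr4 in hlow hst hb.
apply: (@wp_tester R n d A0 RB mt eps tab n0 hA0 hRB dd m1 m t (2 ^ dd.+1) (D_of E)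
   (interleave m1 m 0 t xs ys)) => //.
- by apply: (par_frames _ hb hp4).
- by rewrite expn_gt0.
- by apply: size_interleave.
Qed.

End Identity.
End Common.
End Programs.

(** * Runs from the initial configuration *)

Section Runs.
Variable R : realFieldType.

Lemma nth_allpairs_rect (A B V : Type) (g : A -> B -> V) (z : V) (sa : seq A) (sb : seq B)
    (a0 : A) (b0 : B) i j : (i < size sa)%N -> (j < size sb)%N ->
  nth z [seq g a b | a <- sa, b <- sb] (i * size sb + j) = g (nth a0 sa i) (nth b0 sb j).
Proof.
elim: sa i => [|a sa IH] [|i] //= hi hj; rewrite nth_cat size_map.
  by rewrite mul0n hj (nth_map b0).
rewrite mulSn -addnA ltnNge leq_addr /= addKn; exact: IH.
Qed.

Lemma parent_code_lt n (S : rel 'I_n) i (x : n.-tuple bool) :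
  (parent_code S i x < 2 ^ #|parents S i|)%N.
Proof.
pose pa k := [set j in parents S i | (j < k)%N].
pose pc k := (\sum_(j in pa k) tnth x j * 2 ^ #|pa j|)%N.
have pn : pa n = parents S i by apply/setP => j; rewrite !inE ltn_ord andbT.
suff h k : (k <= n)%N -> (pc k < 2 ^ #|pa k|)%N by have := h n (leqnn n); rewrite /pc pn.
elim: k => [|k IH] kn.
  have -> : pa 0%N = set0 by apply/setP => j; rewrite !inE andbF.
  rewrite /pc (_ : pa 0%N = set0) ?big_set0 ?cards0 //.
  by apply/setP => j; rewrite !inE andbF.
pose o := Ordinal kn; have oN : o \notin pa k by rewrite inE /= ltnn andbF.
have [Soi|Soi] := boolP (S o i); last first.
  have -> : pc k.+1 = pc k.
    rewrite /pc (_ : pa k.+1 = pa k) //; apply/setP => j; rewrite !inE ltnS leq_eqVlt.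
    rewrite -[k]/(val o) val_eqE; case: eqVneq => [->|//]; by rewrite (negPf Soi).
  rewrite (_ : pa k.+1 = pa k); first by apply: IH; apply: ltnW.
  apply/setP => j; rewrite !inE ltnS leq_eqVlt.
  by rewrite -[k]/(val o) val_eqE; case: eqVneq => [->|//]; rewrite (negPf Soi).
have e : pa k.+1 = o |: pa k.
  apply/setP => j; rewrite !inE ltnS leq_eqVlt -[k]/(val o) val_eqE.
  by case: eqVneq => [->|//]; rewrite Soi.
have := IH (ltnW kn); rewrite /pc e big_setU1 //= cardsU1 oN expnS mul2n -addnn => h.
rewrite -addnS leq_add // -[X in (_ <= X)%N]mul1n leq_mul2r.
by case: (tnth x o); rewrite orbT.
Qed.

Lemma run_closeness n d (eps : R) E T cs xs ys :
  let dd := minn d n in let h := (4 ^ divup dd 3)%N in let m := m_of n dd E h in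
  let t := t_of n dd in
  (0 < n)%N -> (forall i : nat, (i%:R * eps <= 1) = (i < E)%N) ->
  size xs = (t * (h + m + m))%N -> size ys = (t * (h + m + m))%N ->
  (time_closeness n dd E h + 2 <= T)%N ->
  let c := run T (Finish ClosenessMain) (closeness_input n d eps) cs xs ys in
  [/\ halted c, samples c.2 false = [::], samples c.2 true = [::] &
      answer c = decide R n dd h m t (2 ^ dd.+1) (D_of n E) (interleave h m h t xs ys)].
Proof.
move=> dd h m t n0 hE sxs sys hT c.
pose A0 := (2 + (n + num_vars) * n.+1)%N.
have hm := @closeness_main R n d A0 1 (fun _ _ => false) eps (fun=> 0) n0 isT erefl E cs xs ys
  (fun k => nth 0 [:: eps] (1 + k)) erefl hE sxs sys.
pose inp := closeness_input n d eps.
have hrep : rep n d A0 1 (fun _ _ => false) eps (fun=> 0)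
    (initial (fun k => nth 0 [:: eps] (1 + k)) cs xs ys)
    (start (Finish ClosenessMain) inp cs xs ys).2.
  have far q : nth 0%N [:: n; d] (2 + q) = 0%N by rewrite nth_default.
  split; [split=> // v _; exact: far|move=> q|move=> i j _ _ _; exact: far|by []|by []].
  by rewrite /A0 -addnA; exact: far.
have [b [e1 e2 e3 [hans hs1 hs2]]] := @finish_run R n d A0 1 _ _ _ n0 isT erefl _ _
  (fun u b => [/\ u = decide R n dd h m t (2 ^ dd.+1) (D_of n E) (interleave h m h t xs ys) :> nat,
     sa b false = [::] & sa b true = [::]]) _ _ T hm hrep hT.
have ec : c = iter T (@step R) ([:: Finish ClosenessMain], (start (Finish ClosenessMain) inp cs xs ys).2) by [].
rewrite /halted /answer ec e1 e2 e3 hs1 hs2 hans; split=> //.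
by case: decide.
Qed.

Lemma run_identity n d (eps : R) (S : rel 'I_n) (theta : 'I_n -> nat -> R) (s : 'S_n) E T cs xs :
  let dd := minn d n in let h := (2 ^ divup dd 2)%N in let m1 := (h * h)%N in
  let m := m_of n dd E h in let t := t_of n dd in let kc := kc_of n dd E h m1 in
  let NQ := (t * (m1 + m + m))%N in
  (0 < n)%N -> (forall i : nat, (i%:R * eps <= 1) = (i < E)%N) ->
  topological S s -> (forall i, ~~ S i i) -> (forall i, (#|parents S i| <= d)%N) ->
  size xs = (t * (0 + m + m))%N -> (NQ * (n * kc) <= size cs)%N ->
  (time_identity n d dd E h m1 + 2 <= T)%N ->
  let c := run T (Finish IdentityMain) (identity_input d eps S theta) cs xs [::] in
  [/\ halted c, samples c.2 false = [::], samples c.2 true = [::] &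
      answer c = decide R n dd m1 m t (2 ^ dd.+1) (D_of n E)
        (interleave m1 m 0 t xs [seq tval x | x <- coin_samples S theta kc NQ cs])].
Proof.
move=> dd h m1 m t kc NQ n0 hE top irr hdeg sxs scs hT c.
pose A0 := (2 + (n + num_vars) * n.+1)%N.
pose inp := identity_input d eps S theta.
pose RB := (n * stride n d).+1.
pose M := [seq nat_of_bool (S j i) | i <- enum 'I_n, j <- enum 'I_n].
pose mt i j := nth 0%N M (i * n + j) == 1%N.
pose tab k := nth 0 inp.2 k.+1.
pose f k := nth 0 inp.2 (RB + k).
have sE : size (enum 'I_n) = n by rewrite size_enum_ord.
have sM : size M = (n * n)%N by rewrite size_allpairs sE.
pose i0 : 'I_n := Ordinal n0.
have nM (i j : 'I_n) : nth 0%N M (i * n + j) = S j i.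
  have := @nth_allpairs_rect _ _ _ (fun i j : 'I_n => nat_of_bool (S j i)) 0%N
    (enum 'I_n) (enum 'I_n) i0 i0 i j.
  by rewrite sE !nth_ord_enum; apply.
have hmt (i j : 'I_n) : mt i j = S j i by rewrite /mt nM; case: (S j i).
have htab (i : 'I_n) (x : n.-tuple bool) :
    ((i * stride n d + parent_code S i x).+1 < RB)%N /\
    tab (i * stride n d + parent_code S i x)%N = theta i (parent_code S i x).
  have cl : (parent_code S i x < 2 ^ d)%N.
    by apply: leq_trans (parent_code_lt S i x) _; rewrite leq_exp2l.
  (* A single node has no parent, so its only configuration is 0 and fits the stride 1. *)
  have cs1 : (parent_code S i x < stride n d)%N.
    rewrite /stride; case: ifP => // n1; rewrite ltnS leqn0; apply/eqP.
    rewrite /parent_code big_pred0 // => j; rewrite inE; apply/negbTE.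
    have -> : j = i by apply: ord_inj; have := ltn_ord j; have := ltn_ord i; lia.
    exact: irr.
  split.
    rewrite /RB ltnS; apply: (@leq_trans (i * stride n d + stride n d)%N); first by rewrite ltn_add2l.
    by rewrite -mulSnr leq_mul2r ltn_ord orbT.
  rewrite /tab /inp /=.
  have -> : (i * stride n d)%N = (i * size (iota 0 (2 ^ d)))%N.
    rewrite size_iota /stride; case: ifP => // n1.
    have -> : (i : nat) = 0%N by have := ltn_ord i; lia.
    by rewrite !mul0n.
  rewrite (nth_allpairs_rect _ _ i0 0%N) ?size_iota ?sE //.
  by rewrite nth_ord_enum nth_iota.
have hm := @identity_main R n d A0 RB mt eps tab n0 isT erefl S theta s top hmt htab irr
  E cs xs f erefl hE sxs scs.
have hrep : rep n d A0 RB mt eps tab (initial f cs xs [::])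
    (start (Finish IdentityMain) inp cs xs [::]).2.
  have far q : (n * n <= q)%N -> nth 0%N ([:: n; d] ++ M) (2 + q) = 0%N.
    by move=> hq; rewrite nth_default // size_cat sM leq_add2l.
  have hA : (2 + n * n <= A0)%N by rewrite /A0 leq_add2l leq_mul // leq_addr.
  split=> //.
  - split=> // v _; rewrite /adr /=.
    have [vn|nv] := ltnP v n; last by apply: (far (v * n.+1)%N); rewrite leq_mul.
    rewrite add0n mulnS addnC -[v]/(val (Ordinal vn)) nM.
    by rewrite (negPf (irr _)).
  - move=> q; have -> : (A0 + q = 2 + (A0 - 2 + q))%N by lia.
    by apply: far; lia.
  - move=> i j hi hj _ /=; rewrite add0n.
    by rewrite -[i]/(val (Ordinal hi)) -[j]/(val (Ordinal hj)) hmt nM.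
have [b [e1 e2 e3 [hans hs1 hs2]]] := @finish_run R n d A0 RB _ _ _ n0 isT erefl _ _
  (fun u b => [/\ u = decide R n dd m1 m t (2 ^ dd.+1) (D_of n E)
       (interleave m1 m 0 t xs [seq tval x | x <- coin_samples S theta kc NQ cs]) :> nat,
     sa b false = [::] & sa b true = [::]]) _ _ T hm hrep hT.
have ec : c = iter T (@step R) ([:: Finish IdentityMain], (start (Finish IdentityMain) inp cs xs [::]).2) by [].
rewrite /halted /answer ec e1 e2 e3 hs1 hs2 hans; split=> //.
by case: decide.
Qed.

End Runs.

(** * Acceptance probabilities *)

Section MapSamples.
Variables (R : realFieldType) (T T' : Type) (f : T -> T').

Lemma map_interleave m1 m o t (xs ys : seq T) :
  map f (interleave m1 m o t xs ys) = interleave m1 m o t (map f xs) (map f ys).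
Proof.
elim: t xs ys => //= t IH xs ys.
by rewrite !map_cat IH !map_take !map_drop.
Qed.

Lemma all_exceed_map m1 m (phi : T' -> nat) K (tau : R) t l :
  all_exceed m1 m phi K tau t (map f l) = all_exceed m1 m (phi \o f) K tau t l.
Proof.
apply: eq_all => b; congr (_ < _); rewrite -map_drop /block_stat -!map_drop -!map_take.
by apply: eq_bigr => c _; rewrite /cdiff /cnt !count_map.
Qed.

End MapSamples.

(** * Correctness of the test for the chosen parameters *)

Section TesterAnalysis.
Variables (R : realFieldType) (n : nat).
Hypothesis n0 : (0 < n)%N.
Variables (SP SQ : rel 'I_n) (P Q : {ffun n.-tuple bool -> R}) (dd h m1 E : nat).
Hypotheses (bP : bayes_net SP P) (bQ : bayes_net SQ Q) (same : same_ordering SP SQ)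
  (dP : forall i, (#|parents SP i| <= dd)%N) (dQ : forall i, (#|parents SQ i| <= dd)%N)
  (E0 : (0 < E)%N) (m10 : (0 < m1)%N)
  (hKm : ((2 ^ dd.+1 + m1) ^ 2 <= 9 * h ^ 2 * m1)%N) (hK : (2 ^ dd.+1 + m1 <= 3 * h ^ 2)%N).

Let K := (2 ^ dd.+1)%N.
Let t := (n * (dd + 3))%N.
Let D := (8 * (n * n * (E * E)))%N.
Let m := (600 * (D * D * h * t))%N.
Let tau : R := threshold R m1 m K D.
Let feat (c : nat) (x : n.-tuple bool) : nat := code (digit n c) dd.+1 x.

Definition accept (l : seq (n.-tuple bool)) : bool :=
  ~~ [exists c : 'I_(n ^ dd.+1), all_exceed m1 m (feat c) K tau t l].

Lemma decide_accept l :
  decide R n dd m1 m t K D [seq tval x | x <- l] = accept l.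
Proof.
congr (~~ _); apply/hasP/existsP => [[c]|[c hc]].
  rewrite mem_iota /= add0n all_exceed_map => cn hc.
  by exists (Ordinal cn).
by exists (val c); rewrite ?mem_iota //= all_exceed_map.
Qed.

Let lawP : is_law P. Proof. by case: bP. Qed.
Let lawQ : is_law Q. Proof. by case: bQ. Qed.
Let K0 : (0 < K)%N. Proof. by rewrite expn_gt0. Qed.
Let h0 : (0 < h)%N.
Proof. by rewrite lt0n; apply: contraL hK => /eqP ->; rewrite muln0 -ltnNge addn_gt0 K0. Qed.
Let D0 : (0 < D)%N. Proof. by rewrite !muln_gt0 n0 E0. Qed.
Let t0 : (0 < t)%N. Proof. by rewrite muln_gt0 n0 addn3. Qed.
Let m0 : (0 < m)%N.
Proof.
have f a b c : (0 < a -> 0 < b -> 0 < c -> 0 < 600 * (a * a * b * c))%N.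
  by move=> a0 b0 c0; rewrite !muln_gt0 a0 b0 c0.
exact: f.
Qed.
Let featK c x : (feat c x < K)%N. Proof. exact: code_lt. Qed.

Let tauE : tau = m%:R ^+ 2 / (2 * (K + m1)%:R * D%:R ^+ 2).
Proof.
have KR : (K + m1)%:R != 0 :> R by rewrite pnatr_eq0 -lt0n addn_gt0 K0.
have DR : D%:R != 0 :> R by rewrite pnatr_eq0 -lt0n.
rewrite /tau /threshold [(K + m1 + (K + m1))%:R]natrD.
by move: ((K + m1)%:R) (D%:R) (m%:R) KR DR => k x y hk hx; rewrite -mulr2n -[k *+ 2]mulr_natl; field; rewrite ?hk ?hx.
Qed.

Let nP (k : nat) : (0 < k)%N -> 0 < k%:R :> R. Proof. by rewrite ltr0n. Qed.

(** The condition [hKm] is what brings the error of a single block down to one half, and the size of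
    [t] then pays for the number of tuples. *)
Lemma tester_accepts : (forall x, P x = Q x) ->
  3 / 4 <= Eblocks P Q m1 m t (fun l => (accept l)%:R).
Proof.
move=> ePQ.
have := blocks_null lawP lawQ (m1 := m1) (m := m) t (K := K) (phi := fun c : 'I_(n ^ dd.+1) => feat c)
  (tau := tau) (fun c x => featK c x).
have tau0 : 0 < tau.
  by rewrite tauE divr_gt0 ?exprn_gt0 ?mulr_gt0 ?exprn_gt0 ?nP // addn_gt0 K0.
move/(_ tau0 (fun j c => eq_bigr _ (fun x _ => congr1 (fun z => z * _) (ePQ x)))).
(* With this [tau] the claim reads [144 D ^ 4 (K + m1) ^ 2 <= m ^ 2 (m1 + 1)]. By [hKm] the left
   side is at most [(36 D ^ 2 h) ^ 2 m1], since [144 * 9 = 36 ^ 2], and [m] is at least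
   [36 D ^ 2 h]. *)
have hm : 36 * m%:R ^+ 2 <= tau ^+ 2 * m1.+1%:R.
  have h1 : (K + m1)%:R ^+ 2 <= 9 * h%:R ^+ 2 * m1%:R :> R.
    by rewrite -!natrX -!natrM ler_nat.
  have em : m%:R = 600 * (D%:R ^+ 2 * h%:R * t%:R) :> R by rewrite /m !natrM expr2.
  have t1 : 1 <= t%:R :> R by rewrite ler1n.
  have X0 : 0 < (K + m1)%:R ^+ 2 :> R by rewrite exprn_gt0 // nP // addn_gt0 K0.
  have mR := nP m0; have DR := nP D0; have hR := nP h0; have m1R := nP m10.
  rewrite tauE exprMn exprVn mulrAC ler_pdivlMr; last first.
    by rewrite exprn_gt0 // !mulr_gt0 ?exprn_gt0 ?nP // addn_gt0 K0.
  have -> : 36 * m%:R ^+ 2 * (2 * (K + m1)%:R * D%:R ^+ 2) ^+ 2 =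
     m%:R ^+ 2 * (144 * D%:R ^+ 4 * (K + m1)%:R ^+ 2) :> R by ring.
  have -> : (m%:R ^+ 2) ^+ 2 * m1.+1%:R = m%:R ^+ 2 * (m%:R ^+ 2 * m1.+1%:R) :> R by ring.
  rewrite ler_pM2l ?exprn_gt0 //.
  apply: (le_trans (y := 144 * D%:R ^+ 4 * (9 * h%:R ^+ 2 * m1%:R))).
    by rewrite ler_pM2l // mulr_gt0 // exprn_gt0.
  have -> : 144 * D%:R ^+ 4 * (9 * h%:R ^+ 2 * m1%:R) =
     (36 * (D%:R ^+ 2 * h%:R)) ^+ 2 * m1%:R :> R by ring.
  apply: ler_pM => //; [exact: sqr_ge0| |by rewrite ler_nat].
  have X1 : 0 < D%:R ^+ 2 * h%:R :> R by rewrite mulr_gt0 ?exprn_gt0.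
  rewrite em ler_pXn2r ?nnegrE ?mulr_ge0 ?exprn_ge0 //.
  apply: ler_pM => //; [exact: ltW|by rewrite ler_nat|by rewrite ler_pMr].
move/(_ hm); rewrite card_ord => hb.
(* [n ^ (dd + 1) <= 2 ^ (n (dd + 1))], and the remaining [2 n] in the exponent [t] supply the factor
   [1 / 4]. *)
have hbound : (n ^ dd.+1)%:R * 2^-1 ^+ t <= 4^-1 :> R.
  rewrite exprVn ler_pdivrMr ?exprn_gt0 // ler_pdivlMl //.
  rewrite -natrX -natrM ler_nat /t.
  have -> : (n * (dd + 3) = n * dd.+1 + 2 * n)%N by lia.
  rewrite expnD mulnC leq_mul //; first by rewrite expnM leq_exp2r // ltnW // ltn_expl.
  by rewrite expnM -[4%N]/(4 ^ 1)%N leq_exp2l.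
have -> : Eblocks P Q m1 m t (fun l => (accept l)%:R) =
  1 - Eblocks P Q m1 m t (fun l => [exists c : 'I_(n ^ dd.+1), all_exceed m1 m (feat c) K tau t l]%:R).
  transitivity (Eblocks P Q m1 m t (fun l => 1 + -1 *
      [exists c : 'I_(n ^ dd.+1), all_exceed m1 m (feat c) K tau t l]%:R)).
    by apply: eq_Eblocks => // l; rewrite /accept; case: existsP => _ /=; lra.
  by rewrite EblocksD // EblocksZ // Eblocks_const // mulN1r.
have := le_trans hb hbound; lra.
Qed.

(** By contraposition of [marginals_determine], some tuple has marginals more than [1 / D] apart.
    That tuple has to exceed on all [t] blocks, so a block may err with probability [1 / (4 t)];
    this dictates [l = 1 / (64 t)]. *)
Lemma tester_rejects : E%:R^-1 < l1dist P Q ->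
  3 / 4 <= Eblocks P Q m1 m t (fun l => (~~ accept l)%:R).
Proof.
move=> far.
have [c cn hc] : exists2 c, (c < n ^ dd.+1)%N & (8 * n%:R ^+ 2 * E%:R ^+ 2)^-1 < marginal_dist P Q dd.+1 c.
  have [/forallP all|] := boolP [forall c : 'I_(n ^ dd.+1),
      marginal_dist P Q dd.+1 c <= (8 * n%:R ^+ 2 * E%:R ^+ 2)^-1].
    have := marginals_determine n0 E0 bP bQ same dP dQ (fun c cn => all (Ordinal cn)).
    by rewrite leNgt far.
  by rewrite negb_forall => /existsP[c]; rewrite -ltNge; exists c.
have DE : D%:R = 8 * n%:R ^+ 2 * E%:R ^+ 2 :> R by rewrite /D !natrM; ring.
rewrite -DE in hc.
have mR := nP m0; have DR := nP D0; have hR := nP h0; have m1R := nP m10; have tR := nP t0.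
have KR : 0 < (K + m1)%:R :> R by rewrite nP // addn_gt0 K0.
pose g : R := ((K + m1)%:R * D%:R ^+ 2)^-1.
have g0 : 0 < g by rewrite invr_gt0 mulr_gt0 ?exprn_gt0.
pose l : R := (64 * t%:R)^-1.
have l0 : 0 < l by rewrite invr_gt0 mulr_gt0.
have hg : (K + m1)%:R * g <= (\sum_(b < K) `|mass (feat c) P b - mass (feat c) Q b|) ^+ 2.
  have -> : (K + m1)%:R * g = (D%:R^-1) ^+ 2.
    by rewrite /g; field; rewrite !lt0r_neq0 // -natrD.
  by rewrite ler_pXn2r ?nnegrE ?invr_ge0 // ltW // (lt_trans _ hc) // invr_gt0.
have htau : 2 * tau <= m%:R ^+ 2 * g.
  rewrite tauE /g le_eqVlt; apply/orP; left; apply/eqP; field.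
  by rewrite !lt0r_neq0 // -natrD.
have hb := block_alt lawP lawQ (featK c) K0 m0 g0 l0 hg htau.
(* The estimates [a1] and [a2] add up to [27 + 6 = 33], and [132 * 33 = 66 ^ 2], so the Chebyshev
   part is [(66 / 600) ^ 2 / t]. With [66 / 600 <= 1 / 9] it remains that
   [4 (1 / 81 + 1 / 64) <= 1 / 4]. *)
have hs : 4 * ((4 + 2 / l) * (3 / (m1.+1%:R * g ^+ 2) + 2 / g) / m%:R ^+ 2 + l) <= (4 * t%:R)^-1.
  have h1 : (K + m1)%:R ^+ 2 <= 9 * h%:R ^+ 2 * m1%:R :> R by rewrite -!natrX -!natrM ler_nat.
  have h2 : (K + m1)%:R <= 3 * h%:R ^+ 2 :> R by rewrite -!natrX -!natrM ler_nat.
  have em : m%:R = 600 * (D%:R ^+ 2 * h%:R * t%:R) :> R by rewrite /m !natrM expr2.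
  have D1 : 1 <= D%:R :> R by rewrite ler1n.
  have t1 : 1 <= t%:R :> R by rewrite ler1n.
  have a1 : 3 / (m1.+1%:R * g ^+ 2) <= 27 * (h%:R ^+ 2 * D%:R ^+ 4).
    have -> : 3 / (m1.+1%:R * g ^+ 2) = m1.+1%:R^-1 * (3 * ((K + m1)%:R * D%:R ^+ 2) ^+ 2).
      by rewrite /g exprVn invfM invrK mulrCA.
    rewrite ler_pdivrMl ?ltr0n //.
    apply: (le_trans (y := 3 * (D%:R ^+ 4 * (9 * h%:R ^+ 2 * m1%:R)))).
      have -> : ((K + m1)%:R * D%:R ^+ 2) ^+ 2 = D%:R ^+ 4 * (K + m1)%:R ^+ 2 :> R by ring.
      by rewrite !ler_pM2l ?exprn_gt0.
    have -> : 3 * (D%:R ^+ 4 * (9 * h%:R ^+ 2 * m1%:R)) = m1%:R * (27 * (h%:R ^+ 2 * D%:R ^+ 4)) :> R by ring.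
    by apply: ler_wpM2r; [rewrite !mulr_ge0 ?exprn_ge0|rewrite ler_nat].
  have a2 : 2 / g <= 6 * (h%:R ^+ 2 * D%:R ^+ 4).
    rewrite /g invrK.
    apply: (le_trans (y := 2 * (3 * h%:R ^+ 2 * D%:R ^+ 2))).
      by rewrite ler_pM2l // ler_pM2r ?exprn_gt0.
    have -> : 2 * (3 * h%:R ^+ 2 * D%:R ^+ 2) = 6 * (h%:R ^+ 2 * D%:R ^+ 2) :> R by ring.
    rewrite ler_pM2l // ler_pM2l ?exprn_gt0 //; exact: ler_weXn2l.
  have a3 : 4 + 2 / l <= 132 * t%:R by rewrite /l invrK; lra.
  have a30 : 0 <= 4 + 2 / l by rewrite addr_ge0 // divr_ge0 // ltW.
  have a4 : (4 + 2 / l) * (3 / (m1.+1%:R * g ^+ 2) + 2 / g) <=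
     132 * t%:R * (33 * (h%:R ^+ 2 * D%:R ^+ 4)).
    apply: ler_pM => //; last first.
      move: a1 a2; move: (3 / _) (2 / g) (h%:R ^+ 2 * _) => u v Y a1 a2; lra.
    by rewrite addr_ge0 // divr_ge0 // ?mulr_ge0 ?sqr_ge0 // ltW.
  have w0 : 0 < 600 :> R by rewrite ltr0n.
  have w9 : 66 / 600 <= 9^-1 :> R by rewrite ler_pdivrMr // ler_pdivlMl // -natrM ler_nat.
  have w00 : 0 <= 66 / 600 :> R by rewrite divr_ge0 ?ler0n.
  move: (600 : R) em w0 w9 w00 => w em w0 w9 w00.
  have a5 : (4 + 2 / l) * (3 / (m1.+1%:R * g ^+ 2) + 2 / g) / m%:R ^+ 2 <= (66 / w) ^+ 2 / t%:R.
    rewrite ler_pdivrMr ?exprn_gt0 //; apply: (le_trans a4).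
    rewrite le_eqVlt; apply/orP; left; apply/eqP; rewrite em.
    move: (D%:R) (h%:R) (t%:R) tR => x y z z0; field.
    by rewrite !lt0r_neq0.
  apply: (le_trans (y := 4 * ((66 / w) ^+ 2 / t%:R + l))).
    by rewrite ler_pM2l // lerD2r.
  have -> : 4 * ((66 / w) ^+ 2 / t%:R + l) = (4 * ((66 / w) ^+ 2 + 64^-1)) / t%:R.
    rewrite /l; move: (66 / w) (t%:R) tR => v z z0; field; exact: lt0r_neq0.
  rewrite invfM mulrC [leRHS]mulrC; apply: ler_wpM2l.
    by rewrite invr_ge0 ltW.
  by move: (66 / w) w9 w00 => v; nra.
have hfin := blocks_alt lawP lawQ t (le_trans hb hs).
have hq : t%:R * (4 * t%:R)^-1 = 4^-1 :> R by field; exact: lt0r_neq0.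
rewrite hq in hfin.
apply: (le_trans (y := 1 - Eblocks P Q m1 m t (fun l => (~~ all_exceed m1 m (feat c) K tau t l)%:R))).
  lra.
have -> : 1 - Eblocks P Q m1 m t (fun l => (~~ all_exceed m1 m (feat c) K tau t l)%:R) =
  Eblocks P Q m1 m t (fun l => (all_exceed m1 m (feat c) K tau t l)%:R).
  transitivity (Eblocks P Q m1 m t (fun l => 1 + -1 * (~~ all_exceed m1 m (feat c) K tau t l)%:R)).
    by rewrite EblocksD // EblocksZ // Eblocks_const // mulN1r.
  by apply: eq_Eblocks => // l'; case: all_exceed => /=; lra.
apply: le_Eblocks => // l'; rewrite /accept negbK.
case: (boolP (all_exceed _ _ _ _ _ _ _)) => hc'; last by rewrite ler0n.
rewrite ler_nat; have -> // : [exists c : 'I_(n ^ dd.+1), all_exceed m1 m (feat c) K tau t l'].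
by apply/existsP; exists (Ordinal cn).
Qed.

End TesterAnalysis.

(** * The law of the simulated samples *)

Section CoinLaw.
Variable R : realFieldType.

Definition coin_law : bool -> R := fun=> 2^-1.

Lemma coin_law_is_law : is_law coin_law.
Proof. by split=> [b|]; rewrite /coin_law ?invr_ge0 // big_bool /=; lra. Qed.

Definition unif_below (k : nat) (z : R) : R :=
  Ex coin_law k (fun bs => (unif R bs < z)%R%:R).

(** The last coin is the leading binary digit, so conditioning on it doubles the threshold and
    shifts it by 0 or 1. *)
Lemma unif_belowS k z :
  unif_below k.+1 z = 2^-1 * (unif_below k (2 * z) + unif_below k (2 * z - 1)).
Proof.
rewrite /unif_below -addn1 Ex_cat -ExD -ExZ; apply: eq_Ex => l _.
rewrite /= big_bool /= /coin_law -mulrDr; congr (_ * _).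
rewrite /unif !foldl_cat /= addr0 addrC; congr (_%:R + _%:R).
  by rewrite ltr_pdivrMr // mulrC.
by rewrite ltr_pdivrMr // -ltrBrDr mulrC.
Qed.

Lemma unif_below_le0 k z : z <= 0 -> unif_below k z = 0.
Proof.
elim: k z => [|k IH] z z0; first by rewrite /unif_below /unif /= ltNge z0.
by rewrite unif_belowS !IH ?addr0 ?mulr0 //; lra.
Qed.

Lemma unif_below_ge1 k z : 1 <= z -> unif_below k z = 1.
Proof.
elim: k z => [|k IH] z z1; first by rewrite /unif_below /unif /= (lt_le_trans ltr01 z1).
by rewrite unif_belowS !IH; lra.
Qed.

(** For [z] in the unit interval, one of the thresholds [2 z] and [2 z - 1] lies outside the open
    unit interval, where the value is known exactly. Only the other one carries an error, so each
    coin halves it. *)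
Lemma unif_below_close k z : 0 <= z <= 1 -> `|unif_below k z - z| <= 2^-1 ^+ k.
Proof.
have half : 0 <= 2^-1 :> R by rewrite invr_ge0.
elim: k z => [|k IH] z /andP[z0 z1].
  rewrite /unif_below /unif /= expr0; case: (ltrP 0 z) => h /=.
    by rewrite ger0_norm; lra.
  by have -> : z = 0 by [lra]; rewrite subrr normr0.
rewrite unif_belowS exprS; have [h|h] := lerP (2 * z) 1.
  rewrite (@unif_below_le0 k (2 * z - 1)); last by lra.
  have -> : 2^-1 * (unif_below k (2 * z) + 0) - z = 2^-1 * (unif_below k (2 * z) - 2 * z) by lra.
  by rewrite normrM (ger0_norm half) ler_pM2l ?invr_gt0 //; apply: IH; lra.
rewrite (@unif_below_ge1 k (2 * z)); last by lra.
have -> : 2^-1 * (1 + unif_below k (2 * z - 1)) - z =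
  2^-1 * (unif_below k (2 * z - 1) - (2 * z - 1)) by lra.
by rewrite normrM (ger0_norm half) ler_pM2l ?invr_gt0 //; apply: IH; lra.
Qed.

Lemma unif_below01 k z : 0 <= unif_below k z <= 1.
Proof.
apply/andP; split; first by apply: Ex_ge0 => //; exact: coin_law_is_law.
rewrite -[leRHS](Ex_const k 1 coin_law_is_law); apply: le_Ex => [|l _]; first exact: coin_law_is_law.
by rewrite lern1; case: (_ < _).
Qed.

Lemma Ex_chunks (T : finType) (P : T -> R) k n (phi : 'I_n -> seq T -> R) :
  Ex P (n * k) (fun l => \prod_(i < n) phi i (take k (drop (i * k) l))) =
  \prod_(i < n) Ex P k (phi i).
Proof.
elim: n phi => [|n IH] phi; first by rewrite /= !big_ord0.
rewrite mulSn Ex_cat big_ord_recl -IH -ExZr; apply: eq_Ex => l sl.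
rewrite -ExZ; apply: eq_Ex => l' _.
rewrite big_ord_recl /= mul0n drop0 take_size_cat //; congr (_ * _).
apply: eq_bigr => i _; congr (phi _ (take _ _)).
by rewrite /bump leq0n add1n mulSn addnC -drop_drop drop_size_cat.
Qed.

Variables (n : nat) (S : rel 'I_n) (theta : 'I_n -> nat -> R) (s : 'S_n) (kc : nat).
Hypothesis top : topological S s.

Definition kernel (i : 'I_n) (x : n.-tuple bool) : R := theta i (parent_code S i x).
Definition coin_kernel (i : 'I_n) (x : n.-tuple bool) : R := unif_below kc (kernel i x).

Lemma eq_sample_of (U V : 'I_n -> R) : U =1 V -> sample_of S theta U = sample_of S theta V.
Proof.
move=> e; have h : sample_step S theta U =1 sample_step S theta V.
  by move=> x; apply/eq_from_tnth => i; rewrite /sample_step !tnth_mktuple e.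
by rewrite /sample_of (eq_iter h).
Qed.

(** By [sample_of_eq] the indicator of an outcome is a product over the nodes of conditions on
    disjoint segments of coins. Independence turns its mean into the product law of the rounded
    kernels. *)
Lemma Ex_coin_sample (f : n.-tuple bool -> R) :
  Ex coin_law (n * kc) (fun cs => f (coin_sample S theta kc cs)) =
  \sum_x bern_prod coin_kernel x * f x.
Proof.
transitivity (Ex coin_law (n * kc) (fun cs => \sum_x f x * (coin_sample S theta kc cs == x)%:R)).
  apply: eq_Ex => cs _; rewrite (bigD1 (coin_sample S theta kc cs)) //= eqxx mulr1 big1 ?addr0 //.
  by move=> x; rewrite eq_sym => /negPf ->; rewrite mulr0.
rewrite Ex_sum; apply: eq_bigr => x _; rewrite ExZ mulrC; congr (_ * _).
transitivity (Ex coin_law (n * kc) (fun cs => \prod_(i < n)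
    ((unif R (take kc (drop (i * kc) cs)) < kernel i x) == tnth x i)%:R)).
  apply: eq_Ex => cs _; rewrite /coin_sample (sample_of_eq theta top).
  case: forallP => [h|/forallP].
    by rewrite big1 // => i _; rewrite /kernel h.
  rewrite negb_forall => /existsP[i hi]; rewrite (bigD1 i) //= /kernel (negPf hi).
  by rewrite mul0r.
rewrite (Ex_chunks coin_law kc (fun i bs => ((unif R bs < kernel i x) == tnth x i)%:R)).
apply: eq_bigr => i _; rewrite /bern /coin_kernel /unif_below.
case: (tnth x i); first by apply: eq_Ex => l _; rewrite eqb_id.
transitivity (Ex coin_law kc (fun=> 1) -
  Ex coin_law kc (fun bs => (unif R bs < kernel i x)%R%:R)).
  rewrite -ExB; apply: eq_Ex => l _.
  by rewrite eqbF_neg; case: (_ < _); rewrite ?subr0 ?subrr.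
by rewrite (Ex_const _ _ coin_law_is_law).
Qed.

Lemma coin_sample_cat cs cs' : (n * kc <= size cs)%N ->
  coin_sample S theta kc (cs ++ cs') = coin_sample S theta kc cs.
Proof.
move=> scs; rewrite /coin_sample; apply: eq_sample_of => i; congr (unif R _).
have hi : (i * kc + kc <= n * kc)%N by rewrite -mulSnr leq_mul2r ltn_ord orbT.
rewrite drop_cat; case: ltnP => h; last first.
  have k0 : kc = 0%N by lia.
  by rewrite k0 !take0.
by rewrite takel_cat // size_drop; lia.
Qed.

(** The tape holds one coin per time step, more than the simulation consumes; this separates the
    surplus. *)
Lemma coin_samples_cat N cs cs' : (N * (n * kc) <= size cs)%N ->
  coin_samples S theta kc N (cs ++ cs') = coin_samples S theta kc N cs.
Proof.
elim: N cs => //= N IH cs; rewrite mulSn => scs.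
have h : (n * kc <= size cs)%N := leq_trans (leq_addr _ _) scs.
rewrite coin_sample_cat // drop_cat; case: ltnP => h'.
  by rewrite IH // size_drop leq_subRL.
have e : size cs = (n * kc)%N by lia.
have -> : (n * kc - size cs = 0)%N by lia.
rewrite drop0 drop_oversize //.
by rewrite -[in LHS](cat0s cs') IH //=; lia.
Qed.

Lemma Ex_coin_samples N (f : seq (n.-tuple bool) -> R) :
  Ex coin_law (N * (n * kc)) (fun cs => f (coin_samples S theta kc N cs)) =
  Ex (bern_prod coin_kernel) N f.
Proof.
elim: N f => [|N IH] f //; rewrite mulSn Ex_cat.
transitivity (Ex coin_law (n * kc) (fun cs =>
   (fun x => Ex (bern_prod coin_kernel) N (fun l => f (x :: l))) (coin_sample S theta kc cs))).
  apply: eq_Ex => cs scs; rewrite -(IH (fun l => f (coin_sample S theta kc cs :: l))).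
  by apply: eq_Ex => cs' _ /=; rewrite drop_size_cat // coin_sample_cat ?scs.
by rewrite (Ex_coin_sample (fun x => Ex (bern_prod coin_kernel) N (fun l => f (x :: l)))).
Qed.

Lemma coin_kernel_close (Q : {ffun n.-tuple bool -> R}) :
  describes S theta Q ->
  [/\ is_law (bern_prod coin_kernel), is_law Q &
   \sum_x `|bern_prod coin_kernel x - Q x| <= 2 * n%:R * 2^-1 ^+ kc].
Proof.
move=> [bQ hth].
have k01 i x : 0 <= kernel i x <= 1 by have [] := hth i x.
have Qk := net_factorization bQ (fun i x h => (hth i x).2 h).
have ok : ordered s kernel.
  move=> i x y h; congr theta; apply: eq_parent_code => j /top ji.
  by apply: h; rewrite inE.
have oc : ordered s coin_kernel by move=> i x y h; rewrite /coin_kernel (ok i x y h).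
have c01 i x : 0 <= coin_kernel i x <= 1 by exact: unif_below01.
have lQ : is_law Q by case: bQ.
have lk := bern_prod_law ok k01.
split=> //; first exact: bern_prod_law oc c01.
under eq_bigr do rewrite Qk.
apply: (le_trans (hybrid_bound oc ok c01 k01)).
apply: (le_trans (y := \sum_(i < n) 2 * 2^-1 ^+ kc)); last first.
  by rewrite sumr_const card_ord -mulr_natl; lra.
apply: ler_sum => i _; rewrite ler_pM2l //.
apply: (le_trans (y := \sum_x bern_prod kernel x * 2^-1 ^+ kc)).
  apply: ler_sum => x _; apply: ler_wpM2l; first exact: lk.1.
  by rewrite distrC; apply: unif_below_close.
by rewrite -big_distrl /= lk.2 mul1r.
Qed.

End CoinLaw.

Section AcceptanceProbability.
Variables (R : realFieldType) (n : nat).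
Implicit Types (P Q : {ffun n.-tuple bool -> R}).

Lemma prob_answerE A inp T N N' P Q b
    (G : seq bool -> seq (n.-tuple bool) -> seq (n.-tuple bool) -> bool) :
  (forall cs xs ys, size cs = T -> size xs = N -> size ys = N' ->
     let c := run T A inp cs [seq tval x | x <- xs] [seq tval y | y <- ys] in
     halted c /\ answer c = G cs xs ys) ->
  prob_answer A inp T N N' P Q b =
  Ex (coin_law R) T (fun cs => Ex P N (fun xs => Ex Q N' (fun ys => (G cs xs ys == b)%:R))).
Proof.
move=> hG; rewrite /prob_answer Ex_tuple; apply: eq_bigr => cs _.
rewrite prodr_const card_ord Ex_tuple big_distrr; apply: eq_bigr => x _.
rewrite Ex_tuple !big_distrr [LHS]big_mkcond; apply: eq_bigr => y _ /=.
have [h1 h2] := hG cs x y (size_tuple _) (size_tuple _) (size_tuple _).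
rewrite /tape h1 h2 /=; case: eqP => _; last by rewrite !mulr0.
by rewrite mulr1 mulrA.
Qed.

End AcceptanceProbability.

Lemma confidence (R : realFieldType) : (2 / 3 <= 3 / 4 :> R) /\ (2 / 3 <= 3 / 4 - 16^-1 :> R).
Proof. by split; lra. Qed.

(** * Choice of the parameters and correctness of both algorithms *)

Section Blocks.
Variable R : realType.
Variables (n d : nat) (eps : R).

(** The least [E] with [E * eps > 1], as found by [SetupE]. *)
Definition inv_gap : nat := (Num.truncn eps^-1).+1.
Local Notation dd := (minn d n).
Definition h_identity : nat := (2 ^ divup dd 2)%N.
Definition h_closeness : nat := (4 ^ divup dd 3)%N.
Definition N_identity : nat :=
  (t_of n dd * (0 + m_of n dd inv_gap h_identity + m_of n dd inv_gap h_identity))%N.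
Definition N_closeness : nat :=
  (t_of n dd * (h_closeness + m_of n dd inv_gap h_closeness + m_of n dd inv_gap h_closeness))%N.

Lemma divup_bounds x q : (0 < q)%N -> (x <= q * divup x q < x + q)%N.
Proof.
move=> q0; rewrite /divup; have := divn_eq (x + q.-1) q; have := ltn_pmod (x + q.-1) q0.
by move: (_ %/ q)%N (_ %% q)%N => u v; nia.
Qed.

Lemma h_identity_ok : let m1 := (h_identity * h_identity)%N in
  ((2 ^ dd.+1 + m1) ^ 2 <= 9 * h_identity ^ 2 * m1)%N /\ (2 ^ dd.+1 + m1 <= 3 * h_identity ^ 2)%N.
Proof.
have h : (2 ^ dd <= h_identity ^ 2)%N.
  by rewrite /h_identity -expnM leq_exp2l // mulnC; case/andP: (divup_bounds dd (isT : 0 < 2)%N).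
rewrite (expnS 2 dd); move: (2 ^ dd)%N (h_identity) h => K u h m1; split; last by rewrite /m1; nia.
have h' : (2 * K + m1 <= 3 * u ^ 2)%N by rewrite /m1; nia.
have -> : (9 * u ^ 2 * m1 = (3 * u ^ 2) ^ 2)%N by rewrite /m1; lia.
by rewrite leq_exp2r.
Qed.

(** Everything rests on [(2 ^ dd) ^ 2 <= h ^ 3], the origin of the exponent 2/3: with only [m1 = h]
    reference samples, [K ^ 2 / m1] must be at most of order [h ^ 2]. *)
Lemma h_closeness_ok :
  ((2 ^ dd.+1 + h_closeness) ^ 2 <= 9 * h_closeness ^ 2 * h_closeness)%N /\
  (2 ^ dd.+1 + h_closeness <= 3 * h_closeness ^ 2)%N.
Proof.
have h : ((2 ^ dd) ^ 2 <= h_closeness ^ 3)%N.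
  have -> : ((2 ^ dd) ^ 2 = 4 ^ dd)%N by rewrite -expnM mulnC expnM.
  rewrite /h_closeness -expnM leq_exp2l // mulnC.
  by case/andP: (divup_bounds dd (isT : 0 < 3)%N).
have u0 : (0 < h_closeness)%N by rewrite expn_gt0.
have K0 : (0 < 2 ^ dd)%N by rewrite expn_gt0.
rewrite (expnS 2 dd); move: (2 ^ dd)%N (h_closeness) h u0 K0 => K u h u0 K0.
have Ku : (K <= u ^ 2)%N.
  by rewrite -(@leq_exp2r _ _ 2) // (leq_trans h) // -expnM leq_pexp2l.
have uu : (u <= u ^ 2)%N by rewrite -{1}[u]expn1 leq_pexp2l.
have h2 : (u ^ 2 <= u ^ 3)%N by rewrite leq_pexp2l.
split; last by move: (u ^ 2)%N Ku uu => v; lia.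
have -> : ((2 * K + u) ^ 2 = 4 * K ^ 2 + 2 * (2 * (K * u)) + u ^ 2)%N.
  by rewrite sqrnD expnMn; lia.
have -> : (9 * u ^ 2 * u = 9 * u ^ 3)%N by rewrite -mulnA -expnSr.
have h3 : (2 * (K * u) <= K ^ 2 + u ^ 2)%N by case: (nat_Cauchy K u).
by move: (u ^ 3)%N (u ^ 2)%N (K ^ 2)%N (K * u)%N h h2 h3 => v w x z; lia.
Qed.

Lemma parents_le (S : rel 'I_n) i : (degree S <= d)%N -> (#|parents S i| <= dd)%N.
Proof.
move=> h; rewrite leq_min (leq_trans _ h) /=; last exact: (leq_bigmax i).
by rewrite -[X in (_ <= X)%N](card_ord n) max_card.
Qed.

Lemma parents_le_deg (S : rel 'I_n) i : (degree S <= d)%N -> (#|parents S i| <= d)%N.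
Proof. by move=> h; exact: leq_trans (parents_le i h) (geq_minl _ _). Qed.

(** [N n <= 2 ^ (N n)] absorbs the union over samples and nodes, and the 5 extra digits turn the
    factor 2 into [1 / 16]. *)
Lemma simulation_error (N kc : nat) : kc = (N * n + 5)%N ->
  N%:R * (2 * n%:R * 2^-1 ^+ kc) <= 16^-1 :> R.
Proof.
move=> ->; rewrite exprVn exprD.
have p0 : 0 < 2 ^+ (N * n) :> R by rewrite exprn_gt0.
have h : N%:R * n%:R <= 2 ^+ (N * n) :> R by rewrite -natrM -natrX ler_nat ltnW // ltn_expl.
have -> : N%:R * (2 * n%:R / (2 ^+ (N * n) * 2 ^+ 5)) = 16^-1 * ((N%:R * n%:R) / 2 ^+ (N * n)) :> R.
  by move: (2 ^+ (N * n)) p0 => u u0; field; exact: lt0r_neq0.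
by rewrite ler_piMr ?invr_ge0 // ler_pdivrMr // mul1r.
Qed.

Hypotheses (n0 : (0 < n)%N) (eps0 : 0 < eps) (eps1 : eps <= 1).

Lemma inv_gapP (i : nat) : (i%:R * eps <= 1) = (i < inv_gap)%N.
Proof. by rewrite -ler_pdivlMr // mul1r ltnS truncn_ge_nat // invr_ge0 ltW. Qed.

Lemma inv_gap_lt : inv_gap%:R^-1 < eps.
Proof. by rewrite invf_plt ?posrE ?ltr0n // truncnS_gt. Qed.

Lemma inv_gap_le : inv_gap%:R <= 2 / eps.
Proof.
have h : 1 <= eps^-1 by rewrite invf_ge1.
have : (Num.truncn eps^-1)%:R <= eps^-1 by rewrite -truncn_ge_nat // (le_trans ler01).
by rewrite /inv_gap -natr1; lra.
Qed.

Lemma closeness_run T cs (xs ys : seq (n.-tuple bool)) : size xs = N_closeness -> size ys = N_closeness ->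
  (time_closeness n dd inv_gap h_closeness + 2 <= T)%N ->
  let c := run T (Finish ClosenessMain) (closeness_input n d eps) cs
             [seq tval x | x <- xs] [seq tval y | y <- ys] in
  [/\ halted c, samples c.2 false = [::], samples c.2 true = [::] &
      answer c = accept R dd h_closeness h_closeness inv_gap
        (interleave h_closeness (m_of n dd inv_gap h_closeness) h_closeness (t_of n dd) xs ys)].
Proof.
move=> sxs sys hT.
have := @run_closeness R n d eps inv_gap T cs [seq tval x | x <- xs] [seq tval y | y <- ys]
  n0 inv_gapP.
rewrite !size_map => /(_ sxs sys hT) [h1 h2 h3 h4]; split=> //.
by rewrite h4 -map_interleave decide_accept.
Qed.

Lemma closeness_correct T (SP SQ : rel 'I_n) (P Q : {ffun n.-tuple bool -> R}) :
  (time_closeness n dd inv_gap h_closeness + 2 <= T)%N ->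
  bayes_net SP P -> (degree SP <= d)%N -> bayes_net SQ Q -> (degree SQ <= d)%N ->
  same_ordering SP SQ ->
  let pr := prob_answer (Finish ClosenessMain) (closeness_input n d eps) T N_closeness N_closeness P Q in
  (P = Q -> 2 / 3 <= pr true) /\ (l1dist P Q > eps -> 2 / 3 <= pr false).
Proof.
move=> hT bP dP bQ dQ same pr.
have lP : is_law P by case: bP.
have lQ : is_law Q by case: bQ.
have prE b : pr b = Eblocks P Q h_closeness (m_of n dd inv_gap h_closeness) (t_of n dd)
    (fun l => (accept R dd h_closeness h_closeness inv_gap l == b)%:R).
  rewrite /pr (@prob_answerE _ _ _ _ _ _ _ P Q b (fun _ xs ys => accept R dd h_closeness h_closeness inv_gap
    (interleave h_closeness (m_of n dd inv_gap h_closeness) h_closeness (t_of n dd) xs ys))).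
    rewrite Ex_const; last exact: coin_law_is_law.
    by rewrite -(Ex_interleave _ _ _ lP h_closeness).
  by move=> cs xs ys _ sxs sys; have [h1 _ _ h4] := closeness_run cs sxs sys hT.
have [ok1 ok2] := h_closeness_ok.
have h0 : (0 < h_closeness)%N by rewrite expn_gt0.
have g0 : (0 < inv_gap)%N by [].
have dP' i := parents_le i dP; have dQ' i := parents_le i dQ.
split=> [ePQ|far]; rewrite prE; apply: (le_trans (confidence R).1).
  under eq_Eblocks do rewrite eqb_id.
  exact: (tester_accepts n0 bP bQ g0 h0 ok1 ok2 (fun x => congr1 (fun f : {ffun _} => f x) ePQ)).
under eq_Eblocks do rewrite eqbF_neg.
exact: (tester_rejects n0 bP bQ same dP' dQ' g0 h0 ok1 ok2 (lt_trans inv_gap_lt far)).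
Qed.

Local Notation m1 := (h_identity * h_identity)%N.
Local Notation mI := (m_of n dd inv_gap h_identity).
Definition simulated : nat := (t_of n dd * (m1 + mI + mI))%N.
Definition coins_identity : nat := (simulated * (n * kc_of n dd inv_gap h_identity m1))%N.

Lemma identity_run (S : rel 'I_n) theta T cs (xs : seq (n.-tuple bool)) : is_dag S -> (degree S <= d)%N ->
  (exists s, topological S s) ->
  size xs = N_identity -> (coins_identity <= size cs)%N ->
  (time_identity n d dd inv_gap h_identity m1 + 2 <= T)%N ->
  let c := run T (Finish IdentityMain) (identity_input d eps S theta) cs [seq tval x | x <- xs] [::] in
  [/\ halted c, samples c.2 false = [::], samples c.2 true = [::] &
      answer c = accept R dd h_identity m1 inv_gap
        (interleave m1 mI 0 (t_of n dd) xs
          (coin_samples S theta (kc_of n dd inv_gap h_identity m1) simulated cs))].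
Proof.
move=> dagS dS [s top] sxs scs hT.
have irr i : ~~ S i i by apply/negP => /[dup] /dagS; rewrite connect0.
have := @run_identity R n d eps S theta s inv_gap T cs [seq tval x | x <- xs]
  n0 inv_gapP top irr (fun i => parents_le_deg i dS).
rewrite size_map => /(_ sxs scs hT) [h1 h2 h3 h4]; split=> //.
by rewrite h4 -map_interleave decide_accept.
Qed.

Lemma identity_correct T (SP SQ : rel 'I_n) theta (P Q : {ffun n.-tuple bool -> R}) :
  (time_identity n d dd inv_gap h_identity m1 + 2 + coins_identity <= T)%N ->
  bayes_net SP P -> (degree SP <= d)%N -> describes SQ theta Q -> (degree SQ <= d)%N ->
  same_ordering SP SQ ->
  let pr := prob_answer (Finish IdentityMain) (identity_input d eps SQ theta) T N_identity 0 P Q in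
  (P = Q -> 2 / 3 <= pr true) /\ (l1dist P Q > eps -> 2 / 3 <= pr false).
Proof.
move=> hT bP dP desc dQ same pr.
have bQ := desc.1; have [dagQ _ [s [top _]]] := bQ.
pose acc (l : seq (n.-tuple bool)) := accept R dd h_identity m1 inv_gap l.
pose kc := kc_of n dd inv_gap h_identity m1.
have [lk lQ close] := coin_kernel_close kc top desc.
have lP : is_law P by case: bP.
(* The rounding costs at most [1 / 16], and [3 / 4 - 1 / 16] still exceeds [2 / 3]. *)
have prE b : Eblocks P Q m1 mI (t_of n dd) (fun l => (acc l == b)%:R) - 16^-1 <= pr b.
  rewrite /pr (@prob_answerE _ _ _ _ _ _ _ P Q b (fun cs xs _ => acc (interleave m1 mI 0 (t_of n dd) xs
          (coin_samples SQ theta kc simulated cs)))); last first.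
    move=> cs xs ys scs sxs /size0nil ->.
    have [||h1 _ _ h4] := identity_run theta dagQ dQ (ex_intro _ s top) sxs (T := T) (cs := cs).
    - by rewrite scs; lia.
    - by lia.
    by [].
  (* The coins read by the simulation are split off; those that follow integrate to 1. *)
  have -> : T = (coins_identity + (T - coins_identity))%N by lia.
  rewrite Ex_cat.
  have -> : Ex (coin_law R) coins_identity (fun cs => Ex (coin_law R) (T - coins_identity) (fun cs' =>
      Ex P N_identity (fun xs => Ex Q 0 (fun=> (acc (interleave m1 mI 0 (t_of n dd) xs
          (coin_samples SQ theta kc simulated (cs ++ cs'))) == b)%:R)))) =
    Ex P N_identity (fun xs => Ex (bern_prod (coin_kernel SQ theta kc)) simulated (fun ys =>
      (acc (interleave m1 mI 0 (t_of n dd) xs ys) == b)%:R)).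
    rewrite -[LHS](@eq_Ex _ _ _ _ (fun cs => Ex P N_identity (fun xs => (acc (interleave m1 mI 0 (t_of n dd) xs
          (coin_samples SQ theta kc simulated cs)) == b)%:R))); last first.
      move=> cs scs; rewrite -[LHS](Ex_const (T - coins_identity) _ (coin_law_is_law R)).
      by apply: eq_Ex => cs' _; apply: eq_Ex => xs _ /=; rewrite coin_samples_cat ?scs.
    rewrite Ex_exch; apply: eq_Ex => xs _.
    exact: (Ex_coin_samples theta kc top simulated (fun ys => (acc (interleave m1 mI 0 (t_of n dd) xs ys) == b)%:R)).
  rewrite -(Ex_interleave _ _ _ lP 0) -[16^-1](Ex_const N_identity _ lP) -ExB.
  apply: le_Ex => // xs _; rewrite lerBlDr -lerBlDl.
  apply: (le_trans (ler_norm _)); rewrite distrC.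
  apply: (le_trans (Ex_dist simulated lk lQ _)) => [l|]; first by case: (_ == _); rewrite /= ?normr1 ?normr0.
  apply: (le_trans (ler_wpM2l _ close)); first by rewrite ler0n.
  exact: simulation_error.
have [ok1 ok2] := h_identity_ok.
have h0 : (0 < m1)%N by rewrite muln_gt0 expn_gt0.
have g0 : (0 < inv_gap)%N by [].
have dP' i := parents_le i dP; have dQ' i := parents_le i dQ.
split=> [ePQ|far]; apply: le_trans (prE _); apply: (le_trans (confidence R).2); rewrite lerD2r.
  under eq_Eblocks do rewrite eqb_id.
  exact: (tester_accepts n0 bP bQ g0 h0 ok1 ok2 (fun x => congr1 (fun f : {ffun _} => f x) ePQ)).
under eq_Eblocks do rewrite eqbF_neg.
exact: (tester_rejects n0 bP bQ same dP' dQ' g0 h0 ok1 ok2 (lt_trans inv_gap_lt far)).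
Qed.

End Blocks.

(** * Bounds on time and samples *)

Section PolynomialTime.
Variable N : nat.
Hypothesis N2 : (1 < N)%N.

(** The exponents are generous: as [N >= 2], one more factor [N] absorbs the constant, so bounds
    compose along the syntax of a running time. *)
Lemma pow_sum x y a b : (x <= N ^ a -> y <= N ^ b -> x + y <= N ^ (a + b).+1)%N.
Proof.
move=> hx hy; apply: leq_trans (leq_add hx hy) _.
have N0 : (0 < N)%N by apply: ltnW.
apply: (@leq_trans (2 * N ^ (a + b))%N); last by rewrite expnS leq_mul2r N2 orbT.
by rewrite mul2n -addnn leq_add // leq_pexp2l // ?leq_addr ?leq_addl.
Qed.

Lemma pow_prod x y a b : (x <= N ^ a -> y <= N ^ b -> x * y <= N ^ (a + b))%N.
Proof. by move=> hx hy; rewrite expnD leq_mul. Qed.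

Lemma pow_succ x a : (x <= N ^ a -> x.+1 <= N ^ a.+1)%N.
Proof.
move=> hx; rewrite expnS; apply: (@leq_trans (2 * N ^ a)%N); last by rewrite leq_mul2r N2 orbT.
by rewrite mul2n -addnn -addn1 leq_add // expn_gt0 (ltnW N2).
Qed.

Variable c : nat.
Hypothesis c0 : (0 < c)%N.

(** Here [c] stands for [n ^ d], of which the final bound allows one factor only: in a product a
    single factor may carry it. Hence this second family of rules. *)
Lemma pow_scale x a : (x <= N ^ a -> x <= c * N ^ a)%N.
Proof. by move=> hx; apply: leq_trans hx _; rewrite leq_pmull. Qed.

Lemma pow_scale_prod x y a b : (x <= c * N ^ a -> y <= N ^ b -> x * y <= c * N ^ (a + b))%N.
Proof. by move=> hx hy; rewrite expnD mulnA leq_mul. Qed.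

Lemma pow_scale_sum x y a b : (x <= c * N ^ a -> y <= c * N ^ b -> x + y <= c * N ^ (a + b).+1)%N.
Proof.
move=> hx hy; apply: leq_trans (leq_add hx hy) _.
rewrite -mulnDr leq_mul2l; apply/orP; right; exact: pow_sum.
Qed.

End PolynomialTime.

(** Descends along the expression and lets unification assemble the exponent. *)
Ltac pow_bound := match goal with
  | |- is_true (leq (addn _ _) _) => eapply pow_sum; [assumption|pow_bound|pow_bound]
  | |- is_true (leq (muln _ _) _) => eapply pow_prod; [pow_bound|pow_bound]
  | hc : forall c, is_true (leq c 100) -> _ |- is_true (leq (S _) _) => eapply hc; exact isT
  | |- is_true (leq (S _) _) => eapply pow_succ; [assumption|pow_bound]
  | |- _ => eassumption
  end.

Ltac pow_scale_bound := match goal with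
  | |- is_true (leq (addn _ _) _) =>
      eapply pow_scale_sum; [assumption|pow_scale_bound|pow_scale_bound]
  | |- is_true (leq (muln _ _) _) => eapply pow_scale_prod; [eassumption|pow_bound]
  | |- _ => eapply pow_scale; [assumption|pow_bound]
  end.

Section TimeBounds.

(** All parameters of the running times are polynomial in the number [N] of samples. What remains,
    [n ^ (dd + 1)] and the loop of length [d], is charged to the factor [n ^ d] in [facts_tuples]
    and [facts_edges]. *)
Definition size_facts (n d E h m1 N : nat) : Prop :=
  let dd := minn d n in
  [/\ [/\ (0 < n)%N, (100 <= N)%N, (n <= N)%N & (dd <= N)%N],
      [/\ (E <= N)%N, (D_of n E <= N)%N, (h <= N)%N & (m_of n dd E h <= N)%N] &
      [/\ (t_of n dd <= N)%N, (2 ^ dd.+1 <= N ^ 3)%N & (m1 <= N ^ 2)%N]].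

Variables (n d E h m1 N : nat).
Hypothesis facts : size_facts n d E h m1 N.
Local Notation dd := (minn d n).

Lemma facts_N1 : (1 < N)%N. Proof. by case: facts => [[_ h1 _ _] _ _]; apply: leq_trans h1. Qed.
Lemma facts_n1 : (0 < n)%N. Proof. by case: facts => [[]]. Qed.
Lemma facts_c0 : (0 < n ^ d)%N. Proof. by rewrite expn_gt0 facts_n1. Qed.
Lemma facts_small k : (k <= 100)%N -> (k <= N ^ 1)%N.
Proof. by case: facts => [[_ h1 _ _] _ _] hk; rewrite expn1 (leq_trans hk). Qed.
Lemma facts_large : (3000 <= N ^ 2)%N.
Proof.
case: facts => [[_ h1 _ _] _ _]; apply: (@leq_trans (100 * 100)%N) => //.
by rewrite expnS expn1 leq_mul.
Qed.
Lemma facts_tuples : (n ^ dd.+1 <= n ^ d * N ^ 1)%N.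
Proof.
case: facts => [[_ _ h1 _] _ _]; rewrite expnSr expn1 leq_mul //.
by rewrite leq_pexp2l ?facts_n1 ?geq_minl.
Qed.
(** With two nodes or more, [d < 2 ^ d <= n ^ d]. With a single node [n ^ d = 1] gives no such room,
    and the factor [1 < n] makes the left side 0. *)
Lemma facts_edges : ((1 < n) * d <= n ^ d * N ^ 0)%N.
Proof.
rewrite muln1; have h0 := facts_n1; case: ltnP => h1; rewrite ?mul0n // mul1n.
by apply: (@leq_trans (2 ^ d)%N); [apply: ltnW; exact: ltn_expl|have [->|dp] := posnP d; rewrite ?expn0 // leq_exp2r].
Qed.

End TimeBounds.

(** The exponent is left open and fixed by the derivation of the bound itself. Bounding the sum of
    the two times yields one exponent for both programs. *)
Lemma time_bounds : exists a, forall n d E h m1 N, size_facts n d E h m1 N ->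
  (time_closeness n (minn d n) E h + 2 <= n ^ d * N ^ a)%N /\
  (time_identity n d (minn d n) E h m1 + 2 +
   t_of n (minn d n) * (m1 + m_of n (minn d n) E h + m_of n (minn d n) E h) *
     (n * kc_of n (minn d n) E h m1) <= n ^ d * N ^ a)%N.
Proof.
suff [a ha] : exists a, forall n d E h m1 N, size_facts n d E h m1 N ->
  (time_closeness n (minn d n) E h + 2 +
  (time_identity n d (minn d n) E h m1 + 2 +
   t_of n (minn d n) * (m1 + m_of n (minn d n) E h + m_of n (minn d n) E h) *
     (n * kc_of n (minn d n) E h m1)) <= n ^ d * N ^ a)%N.
  exists a => n d E h m1 N /ha hT.
  by split; apply: leq_trans hT; [exact: leq_addr|exact: leq_addl].
eexists => n d E h m1 N facts.
have N1 := facts_N1 facts; have c0 := facts_c0 facts; have small := facts_small facts.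
have large := facts_large facts; have tuples := facts_tuples facts; have edges := facts_edges facts.
case: facts => [[_ _ nN ddN] [EN DN hN mN] [tN KN m1N]].
have up x : (x <= N)%N -> (x <= N ^ 1)%N by rewrite expn1.
have dv3 : (divup (minn d n) 3 <= N ^ 1)%N.
  by apply: up; apply: leq_trans ddN; rewrite /divup; lia.
have dv2 : (divup (minn d n) 2 <= N ^ 1)%N.
  by apply: up; apply: leq_trans ddN; rewrite /divup; lia.
move: {nN ddN EN DN hN mN tN} (up _ nN) (up _ ddN) (up _ EN) (up _ DN) (up _ hN) (up _ mN) (up _ tN).
rewrite /time_closeness /time_identity /time_simulate /kc_of /time_fill /time_tester /time_test
  /time_zstat /time_code /time_next /time_setup /num_vars.
move: dv2 dv3 edges tuples KN large.
move: (minn d n) (D_of n E) (m_of n _ E h) (t_of n _) (divup _ 3) (divup _ 2)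
  (n ^ _.+1)%N (2 ^ _.+1)%N ((1 < n) * d)%N (n ^ d)%N c0 3000%N.
move=> dd D m t q2 q3 T K e c c0 k3 *.
pow_scale_bound.
Qed.

Lemma leq_m_of n dd E h : (0 < n)%N -> (0 < E)%N -> (h <= m_of n dd E h)%N.
Proof.
move=> n0 E0; have D0 : (0 < D_of n E)%N by rewrite !muln_gt0 n0 E0.
have t0 : (0 < t_of n dd)%N by rewrite muln_gt0 n0 addn3.
have -> : m_of n dd E h = (600 * (D_of n E * D_of n E * h * t_of n dd))%N by [].
move: (D_of n E) (t_of n dd) D0 t0 => D t D0 t0.
rewrite mulnAC [(_ * h)%N]mulnC mulnCA leq_pmulr //.
by rewrite muln_gt0 !muln_gt0 D0 t0.
Qed.

(** [m] is a multiple of [D ^ 2 * h * t] and so dominates every parameter, while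
    [K <= 3 h ^ 2 <= N ^ 3]. *)
Lemma size_factsP n d E h m1 x : let dd := minn d n in
  (0 < n)%N -> (0 < E)%N -> (0 < h)%N -> (2 ^ dd.+1 <= 3 * h ^ 2)%N -> (m1 <= h ^ 2)%N ->
  size_facts n d E h m1 (t_of n dd * (x + m_of n dd E h + m_of n dd E h)).
Proof.
move=> dd n0 E0 h0 hK hm1.
have D0 : (0 < D_of n E)%N by rewrite !muln_gt0 n0 E0.
have t0 : (0 < t_of n dd)%N by rewrite muln_gt0 n0 addn3.
have ED : (E <= D_of n E)%N.
  by rewrite /D_of !mulnA leq_pmull // !muln_gt0 n0 E0.
have nt : (n <= t_of n dd)%N by rewrite /t_of leq_pmulr // addn3.
have dt : (dd <= t_of n dd)%N by rewrite /t_of; apply: leq_trans (leq_pmull _ n0); rewrite leq_addr.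
have mE : m_of n dd E h = (600 * (D_of n E * D_of n E * h * t_of n dd))%N by [].
rewrite /size_facts -/dd.
have hm : (h <= m_of n dd E h)%N := leq_m_of dd h n0 E0.
move: (m_of n dd E h) (t_of n dd) (D_of n E) mE D0 ED nt dt t0 hm => m t D mE D0 ED nt dt t0 hm.
have X0 : (0 < D * D * h * t)%N by rewrite !muln_gt0 D0 h0 t0.
have mX : (D * D * h * t <= m)%N by rewrite mE leq_pmull.
have m100 : (100 <= m)%N.
  by rewrite mE; apply: (@leq_trans (600 * 1)%N) => //; rewrite leq_mul2l X0 orbT.
have Dm : (D <= m)%N by apply: leq_trans mX; rewrite -!mulnA leq_pmulr // !muln_gt0 D0 h0 t0.
set N := (t * _)%N.
have mN : (m <= N)%N by rewrite /N; apply: leq_trans (leq_pmull _ t0); rewrite leq_addl.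
have tN : (t <= N)%N by rewrite /N leq_pmulr //; apply: leq_trans (leq_addl _ _); lia.
have hN := leq_trans hm mN.
have hhN : (h ^ 2 <= N ^ 2)%N by rewrite leq_exp2r.
split; split=> //; try lia.
apply: (leq_trans hK); rewrite [(N ^ 3)%N]expnS leq_mul //; lia.
Qed.

Section SampleBounds.
Variable R : realType.

Lemma powR_root (e q : nat) : (0 < q)%N -> (2 `^ (e%:R / q%:R)) ^+ q = 2 ^+ e :> R.
Proof.
move=> q0; rewrite -powR_mulrn ?powR_ge0 // -powRrM divfK ?powR_mulrn //.
by rewrite pnatr_eq0 -lt0n.
Qed.

Lemma root_bound (h c q e : nat) : (0 < q)%N -> (h ^ q <= c ^ q * 2 ^ e)%N ->
  h%:R <= c%:R * 2 `^ (e%:R / q%:R) :> R.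
Proof.
move=> q0 hc; have p0 : 0 <= c%:R * 2 `^ (e%:R / q%:R) :> R by rewrite mulr_ge0 ?powR_ge0.
rewrite -(@ler_pXn2r _ q) ?nnegrE // exprMn powR_root //.
by rewrite -!natrX -natrM ler_nat.
Qed.

Variables (n d : nat) (eps : R).
Local Notation dd := (minn d n).

Lemma divup_pow b q : (0 < b)%N -> (0 < q)%N -> ((b ^ divup dd q) ^ q <= b ^ q * b ^ d)%N.
Proof.
move=> b0 q0; rewrite -expnM -expnD leq_pexp2l //.
have /andP[_ h] := divup_bounds dd q0; have : (dd <= d)%N by exact: geq_minl.
by rewrite mulnC; lia.
Qed.

Lemma h_identity_le : (h_identity n d)%:R <= 4 * 2 `^ (d%:R / 2) :> R.
Proof.
apply: (le_trans (root_bound (isT : 0 < 2)%N (divup_pow (isT : 0 < 2)%N (isT : 0 < 2)%N))).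
by rewrite ler_wpM2r ?powR_ge0 // ler_nat.
Qed.

Lemma h_closeness_le : (h_closeness n d)%:R <= 4 * 2 `^ (2 * d%:R / 3) :> R.
Proof.
have := @root_bound (h_closeness n d) 4 3 (2 * d) isT.
rewrite natrM; apply; rewrite [(2 ^ (2 * d))%N]expnM.
exact: divup_pow.
Qed.

Hypotheses (n0 : (0 < n)%N) (eps0 : 0 < eps) (eps1 : eps <= 1).

(** With [y = n / eps], the bounds are [4 y ^ 2] for [t], [32 y ^ 2] for [D] and 4 times the power
    of 2 for [h]. At most [3 t m] samples are taken from a source and [m = 600 D ^ 2 h t], whence
    the constant and the degree 8. *)
Definition sample_poly : {poly R} := (4 * (3 * (4 * (600 * (32 * (32 * 4))))))%:P * 'X^8.

Lemma sample_bound h x w : (h%:R <= 4 * w :> R) ->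
  (x <= m_of n dd (inv_gap eps) h)%N ->
  (t_of n dd * (x + m_of n dd (inv_gap eps) h + m_of n dd (inv_gap eps) h))%N%:R <=
  w * sample_poly.[n%:R / eps].
Proof.
move=> hw xm; pose y := n%:R / eps; set E := inv_gap eps in xm *.
have ny : n%:R <= y by rewrite /y ler_peMr // invf_ge1.
have y0 : 0 <= y by rewrite (le_trans _ ny).
have ei : 0 <= eps^-1 by rewrite invr_ge0 ltW.
have ht : (t_of n dd)%:R <= 4 * y ^+ 2.
  apply: (le_trans (y := 4 * n%:R ^+ 2)); last by rewrite ler_pM2l // ler_pXn2r ?nnegrE.
  rewrite -natrX -natrM ler_nat /t_of.
  by have := geq_minr d n; move: dd => k; nia.
have hD : (D_of n E)%:R <= 32 * y ^+ 2.
  have -> : (D_of n E)%:R = 8 * (n%:R * E%:R) ^+ 2 :> R by rewrite /D_of !natrM; ring.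
  have -> : 32 * y ^+ 2 = 8 * (2 * y) ^+ 2 by ring.
  rewrite ler_pM2l // ler_pXn2r ?nnegrE ?mulr_ge0 //.
  rewrite /y mulrCA; apply: ler_wpM2l => //; exact: inv_gap_le.
have mE : m_of n dd E h = (600 * (D_of n E * D_of n E * h * t_of n dd))%N by [].
apply: (le_trans (y := 3 * ((t_of n dd)%:R * (m_of n dd E h)%:R))).
  have -> : 3 * ((t_of n dd)%:R * (m_of n dd E h)%:R) = (3 * (t_of n dd * m_of n dd E h))%N%:R :> R by rewrite !natrM.
  rewrite ler_nat mulnCA leq_mul2l; apply/orP; right.
  by move: (m_of n dd E h) xm => m; lia.
rewrite mE hornerCM hornerXn -/y.
move: (t_of n dd) (D_of n E) ht hD => t D; rewrite !natrM.
move: t%:R D%:R h%:R (ler0n R t) (ler0n R D) (ler0n R h) hw (600%:R) (ler0n R 600).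
move=> {}t {}D u t0 D0 u0 hw c c0 ht hD.
have -> : w * ((4 * (3 * (4 * (c * (32 * (32 * 4)))))) * y ^+ 8) =
  3 * ((4 * y ^+ 2) * (c * ((32 * y ^+ 2) * (32 * y ^+ 2) * (4 * w) * (4 * y ^+ 2)))) by ring.
have DD0 := mulr_ge0 D0 D0; have DDu0 := mulr_ge0 DD0 u0; have DDut0 := mulr_ge0 DDu0 t0.
rewrite ler_pM2l //; apply: (ler_pM t0 (mulr_ge0 c0 DDut0) ht); apply: ler_wpM2l => //.
exact: (ler_pM DDu0 t0 (ler_pM DD0 u0 (ler_pM D0 D0 hD hD) hw) ht).
Qed.

End SampleBounds.

Theorem theorem8p1 (R : realType) :
  (exists (A : cmd) (N T : nat -> nat -> R -> nat) (p q : {poly R}),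
    forall (n d : nat) (eps : R), (0 < n)%N -> 0 < eps -> eps <= 1 ->
      [/\ (N n d eps)%:R <= 2 `^ (d%:R / 2) * p.[n%:R / eps],
          (T n d eps)%:R <= n%:R ^+ d * q.[(N n d eps)%:R] &
          forall (SQ : rel 'I_n) (theta : 'I_n -> nat -> R)
                 (Q : {ffun n.-tuple bool -> R}),
            describes SQ theta Q -> (degree SQ <= d)%N ->
            let inp := identity_input d eps SQ theta in
            takes A inp n (T n d eps) (N n d eps) 0 /\
            forall (SP : rel 'I_n) (P : {ffun n.-tuple bool -> R}),
              bayes_net SP P -> (degree SP <= d)%N -> same_ordering SP SQ ->
              (P = Q ->
               2 / 3 <= prob_answer A inp (T n d eps) (N n d eps) 0 P Q true) /\
              (l1dist P Q > eps ->
               2 / 3 <= prob_answer A inp (T n d eps) (N n d eps) 0 P Q false)])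
  /\
  (exists (A : cmd) (N T : nat -> nat -> R -> nat) (p q : {poly R}),
    forall (n d : nat) (eps : R), (0 < n)%N -> 0 < eps -> eps <= 1 ->
      [/\ (N n d eps)%:R <= 2 `^ (2 * d%:R / 3) * p.[n%:R / eps],
          (T n d eps)%:R <= n%:R ^+ d * q.[(N n d eps)%:R] &
          let inp := closeness_input n d eps in
          takes A inp n (T n d eps) (N n d eps) (N n d eps) /\
          forall (SP SQ : rel 'I_n) (P Q : {ffun n.-tuple bool -> R}),
            bayes_net SP P -> (degree SP <= d)%N ->
            bayes_net SQ Q -> (degree SQ <= d)%N -> same_ordering SP SQ ->
            (P = Q ->
             2 / 3 <= prob_answer A inp (T n d eps) (N n d eps) (N n d eps)
                        P Q true) /\
            (l1dist P Q > eps ->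
             2 / 3 <= prob_answer A inp (T n d eps) (N n d eps) (N n d eps)
                        P Q false)]).
Proof.
have [a ha] := time_bounds.
pose T (N : R -> nat) n d (eps : R) : nat := (n ^ d * N eps ^ a)%N.
split.
(* The time bound itself serves as [T], hence also as the number of coins on the tape; this is why
   [time_bounds] counts the coins of the simulation as well. *)
- exists (Finish IdentityMain), (@N_identity R), (fun n d eps => (n ^ d * N_identity n d eps ^ a)%N),
    (sample_poly R), 'X^a.
  move=> n d eps n0 eps0 eps1.
  have [ok1 ok2] := h_identity_ok n d.
  have h0 : (0 < h_identity n d)%N by rewrite expn_gt0.
  have [_ hT] := ha _ _ _ _ _ _ (@size_factsP n d (inv_gap eps) (h_identity n d)
    (h_identity n d * h_identity n d) 0 n0 isT h0 (leq_trans (leq_addr _ _) ok2) (leqnn _)).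
  split; first exact: (sample_bound n0 eps0 eps1 (h_identity_le R n d)).
    by rewrite hornerXn natrM !natrX.
  move=> SQ theta Q desc dQ inp; split=> [cs x y c|SP P bP dP same].
    have [[dagQ _ [s [top _]]] _] := desc.
    have hc : (coins_identity n d eps <= size cs)%N.
      by rewrite size_tuple; apply: leq_trans hT; exact: leq_addl.
    have ht := leq_trans (leq_addr _ _) hT.
    have [h1 h2 h3 _] := identity_run n0 eps0 theta dagQ dQ (ex_intro _ s top) (size_tuple x) hc ht.
    by rewrite /c (tuple0 y).
  exact: (identity_correct n0 eps0 eps1 hT bP dP desc dQ same).
exists (Finish ClosenessMain), (@N_closeness R), (fun n d eps => (n ^ d * N_closeness n d eps ^ a)%N),
  (sample_poly R), 'X^a.
move=> n d eps n0 eps0 eps1.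
have [ok1 ok2] := h_closeness_ok n d.
have h0 : (0 < h_closeness n d)%N by rewrite expn_gt0.
have [hT _] := ha _ _ _ _ _ _ (@size_factsP n d (inv_gap eps) (h_closeness n d) 0
  (h_closeness n d) n0 isT h0 (leq_trans (leq_addr _ _) ok2) (leq0n _)).
split.
- apply: (sample_bound n0 eps0 eps1 (h_closeness_le R n d)).
  exact: leq_m_of.
- by rewrite hornerXn natrM !natrX.
split=> [cs x y c|SP SQ P Q bP dP bQ dQ same].
  have [h1 h2 h3 _] := closeness_run n0 eps0 cs (size_tuple x) (size_tuple y) hT.
  by [].
exact: (closeness_correct n0 eps0 hT bP dP bQ dQ same).
Qed.
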